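(* Let $A$ be a (unital, complex) Banach algebra and $G$ its group of invertible elements. Let $R_1$ and $R_2$ be rectangles in $\mathbb{C}$ such that their union is again a rectangle. Then for every holomorphic map $f:R_1\cap R_2\to G$ there exist holomorphic maps $f_1:R_1\to G$ and $f_2:R_2\to G$ with $f=f_1^{-1}f_2$ on $R_1\cap R_2$.
   Context: A rectangle in $\mathbb{C}$ is a nonempty open set of the form $\{z\in\mathbb{C}\mid a<\operatorname{Re} z<b,\ c<\operatorname{Im} z<d\}$ with $a,b,c,d\in\mathbb{R}$. A holomorphic map into $G$ is a holomorphic $A$-valued map with values in $G$; $f_1^{-1}$ denotes the pointwise inverse $z\mapsto f_1(z)^{-1}$. *)

(* Defs.v *)
From Stdlib Require Import Reals ClassicalEpsilon.
From Coquelicot Require Import Coquelicot.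
Local Open Scope R_scope.

(** Unital complex Banach algebras: a complex Banach space whose additive group
    carries a ring structure compatible with scalars, with submultiplicative
    norm.  The normalisation [norm one = 1] is not imposed, so algebras with and
    without it (and the zero algebra) are all covered. *)
Record BanachAlgebra := {
  ba_space :> CompleteNormedModule C_AbsRing;
  ba_ring : Ring.mixin_of (CompleteNormedModule.AbelianGroup C_AbsRing ba_space);
  ba_scal_mult_l : forall (c : C) (x y : ba_space),
    Ring.mult _ ba_ring (scal c x) y = scal c (Ring.mult _ ba_ring x y);
  ba_scal_mult_r : forall (c : C) (x y : ba_space),
    Ring.mult _ ba_ring x (scal c y) = scal c (Ring.mult _ ba_ring x y);
  ba_norm_mult : forall x y : ba_space,
    norm (Ring.mult _ ba_ring x y) <= norm x * norm y
}.

(** Makes Coquelicot's [mult], [one] and their lemmas available on elements of a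
    Banach algebra. *)
Canonical BanachAlgebra_Ring (A : BanachAlgebra) : Ring :=
  Ring.Pack A
    (Ring.Class A _ (ba_ring A)) A.

Definition is_inverse {K : Ring} (x y : K) : Prop :=
  mult x y = one /\ mult y x = one.

Definition invertible {K : Ring} (x : K) : Prop := exists y : K, is_inverse x y.

(** The two-sided inverse of [x] (unique when it exists); unspecified when [x] is
    not invertible. *)
Definition inverse {K : Ring} (x : K) : K :=
  epsilon (inhabits zero) (is_inverse x).

Definition is_rectangle (U : C -> Prop) : Prop :=
  (exists z, U z) /\
  exists a b c d : R,
    forall z : C, U z <-> (a < Re z < b /\ c < Im z < d).

(** [f] restricted to the open set [U] is a holomorphic map from [U] to the group
    of invertible elements of [A].  Maps on [U] are represented by total functions
    whose values outside [U] are irrelevant: since [U] is open, complex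
    differentiability at a point of [U] only depends on the values on [U]. *)
Definition holomorphic_into_units {A : BanachAlgebra} (U : C -> Prop) (f : C -> A) : Prop :=
  (forall z : C, U z -> ex_derive (K := C_AbsRing) (V := CompleteNormedModule.NormedModule C_AbsRing A) f z) /\
  (forall z : C, U z -> invertible (f z)).

(* Main.v *)
Require Import Defs.
From Stdlib Require Import Reals Lra Lia ClassicalEpsilon.
From Stdlib Require Import Ncring Ncring_tac.
From Coquelicot Require Import Coquelicot.

(** Write R1 and R2 side by side: R1 to the left, R2 to the right, of the same
    height, overlapping in a rectangle Q.  The general position reduces to this
    one ([rectangle_union_cases]): either one rectangle contains the other and
    the splitting is trivial, or they share a pair of opposite sides, and a
    rotation by a right angle or an exchange of the roles of R1 and R2
    (replacing [f] by its pointwise inverse) brings them into this form.  What has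
    to be found are holomorphic [f1], [f2] with invertible values and
    [f1 * f = f2] on Q.

    The linearised problem is to write a holomorphic [h] on Q as [h2 - h1] with
    [h1] holomorphic to the left and [h2] to the right.  Cauchy's formula solves
    it: the integral over the right side of Q is holomorphic to the left of that
    side, and the three other integrals are holomorphic to the right of the left
    side.  The splitting loses a factor (1 / distance) in norm, which a Newton
    iteration absorbs: if [F = 1 + h] is near 1 then
    [(1 + h1) * F * inv (1 + h2)] equals 1 up to a quadratic error, so the
    procedure converges on rectangles that shrink in steps of
    [eta / 2 ^ (n + 1)] ([cartan_near_one]).

    The assumption that [f] is near 1 is removed by multiplicative Runge
    approximation ([hol_runge]).  A map with invertible values on a rectangle is,
    by contraction of the rectangle to a corner, a product of maps near 1; each
    of these is approximated by [(1 + q / N) ^ N] with [q] entire, which has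
    invertible values on any prescribed bounded set once N is large.  This gives
    the theorem on compact parts of Q ([cartan_compact]).

    Finally the height is exhausted ([cartan_open]).  Two successive solutions
    [(f1, f2)] and [(g1, g2)] differ by the map [g1 * inv f1 = g2 * inv f2], which is
    holomorphic on the whole union; multiplying [g1] and [g2] by an approximate
    inverse of it makes the successive solutions close, so that they converge.
    The width need not be exhausted: a solution on a narrower overlap extends
    by the relation [f1 * f = f2] itself.

    The analytic tools are Goursat's theorem for triangles ([goursat]), Cauchy's
    formula ([cauchy_formula]), Weierstrass's theorem ([weierstrass]) and Runge's
    theorem ([runge]) for functions with values in a Banach algebra on
    rectangles.  Only integrals along segments occur. *)

Local Open Scope R_scope.

(** * Banach algebras: identities, limits and units *)

Declare Scope ba_scope.
Delimit Scope ba_scope with A.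

(** Each operation of the algebra is available through several canonical
    structures.  Fixing one constant per operation gives every term a unique
    form, on which rewriting and the decision procedure for non-commutative rings
    act reliably. *)
Section Operations.
Context {A : BanachAlgebra}.
Definition vadd (x y : A) : A := plus x y.
Definition vopp (x : A) : A := opp x.
Definition vsub (x y : A) : A := minus x y.
Definition vmul (x y : A) : A := mult x y.
Definition vscal (c : C) (x : A) : A := scal c x.
Definition vzero : A := zero.
Definition vone : A := one.
Definition vnorm (x : A) : R := norm x.
End Operations.

Notation "x + y" := (vadd x y) : ba_scope.
Notation "x - y" := (vsub x y) : ba_scope.
Notation "x * y" := (vmul x y) : ba_scope.
Notation "- x" := (vopp x) : ba_scope.
Notation "c ⋅ x" := (vscal c x) (at level 40, left associativity) : ba_scope.
Notation "0" := vzero : ba_scope.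
Notation "1" := vone : ba_scope.
Notation "⟪ x ⟫" := (vnorm x%A) (at level 0, x at level 99, format "⟪ x ⟫").

Section Algebra.
Context {A : BanachAlgebra}.
Implicit Types x y z : A.

Global Instance ba_ring_ops : @Ring_ops A vzero vone vadd vmul vsub vopp eq := {}.

Global Instance ba_is_ring : @Ncring.Ring A _ _ _ _ _ _ _ ba_ring_ops.
Proof.
  constructor.
  - apply eq_equivalence.
  - intros x x' -> y y' ->; reflexivity.
  - intros x x' -> y y' ->; reflexivity.
  - intros x x' -> y y' ->; reflexivity.
  - intros x x' ->; reflexivity.
  - intros x; apply plus_zero_l.
  - intros x y; apply plus_comm.
  - intros x y z; apply plus_assoc.
  - intros x; apply (mult_one_l (K := BanachAlgebra_Ring A)).
  - intros x; apply (mult_one_r (K := BanachAlgebra_Ring A)).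
  - intros x y z; apply (mult_assoc (K := BanachAlgebra_Ring A)).
  - intros x y z; apply (mult_distr_r (K := BanachAlgebra_Ring A)).
  - intros x y z; apply (mult_distr_l (K := BanachAlgebra_Ring A)).
  - intros x y; reflexivity.
  - intros x; exact (plus_opp_r (G := A) x).
Defined.

Lemma scal_mul_l (c : C) x y : (c ⋅ x * y = c ⋅ (x * y))%A.
Proof. apply ba_scal_mult_l. Qed.
Lemma scal_mul_r (c : C) x y : (x * (c ⋅ y) = c ⋅ (x * y))%A.
Proof. apply ba_scal_mult_r. Qed.
Lemma norm_mul x y : ⟪x * y⟫ <= ⟪x⟫ * ⟪y⟫.
Proof. apply ba_norm_mult. Qed.
Lemma scal_scal (c d : C) x : (c ⋅ (d ⋅ x) = (c * d)%C ⋅ x)%A.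
Proof. apply (scal_assoc c d x). Qed.
Lemma scal_1 x : ((RtoC 1) ⋅ x = x)%A.
Proof. apply (scal_one x). Qed.
Lemma scal_add_r (c : C) x y : (c ⋅ (x + y) = c ⋅ x + c ⋅ y)%A.
Proof. apply (scal_distr_l c x y). Qed.
Lemma scal_add_l (c d : C) x : ((c + d)%C ⋅ x = c ⋅ x + d ⋅ x)%A.
Proof. apply (scal_distr_r c d x). Qed.
Lemma scal_0_l x : ((RtoC 0) ⋅ x = 0)%A.
Proof. apply (scal_zero_l x). Qed.

Lemma norm_add x y : ⟪x + y⟫ <= ⟪x⟫ + ⟪y⟫.
Proof. apply (norm_triangle x y). Qed.
Lemma norm_neg x : ⟪- x⟫ = ⟪x⟫.
Proof. apply (norm_opp x). Qed.
Lemma norm_pos x : 0 <= ⟪x⟫.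
Proof. apply (norm_ge_0 x). Qed.
Lemma norm_0 : ⟪(0 : A)⟫ = 0.
Proof. apply (@norm_zero _ A). Qed.
Lemma norm_sub x y : ⟪x - y⟫ <= ⟪x⟫ + ⟪y⟫.
Proof. rewrite <- (norm_neg y). apply (norm_triangle x (opp y)). Qed.
Lemma norm_scale (c : C) x : ⟪c ⋅ x⟫ <= Cmod c * ⟪x⟫.
Proof. apply (norm_scal c x). Qed.
Lemma norm_0_eq x : ⟪x⟫ = 0 -> x = 0%A.
Proof. apply (norm_eq_zero x). Qed.
End Algebra.

Ltac nring := non_commutative_ring.

Section Limits.
Context {A : BanachAlgebra}.
Implicit Types (x y z : A) (u : nat -> A).

Lemma vscal_opp_l (c : C) x : ((- c)%C ⋅ x = - (c ⋅ x))%A.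
Proof. exact (scal_opp_l c x). Qed.
Lemma vscal_opp_r (c : C) x : (c ⋅ (- x) = - (c ⋅ x))%A.
Proof. exact (scal_opp_r c x). Qed.
Lemma scal_sub_r (c : C) x y : (c ⋅ (x - y) = c ⋅ x - c ⋅ y)%A.
Proof.
  replace (x - y)%A with (x + - y)%A by nring.
  rewrite scal_add_r, vscal_opp_r. nring.
Qed.
Lemma scal_sub_l (c d : C) x : ((c - d)%C ⋅ x = c ⋅ x - d ⋅ x)%A.
Proof. unfold Cminus. rewrite scal_add_l, vscal_opp_l. nring. Qed.
Lemma scal_0_r (c : C) : (c ⋅ 0 = (0 : A))%A.
Proof. exact (scal_zero_r c). Qed.

Lemma norm_sub_sym x y : ⟪x - y⟫ = ⟪y - x⟫.
Proof. rewrite <- norm_neg. f_equal. nring. Qed.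
Lemma norm_sub_trans x y z : ⟪x - z⟫ <= ⟪x - y⟫ + ⟪y - z⟫.
Proof. replace (x - z)%A with ((x - y) + (y - z))%A by nring. apply norm_add. Qed.
Lemma norm_le_sub x y : ⟪x⟫ <= ⟪y⟫ + ⟪x - y⟫.
Proof. replace x with (y + (x - y))%A at 1 by nring. apply norm_add. Qed.
Lemma sub_0_eq x y : (x - y = 0)%A -> x = y.
Proof. intros H. replace x with ((x - y) + y)%A by nring. rewrite H. nring. Qed.

Lemma norm_small_eq x y : (forall eps, 0 < eps -> ⟪x - y⟫ <= eps) -> x = y.
Proof.
  intros H. apply sub_0_eq, norm_0_eq.
  destruct (Rle_lt_or_eq_dec _ _ (norm_pos (x - y)%A)) as [H0 | H0]; [|now symmetry].
  specialize (H (⟪x - y⟫ / 2)). lra.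
Qed.

Definition converges u x := forall eps, 0 < eps -> exists N, forall n, (N <= n)%nat -> ⟪u n - x⟫ <= eps.

Lemma converges_unique u x y : converges u x -> converges u y -> x = y.
Proof.
  intros Hx Hy. apply norm_small_eq. intros eps Heps.
  destruct (Hx (eps / 2)) as [N HN]; [lra|]. destruct (Hy (eps / 2)) as [M HM]; [lra|].
  specialize (HN (N + M)%nat ltac:(lia)). specialize (HM (N + M)%nat ltac:(lia)).
  pose proof (norm_sub_trans x (u (N + M)%nat) y) as H. rewrite (norm_sub_sym x (u _)) in H. lra.
Qed.

Lemma converges_ext u u' x N :
  (forall n, (N <= n)%nat -> u n = u' n) -> converges u x -> converges u' x.
Proof.
  intros E H eps Heps. destruct (H eps Heps) as [M HM].
  exists (N + M)%nat. intros n Hn. rewrite <- E by lia. apply HM; lia.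
Qed.

(** The difference of products is [x n * (y n - b) + (x n - a) * b], and [x n] is
    eventually bounded by [norm a + 1]. *)
Lemma converges_mul (x y : nat -> A) (a b : A) :
  converges x a -> converges y b -> converges (fun n => x n * y n)%A (a * b)%A.
Proof.
  intros Hx Hy eps Heps.
  pose proof (norm_pos a) as Ha. pose proof (norm_pos b) as Hb.
  destruct (Hx (Rmin 1 (eps / 2 / (⟪b⟫ + 1)))) as [N HN].
  { apply Rmin_glb_lt; [lra|]. apply Rdiv_lt_0_compat; lra. }
  destruct (Hy (eps / 2 / (⟪a⟫ + 1))) as [M HM]; [apply Rdiv_lt_0_compat; lra|].
  exists (N + M)%nat. intros n Hn.
  specialize (HN n ltac:(lia)). specialize (HM n ltac:(lia)).
  pose proof (Rmin_l 1 (eps / 2 / (⟪b⟫ + 1))). pose proof (Rmin_r 1 (eps / 2 / (⟪b⟫ + 1))).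
  replace (x n * y n - a * b)%A with (x n * (y n - b) + (x n - a) * b)%A by nring.
  pose proof (norm_le_sub (x n) a) as Hxa.
  assert (⟪x n * (y n - b)⟫ <= (⟪a⟫ + 1) * (eps / 2 / (⟪a⟫ + 1))).
  { eapply Rle_trans; [apply norm_mul|]. apply Rmult_le_compat; auto using norm_pos. lra. }
  assert (⟪(x n - a) * b⟫ <= eps / 2 / (⟪b⟫ + 1) * (⟪b⟫ + 1)).
  { eapply Rle_trans; [apply norm_mul|]. apply Rmult_le_compat; auto using norm_pos; lra. }
  replace ((⟪a⟫ + 1) * (eps / 2 / (⟪a⟫ + 1))) with (eps / 2) in * by (field; lra).
  replace (eps / 2 / (⟪b⟫ + 1) * (⟪b⟫ + 1)) with (eps / 2) in * by (field; lra).
  eapply Rle_trans; [apply norm_add|]. lra.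
Qed.

Lemma converges_const x : converges (fun _ => x) x.
Proof.
  intros eps Heps. exists 0%nat. intros n _.
  replace (x - x)%A with (0 : A)%A by nring. rewrite norm_0. lra.
Qed.

Lemma converges_mul_r u x y : converges u x -> converges (fun n => u n * y)%A (x * y)%A.
Proof. intros H. apply (converges_mul u (fun _ => y)); [exact H | apply converges_const]. Qed.

Lemma converges_mul_l u x y : converges u x -> converges (fun n => y * u n)%A (y * x)%A.
Proof. intros H. apply (converges_mul (fun _ => y) u); [apply converges_const | exact H]. Qed.

Lemma converges_norm_le u x y M :
  converges u x -> (forall n, ⟪u n - y⟫ <= M) -> ⟪x - y⟫ <= M.
Proof.
  intros H HM. apply Rnot_lt_le. intros Hlt.
  destruct (H ((⟪x - y⟫ - M) / 2)) as [N HN]; [lra|].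
  specialize (HN N (le_n _)). specialize (HM N).
  pose proof (norm_sub_trans x (u N) y) as H'. rewrite (norm_sub_sym x (u _)) in H'. lra.
Qed.

Lemma complete u :
  (forall eps, 0 < eps -> exists N, forall n, (N <= n)%nat -> ⟪u n - u N⟫ <= eps) ->
  exists x, converges u x.
Proof.
  intros H.
  destruct (proj1 (filterlim_locally_cauchy (U := ba_space A) (F := eventually) u)) as [x Hx].
  { intros eps. destruct (H (eps / 3)) as [N HN]; [destruct eps; simpl; lra|].
    exists (fun n => (N <= n)%nat). split; [now exists N|].
    intros n m Hn Hm. apply (norm_compat1 (V := ba_space A)).
    change (⟪u m - u n⟫ < eps).
    pose proof (norm_sub_trans (u m) (u N) (u n)) as H'. rewrite (norm_sub_sym (u N)) in H'.
    specialize (HN n Hn) as H1. specialize (HN m Hm) as H2. destruct eps; simpl in *; lra. }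
  exists x. intros eps Heps.
  pose proof (@norm_factor_gt_0 _ (ba_space A)) as Hf.
  assert (He : 0 < eps / @norm_factor _ (ba_space A)) by now apply Rdiv_lt_0_compat.
  destruct (Hx _ (locally_ball x (mkposreal _ He))) as [N HN].
  exists N. intros n Hn. specialize (HN n Hn). apply (norm_compat2 (V := ba_space A)) in HN.
  simpl in HN. apply Rlt_le. eapply Rlt_le_trans; [exact HN|]. right. field. lra.
Qed.

(** The one form in which completeness is used: increments dominated by a
    geometric sequence, with the explicit distance to the limit. *)
Lemma complete_geometric u C q :
  0 <= q < 1 -> (forall n, ⟪u (S n) - u n⟫ <= C * q ^ n) ->
  exists x, converges u x /\ forall n, ⟪x - u n⟫ <= C / (1 - q) * q ^ n.
Proof.
  intros Hq H.
  assert (HC : 0 <= C).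
  { specialize (H 0%nat). pose proof (norm_pos (u 1%nat - u 0%nat)%A). simpl in H. lra. }
  assert (HK : 0 <= C / (1 - q)) by (apply Rcomplements.Rdiv_le_0_compat; lra).
  assert (Hk : forall k n, ⟪u (n + k)%nat - u n⟫ <= C / (1 - q) * (q ^ n - q ^ (n + k))).
  { induction k as [|k IH]; intros n.
    - rewrite Nat.add_0_r. replace (u n - u n)%A with (0 : A)%A by nring. rewrite norm_0. lra.
    - rewrite <- plus_n_Sm. eapply Rle_trans; [apply (norm_sub_trans _ (u (n + k)%nat))|].
      specialize (IH n). specialize (H (n + k)%nat).
      replace (C * q ^ (n + k)) with (C / (1 - q) * (q ^ (n + k) - q ^ S (n + k))) in H
        by (simpl; field; lra). lra. }
  assert (Hk' : forall k n, ⟪u (n + k)%nat - u n⟫ <= C / (1 - q) * q ^ n).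
  { intros k n. eapply Rle_trans; [apply Hk|]. apply Rmult_le_compat_l; [exact HK|].
    pose proof (pow_le q (n + k) (proj1 Hq)). lra. }
  destruct (complete u) as [x Hx].
  { intros eps Heps.
    destruct (pow_lt_1_zero q ltac:(rewrite Rabs_pos_eq; lra) (eps / (C / (1 - q) + 1))) as [N HN].
    { apply Rdiv_lt_0_compat; lra. }
    exists N. intros n Hn. replace n with (N + (n - N))%nat by lia.
    eapply Rle_trans; [apply Hk'|]. specialize (HN N (le_n _)).
    pose proof (pow_le q N (proj1 Hq)). rewrite Rabs_pos_eq in HN by assumption.
    apply Rle_trans with ((C / (1 - q) + 1) * (eps / (C / (1 - q) + 1))).
    - apply Rmult_le_compat; lra.
    - right. field. lra. }
  exists x. split; [exact Hx|]. intros n.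
  apply converges_norm_le with (u := fun k => u (n + k)%nat).
  - intros eps Heps. destruct (Hx eps Heps) as [N HN]. exists N. intros k Hkn. apply HN. lia.
  - intros k. apply Hk'.
Qed.
End Limits.

Section Units.
Context {A : BanachAlgebra}.
Implicit Types x y z : A.

Definition is_unit x := invertible (K := BanachAlgebra_Ring A) x.
Definition inv x : A := inverse (K := BanachAlgebra_Ring A) x.

Lemma unit_intro x y : (x * y = 1)%A -> (y * x = 1)%A -> is_unit x.
Proof. intros H1 H2. exists y. split; assumption. Qed.

Lemma inv_spec x : is_unit x -> (x * inv x = 1)%A /\ (inv x * x = 1)%A.
Proof. intros [y Hy]. exact (epsilon_spec (inhabits zero) (is_inverse (K := BanachAlgebra_Ring A) x) (ex_intro _ y Hy)). Qed.
Lemma inv_r x : is_unit x -> (x * inv x = 1)%A.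
Proof. apply inv_spec. Qed.
Lemma inv_l x : is_unit x -> (inv x * x = 1)%A.
Proof. apply inv_spec. Qed.

Lemma unit_inv x : is_unit x -> is_unit (inv x).
Proof. intros H. apply (unit_intro _ x); [apply inv_l | apply inv_r]; exact H. Qed.
Lemma unit_1 : is_unit (1 : A)%A.
Proof. apply (unit_intro _ (1 : A)%A); nring. Qed.
Lemma unit_mul x y : is_unit x -> is_unit y -> is_unit (x * y)%A.
Proof.
  intros Hx Hy. apply (unit_intro _ (inv y * inv x)%A).
  - replace (x * y * (inv y * inv x))%A with (x * (y * inv y) * inv x)%A by nring.
    rewrite (inv_r y Hy). replace (x * 1 * inv x)%A with (x * inv x)%A by nring. now apply inv_r.
  - replace (inv y * inv x * (x * y))%A with (inv y * (inv x * x) * y)%A by nring.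
    rewrite (inv_l x Hx). replace (inv y * 1 * y)%A with (inv y * y)%A by nring. now apply inv_l.
Qed.
Lemma unit_cancel_l x y z : is_unit x -> (x * y = x * z)%A -> y = z.
Proof.
  intros Hx H. replace y with (1 * y)%A by nring. replace z with (1 * z)%A by nring.
  rewrite <- (inv_l x Hx).
  replace (inv x * x * y)%A with (inv x * (x * y))%A by nring. rewrite H. nring.
Qed.

Fixpoint vpow x n : A := match n with O => 1%A | S n => (x * vpow x n)%A end.

Lemma vpow_comm x n : (vpow x n * x = x * vpow x n)%A.
Proof.
  induction n as [|n IH]; simpl; [nring|].
  replace (x * vpow x n * x)%A with (x * (vpow x n * x))%A by nring. now rewrite IH.
Qed.

Lemma norm_vpow x n : ⟪vpow x n⟫ <= ⟪(1 : A)%A⟫ * ⟪x⟫ ^ n.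
Proof.
  induction n as [|n IH]; simpl; [lra|].
  eapply Rle_trans; [apply norm_mul|].
  replace (⟪(1 : A)%A⟫ * (⟪x⟫ * ⟪x⟫ ^ n)) with (⟪x⟫ * (⟪(1 : A)%A⟫ * ⟪x⟫ ^ n)) by ring.
  apply Rmult_le_compat_l; auto using norm_pos.
Qed.

(** Neumann series for [- x]. *)
Lemma unit_1_add x : ⟪x⟫ < 1 -> is_unit (1 + x)%A.
Proof.
  intros Hx. set (y := (- x)%A).
  assert (Hy : 0 <= ⟪y⟫ < 1) by (unfold y; rewrite norm_neg; split; [apply norm_pos | exact Hx]).
  set (s := fix s n : A := match n with O => 0%A | S n => (s n + vpow y n)%A end).
  destruct (complete_geometric s ⟪(1 : A)%A⟫ ⟪y⟫ Hy) as [l [Hl _]].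
  { intros n. replace (s (S n) - s n)%A with (vpow y n) by (simpl; nring). apply norm_vpow. }
  assert (H0 : converges (fun n => 1 - vpow y n)%A (1 : A)%A).
  { intros eps Heps.
    destruct (pow_lt_1_zero ⟪y⟫ ltac:(rewrite Rabs_pos_eq; lra) (eps / (⟪(1 : A)%A⟫ + 1))) as [N HN].
    { apply Rdiv_lt_0_compat; [lra|]. pose proof (norm_pos (1 : A)%A); lra. }
    exists N. intros n Hn. specialize (HN n Hn).
    pose proof (pow_le ⟪y⟫ n (proj1 Hy)). rewrite Rabs_pos_eq in HN by assumption.
    replace (1 - vpow y n - 1)%A with (- vpow y n)%A by nring. rewrite norm_neg.
    eapply Rle_trans; [apply norm_vpow|]. pose proof (norm_pos (1 : A)%A).
    apply Rle_trans with ((⟪(1 : A)%A⟫ + 1) * (eps / (⟪(1 : A)%A⟫ + 1))).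
    - apply Rmult_le_compat; lra.
    - right. field. lra. }
  assert (Hs : forall n, ((1 + x) * s n = 1 - vpow y n)%A /\ (s n * (1 + x) = 1 - vpow y n)%A).
  { induction n as [|n [IH1 IH2]]; simpl; [split; nring|]. split.
    - replace ((1 + x) * (s n + vpow y n))%A with ((1 + x) * s n + vpow y n + x * vpow y n)%A by nring.
      rewrite IH1. unfold y; nring.
    - replace ((s n + vpow y n) * (1 + x))%A with (s n * (1 + x) + vpow y n - vpow y n * y)%A
        by (unfold y; nring).
      rewrite IH2, vpow_comm. nring. }
  apply (unit_intro _ l).
  - apply (converges_unique (fun n => 1 - vpow y n)%A); [|exact H0].
    apply (converges_ext (fun n => (1 + x) * s n)%A _ _ 0); [intros; apply Hs|].
    now apply converges_mul_l.
  - apply (converges_unique (fun n => 1 - vpow y n)%A); [|exact H0].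
    apply (converges_ext (fun n => s n * (1 + x))%A _ _ 0); [intros; apply Hs|].
    now apply converges_mul_r.
Qed.

(** Bounds the norm of [inv (1 + x) * z] by that of [z]; since the norm of 1
    may exceed 1, there is no such bound for [inv (1 + x)] itself. *)
Lemma norm_div_l x y : ⟪x⟫ <= 1 / 2 -> ⟪y⟫ <= 2 * ⟪(1 + x) * y⟫.
Proof.
  intros Hx.
  assert (H : ⟪x * y⟫ <= 1 / 2 * ⟪y⟫).
  { eapply Rle_trans; [apply norm_mul|]. apply Rmult_le_compat_r; auto using norm_pos. }
  assert (H' : ⟪y⟫ <= ⟪(1 + x) * y⟫ + ⟪x * y⟫).
  { replace y with ((1 + x) * y - x * y)%A at 1 by nring. apply norm_sub. }
  pose proof (norm_sub ((1 + x) * y)%A (x * y)%A). lra.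
Qed.

Lemma norm_div_r x y : ⟪x⟫ <= 1 / 2 -> ⟪y⟫ <= 2 * ⟪y * (1 + x)⟫.
Proof.
  intros Hx.
  assert (H : ⟪y * x⟫ <= 1 / 2 * ⟪y⟫).
  { eapply Rle_trans; [apply norm_mul|]. rewrite Rmult_comm.
    apply Rmult_le_compat_r; auto using norm_pos. }
  assert (H' : ⟪y⟫ <= ⟪y * (1 + x)⟫ + ⟪y * x⟫).
  { replace y with (y * (1 + x) - y * x)%A at 1 by nring. apply norm_sub. }
  lra.
Qed.

(** [y = x * (1 + inv x * (y - x))], so that the units form an open set on which
    the inverse is locally bounded. *)
Lemma unit_near x y : is_unit x -> ⟪inv x⟫ * ⟪y - x⟫ <= 1 / 2 -> is_unit y /\ ⟪inv y⟫ <= 2 * ⟪inv x⟫.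
Proof.
  intros Hx H. set (u := (inv x * (y - x))%A).
  assert (Hu : ⟪u⟫ <= 1 / 2) by (eapply Rle_trans; [apply norm_mul | exact H]).
  assert (Ey : y = (x * (1 + u))%A).
  { unfold u. replace (x * (1 + inv x * (y - x)))%A with (x + (x * inv x) * (y - x))%A by nring.
    rewrite inv_r by assumption. nring. }
  assert (Uy : is_unit y).
  { rewrite Ey. apply unit_mul; [exact Hx|]. apply unit_1_add. lra. }
  split; [exact Uy|]. eapply Rle_trans; [apply (norm_div_l u), Hu|].
  right. do 2 f_equal. apply (unit_cancel_l x _ _ Hx).
  replace (x * ((1 + u) * inv y))%A with (x * (1 + u) * inv y)%A by nring.
  rewrite <- Ey, !inv_r; auto.
Qed.
End Units.

(** * Complex differentiability *)

Section Calculus.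
Context {A : BanachAlgebra}.
Implicit Types (f g : C -> A) (z w a : C).

Definition ccont f z := forall eps, 0 < eps -> exists d, 0 < d /\
  forall w, Cmod (w - z) < d -> ⟪f w - f z⟫ <= eps.

(** Caratheodory's form of differentiability: the difference quotient extends
    continuously to [z].  Products, inverses and composites are then handled by
    algebra and continuity alone.  [cdiff_ex_derive] identifies it with
    [ex_derive]. *)
Definition cdiff f z := exists phi d, 0 < d /\ ccont phi z /\
  forall w, Cmod (w - z) < d -> (f w = f z + (w - z)%C ⋅ phi w)%A.

Lemma Cmod_self z : Cmod (z - z) = 0.
Proof. replace (z - z)%C with (RtoC 0) by ring. apply Cmod_0. Qed.

Lemma ccont_local f g z d : 0 < d -> (forall w, Cmod (w - z) < d -> f w = g w) ->
  ccont f z -> ccont g z.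
Proof.
  intros Hd E H eps Heps. destruct (H eps Heps) as [e [He Hf]].
  exists (Rmin d e). split; [now apply Rmin_glb_lt|]. intros w Hw.
  rewrite <- !E.
  - apply Hf. eapply Rlt_le_trans; [exact Hw | apply Rmin_r].
  - rewrite Cmod_self. exact Hd.
  - eapply Rlt_le_trans; [exact Hw | apply Rmin_l].
Qed.

Lemma ccont_bounded f z : ccont f z -> exists d M, 0 < d /\ 0 < M /\
  forall w, Cmod (w - z) < d -> ⟪f w⟫ <= M.
Proof.
  intros H. destruct (H 1 Rlt_0_1) as [d [Hd Hf]].
  exists d, (⟪f z⟫ + 1). pose proof (norm_pos (f z)). split; [|split]; try lra.
  intros w Hw. specialize (Hf w Hw). pose proof (norm_le_sub (f w) (f z)). lra.
Qed.

Lemma ccont_const (x : A) z : ccont (fun _ => x) z.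
Proof.
  intros eps Heps. exists 1. split; [lra|]. intros w _.
  replace (x - x)%A with (0 : A)%A by nring. rewrite norm_0. lra.
Qed.

Lemma ccont_add f g z : ccont f z -> ccont g z -> ccont (fun w => f w + g w)%A z.
Proof.
  intros Hf Hg eps Heps.
  destruct (Hf (eps / 2)) as [d [Hd Hfd]]; [lra|]. destruct (Hg (eps / 2)) as [e [He Hge]]; [lra|].
  exists (Rmin d e). split; [now apply Rmin_glb_lt|]. intros w Hw.
  replace (f w + g w - (f z + g z))%A with ((f w - f z) + (g w - g z))%A by nring.
  eapply Rle_trans; [apply norm_add|].
  specialize (Hfd w (Rlt_le_trans _ _ _ Hw (Rmin_l _ _))).
  specialize (Hge w (Rlt_le_trans _ _ _ Hw (Rmin_r _ _))). lra.
Qed.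

Lemma ccont_mul f g z : ccont f z -> ccont g z -> ccont (fun w => f w * g w)%A z.
Proof.
  intros Hf Hg eps Heps.
  destruct (ccont_bounded g z Hg) as [d0 [M [Hd0 [HM Hb]]]].
  pose proof (norm_pos (f z)) as Hfz.
  destruct (Hf (eps / 2 / M)) as [d [Hd Hfd]]; [apply Rdiv_lt_0_compat; lra|].
  destruct (Hg (eps / 2 / (⟪f z⟫ + 1))) as [e [He Hge]]; [apply Rdiv_lt_0_compat; lra|].
  exists (Rmin d0 (Rmin d e)). split; [repeat apply Rmin_glb_lt; assumption|]. intros w Hw.
  assert (H1 : Cmod (w - z) < d0) by (eapply Rlt_le_trans; [exact Hw | apply Rmin_l]).
  assert (H2 : Cmod (w - z) < Rmin d e) by (eapply Rlt_le_trans; [exact Hw | apply Rmin_r]).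
  specialize (Hfd w (Rlt_le_trans _ _ _ H2 (Rmin_l _ _))).
  specialize (Hge w (Rlt_le_trans _ _ _ H2 (Rmin_r _ _))). specialize (Hb w H1).
  replace (f w * g w - f z * g z)%A with ((f w - f z) * g w + f z * (g w - g z))%A by nring.
  eapply Rle_trans; [apply norm_add|].
  assert (⟪(f w - f z) * g w⟫ <= eps / 2 / M * M).
  { eapply Rle_trans; [apply norm_mul|]. apply Rmult_le_compat; auto using norm_pos. }
  assert (⟪f z * (g w - g z)⟫ <= (⟪f z⟫ + 1) * (eps / 2 / (⟪f z⟫ + 1))).
  { eapply Rle_trans; [apply norm_mul|]. apply Rmult_le_compat; auto using norm_pos. lra. }
  replace (eps / 2 / M * M) with (eps / 2) in * by (field; lra).
  replace ((⟪f z⟫ + 1) * (eps / 2 / (⟪f z⟫ + 1))) with (eps / 2) in * by (field; lra).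
  lra.
Qed.

Lemma ccont_scal (c : C) f z : ccont f z -> ccont (fun w => c ⋅ f w)%A z.
Proof.
  intros Hf eps Heps. pose proof (Cmod_ge_0 c).
  destruct (Hf (eps / (Cmod c + 1))) as [d [Hd Hfd]]; [apply Rdiv_lt_0_compat; lra|].
  exists d. split; [exact Hd|]. intros w Hw. rewrite <- scal_sub_r.
  eapply Rle_trans; [apply norm_scale|].
  apply Rle_trans with ((Cmod c + 1) * (eps / (Cmod c + 1))).
  - apply Rmult_le_compat; auto using norm_pos. lra.
  - right; field; lra.
Qed.

Lemma ccont_opp f z : ccont f z -> ccont (fun w => - f w)%A z.
Proof.
  intros Hf eps Heps. destruct (Hf eps Heps) as [d [Hd H]].
  exists d. split; [exact Hd|]. intros w Hw.
  replace (- f w - - f z)%A with (- (f w - f z))%A by nring. rewrite norm_neg. now apply H.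
Qed.

Lemma ccont_scal_var f z a : ccont f z -> ccont (fun w => (w - a)%C ⋅ f w)%A z.
Proof.
  intros Hf eps Heps.
  destruct (ccont_bounded f z Hf) as [d0 [M [Hd0 [HM Hb]]]].
  destruct (ccont_scal (z - a)%C f z Hf (eps / 2)) as [d [Hd Hfd]]; [lra|].
  exists (Rmin (Rmin d0 (eps / 2 / M)) d). split.
  { repeat apply Rmin_glb_lt; try assumption. apply Rdiv_lt_0_compat; lra. }
  intros w Hw.
  assert (H1 : Cmod (w - z) < Rmin d0 (eps / 2 / M)) by (eapply Rlt_le_trans; [exact Hw | apply Rmin_l]).
  assert (H2 : Cmod (w - z) < d) by (eapply Rlt_le_trans; [exact Hw | apply Rmin_r]).
  specialize (Hb w (Rlt_le_trans _ _ _ H1 (Rmin_l _ _))).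
  assert (H3 := Rlt_le_trans _ _ _ H1 (Rmin_r _ _)). specialize (Hfd w H2).
  replace ((w - a)%C ⋅ f w - (z - a)%C ⋅ f z)%A
    with ((w - z)%C ⋅ f w + ((z - a)%C ⋅ f w - (z - a)%C ⋅ f z))%A.
  2:{ replace (w - a)%C with ((w - z) + (z - a))%C by ring. rewrite scal_add_l. nring. }
  eapply Rle_trans; [apply norm_add|].
  assert (⟪(w - z)%C ⋅ f w⟫ <= eps / 2 / M * M).
  { eapply Rle_trans; [apply norm_scale|].
    apply Rmult_le_compat; auto using norm_pos, Cmod_ge_0, Rlt_le. }
  replace (eps / 2 / M * M) with (eps / 2) in * by (field; lra). lra.
Qed.

Lemma Cmod_sub_pos z a : z <> a -> 0 < Cmod (z - a).
Proof.
  intros H. apply Cmod_gt_0. intros E. apply H. replace z with ((z - a) + a)%C by ring.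
  rewrite E. ring.
Qed.

Lemma Cmod_sub_sym z a : Cmod (z - a) = Cmod (a - z).
Proof. rewrite <- Cmod_opp. f_equal. ring. Qed.

Lemma Cmod_sub_trans z w a : Cmod (z - a) <= Cmod (z - w) + Cmod (w - a).
Proof. replace (z - a)%C with ((z - w) + (w - a))%C by ring. apply Cmod_triangle. Qed.

Lemma Csub_neq z a : z <> a -> (z - a)%C <> 0%C.
Proof.
  intros H E. apply H. replace z with ((z - a) + a)%C by ring. rewrite E. ring.
Qed.

Lemma ccont_div f z a : z <> a -> ccont f z -> ccont (fun w => (/ (w - a))%C ⋅ f w)%A z.
Proof.
  intros Hza Hf eps Heps. pose proof (Cmod_sub_pos z a Hza) as Hr.
  set (r := Cmod (z - a)) in *.
  (* the numerator of the difference of the two quotients is continuous and vanishes at z *)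
  assert (Hg : ccont (fun w => (z - a)%C ⋅ f w + - ((w - a)%C ⋅ f z))%A z).
  { apply ccont_add; [now apply ccont_scal|]. apply ccont_opp, ccont_scal_var, ccont_const. }
  destruct (Hg (eps * (r / 2 * r))) as [d [Hd Hgd]].
  { apply Rmult_lt_0_compat; [exact Heps|]. apply Rmult_lt_0_compat; lra. }
  exists (Rmin d (r / 2)). split; [apply Rmin_glb_lt; lra|]. intros w Hw.
  specialize (Hgd w (Rlt_le_trans _ _ _ Hw (Rmin_l _ _))).
  assert (Hw2 := Rlt_le_trans _ _ _ Hw (Rmin_r _ _)).
  assert (Hwr : r / 2 <= Cmod (w - a)).
  { pose proof (Cmod_sub_trans z w a). rewrite (Cmod_sub_sym z w) in H. fold r in H. lra. }
  assert (Hwa : w <> a) by (intros ->; rewrite Cmod_self in Hwr; lra).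
  pose proof (Csub_neq _ _ Hwa) as Nw. pose proof (Csub_neq _ _ Hza) as Nz.
  replace ((/ (w - a))%C ⋅ f w - (/ (z - a))%C ⋅ f z)%A
    with ((/ ((w - a) * (z - a)))%C ⋅ ((z - a)%C ⋅ f w + - ((w - a)%C ⋅ f z)
       - ((z - a)%C ⋅ f z + - ((z - a)%C ⋅ f z))))%A.
  2:{ rewrite scal_sub_r, !scal_add_r, !vscal_opp_r, !scal_scal.
      replace (/ ((w - a) * (z - a)) * (z - a))%C with (/ (w - a))%C by (field; auto).
      replace (/ ((w - a) * (z - a)) * (w - a))%C with (/ (z - a))%C by (field; auto).
      nring. }
  eapply Rle_trans; [apply norm_scale|].
  rewrite Cmod_inv, Cmod_mult. fold r.
  2:{ apply Cmult_neq_0; assumption. }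
  apply Rle_trans with (/ (r / 2 * r) * (eps * (r / 2 * r))).
  - apply Rmult_le_compat; auto using norm_pos.
    + apply Rlt_le, Rinv_0_lt_compat. apply Rmult_lt_0_compat; lra.
    + apply Rinv_le_contravar; [apply Rmult_lt_0_compat; lra|]. apply Rmult_le_compat_r; lra.
  - right. field. lra.
Qed.

Lemma cdiff_cont f z : cdiff f z -> ccont f z.
Proof.
  intros [phi [d [Hd [Hphi H]]]].
  apply (ccont_local (fun w => f z + (w - z)%C ⋅ phi w)%A _ z d Hd).
  { intros w Hw. now rewrite <- H. }
  apply ccont_add; [apply ccont_const | now apply ccont_scal_var].
Qed.

Lemma cdiff_local f g z d : 0 < d -> (forall w, Cmod (w - z) < d -> f w = g w) ->
  cdiff f z -> cdiff g z.
Proof.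
  intros Hd E [phi [e [He [Hphi H]]]].
  exists phi, (Rmin d e). split; [now apply Rmin_glb_lt|]. split; [exact Hphi|].
  intros w Hw. rewrite <- !E.
  - apply H. eapply Rlt_le_trans; [exact Hw | apply Rmin_r].
  - rewrite Cmod_self; exact Hd.
  - eapply Rlt_le_trans; [exact Hw | apply Rmin_l].
Qed.

Lemma cdiff_const (x : A) z : cdiff (fun _ => x) z.
Proof.
  exists (fun _ => 0%A), 1. split; [lra|]. split; [apply ccont_const|].
  intros w _. rewrite scal_0_r. nring.
Qed.

Lemma cdiff_add f g z : cdiff f z -> cdiff g z -> cdiff (fun w => f w + g w)%A z.
Proof.
  intros [phi [d [Hd [Cphi Hf]]]] [psi [e [He [Cpsi Hg]]]].
  exists (fun w => phi w + psi w)%A, (Rmin d e). split; [now apply Rmin_glb_lt|].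
  split; [now apply ccont_add|]. intros w Hw.
  rewrite (Hf w), (Hg w), scal_add_r by
    (eapply Rlt_le_trans; [exact Hw | apply Rmin_l || apply Rmin_r]). nring.
Qed.

Lemma cdiff_scal (c : C) f z : cdiff f z -> cdiff (fun w => c ⋅ f w)%A z.
Proof.
  intros [phi [d [Hd [Cphi Hf]]]].
  exists (fun w => c ⋅ phi w)%A, d. split; [exact Hd|]. split; [now apply ccont_scal|].
  intros w Hw. rewrite (Hf w Hw), scal_add_r, !scal_scal. do 2 f_equal. ring.
Qed.

Lemma cdiff_opp f z : cdiff f z -> cdiff (fun w => - f w)%A z.
Proof.
  intros [phi [d [Hd [Cphi Hf]]]].
  exists (fun w => - phi w)%A, d. split; [exact Hd|]. split; [now apply ccont_opp|].
  intros w Hw. rewrite (Hf w Hw), vscal_opp_r. nring.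
Qed.

Lemma cdiff_sub f g z : cdiff f z -> cdiff g z -> cdiff (fun w => f w - g w)%A z.
Proof.
  intros Hf Hg. apply (cdiff_local (fun w => f w + - g w)%A _ z 1 Rlt_0_1).
  - intros; nring.
  - apply cdiff_add; [exact Hf | now apply cdiff_opp].
Qed.

Lemma cdiff_mul f g z : cdiff f z -> cdiff g z -> cdiff (fun w => f w * g w)%A z.
Proof.
  intros Hf Hg. pose proof (cdiff_cont g z Hg) as Cg. revert Hf Hg.
  intros [phi [d [Hd [Cphi Hf]]]] [psi [e [He [Cpsi Hg]]]].
  exists (fun w => phi w * g w + f z * psi w)%A, (Rmin d e). split; [now apply Rmin_glb_lt|]. split.
  { apply ccont_add; apply ccont_mul; auto using ccont_const. }
  intros w Hw.
  rewrite (Hf w) by (eapply Rlt_le_trans; [exact Hw | apply Rmin_l]).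
  pose proof (Hg w (Rlt_le_trans _ _ _ Hw (Rmin_r _ _))) as Eg.
  rewrite scal_add_r, <- scal_mul_l, <- scal_mul_r.
  replace ((w - z)%C ⋅ psi w)%A with (g w - g z)%A by (rewrite Eg; nring). nring.
Qed.

Lemma cdiff_scal_var f z a : cdiff f z -> cdiff (fun w => (w - a)%C ⋅ f w)%A z.
Proof.
  intros Hf. pose proof (cdiff_cont f z Hf) as Cf. destruct Hf as [phi [d [Hd [Cphi Hf]]]].
  exists (fun w => f w + (z - a)%C ⋅ phi w)%A, d. split; [exact Hd|]. split.
  { apply ccont_add; [exact Cf | now apply ccont_scal]. }
  intros w Hw. pose proof (Hf w Hw) as E.
  rewrite scal_add_r, scal_scal, (Cmult_comm (w - z)), <- scal_scal.
  replace ((w - z)%C ⋅ phi w)%A with (f w - f z)%A by (rewrite E; nring).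
  replace (w - a)%C with ((w - z) + (z - a))%C by ring. rewrite scal_add_l, scal_sub_r. nring.
Qed.

(** Follows from
    [/ (w - a) = / (z - a) - (w - z) / ((w - a) (z - a))]. *)
Lemma cdiff_div f z a : z <> a -> cdiff f z -> cdiff (fun w => (/ (w - a))%C ⋅ f w)%A z.
Proof.
  intros Hza [phi [d [Hd [Cphi Hf]]]]. pose proof (Cmod_sub_pos z a Hza) as Hr.
  exists (fun w => (/ (w - a))%C ⋅ (phi w + - ((/ (z - a))%C ⋅ f z)))%A, (Rmin d (Cmod (z - a))).
  split; [now apply Rmin_glb_lt|]. split.
  { apply ccont_div; [exact Hza|]. apply ccont_add; [exact Cphi | apply ccont_const]. }
  intros w Hw. pose proof (Hf w (Rlt_le_trans _ _ _ Hw (Rmin_l _ _))) as E.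
  assert (Hwa : w <> a).
  { intros ->. rewrite Cmod_sub_sym in Hw. apply (Rlt_irrefl (Cmod (z - a))).
    eapply Rlt_le_trans; [exact Hw | apply Rmin_r]. }
  pose proof (Csub_neq _ _ Hwa) as Nw. pose proof (Csub_neq _ _ Hza) as Nz.
  rewrite E, !scal_add_r, !vscal_opp_r, !scal_scal.
  replace (/ (w - a))%C with (/ (z - a) + - ((w - z) * / (w - a) * / (z - a)))%C at 1 by (field; auto).
  replace ((w - z) * (/ (w - a) * / (z - a)))%C with ((w - z) * / (w - a) * / (z - a))%C by ring.
  rewrite (Cmult_comm (/ (w - a)) (w - z)).
  rewrite scal_add_l, vscal_opp_l. nring.
Qed.

Lemma cdiff_affine f z (b c : C) : cdiff f (b + c * z)%C -> cdiff (fun w => f (b + c * w)%C) z.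
Proof.
  intros [phi [d [Hd [Cphi Hf]]]]. pose proof (Cmod_ge_0 c) as Hc.
  assert (Hcw : forall e w, 0 < e -> Cmod (w - z) < e / (Cmod c + 1) ->
                 Cmod ((b + c * w) - (b + c * z)) < e).
  { intros e w He Hw. replace ((b + c * w) - (b + c * z))%C with (c * (w - z))%C by ring.
    rewrite Cmod_mult. pose proof (Cmod_ge_0 (w - z)).
    apply Rle_lt_trans with ((Cmod c + 1) * Cmod (w - z)); [apply Rmult_le_compat_r; lra|].
    apply (Rmult_lt_compat_l (Cmod c + 1)) in Hw; [|lra].
    replace ((Cmod c + 1) * (e / (Cmod c + 1))) with e in Hw by (field; lra). exact Hw. }
  exists (fun w => c ⋅ phi (b + c * w)%C)%A, (d / (Cmod c + 1)). split.
  { apply Rdiv_lt_0_compat; lra. }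
  split.
  - apply (ccont_scal c (fun w => phi (b + c * w)%C)). intros eps Heps.
    destruct (Cphi eps Heps) as [e [He H]].
    exists (e / (Cmod c + 1)). split; [apply Rdiv_lt_0_compat; lra|].
    intros w Hw. apply H. now apply Hcw.
  - intros w Hw. rewrite (Hf (b + c * w)%C) by now apply Hcw.
    rewrite scal_scal. do 2 f_equal. ring.
Qed.

(** [inv (f w) - inv (f z) = inv (f w) * (f z - f w) * inv (f z)]: this gives first
    the continuity of the inverse, then its difference quotient. *)
Lemma cdiff_inv f z : is_unit (f z) -> cdiff f z -> cdiff (fun w => inv (f w)) z.
Proof.
  intros Uz Hf. pose proof (cdiff_cont f z Hf) as Cf.
  set (M := ⟪inv (f z)⟫). pose proof (norm_pos (inv (f z))) as HM. fold M in HM.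
  assert (Hnear : exists d, 0 < d /\ forall w, Cmod (w - z) < d -> is_unit (f w) /\ ⟪inv (f w)⟫ <= 2 * M).
  { destruct (Cf (1 / 2 / (M + 1))) as [d [Hd H]]; [apply Rdiv_lt_0_compat; lra|].
    exists d. split; [exact Hd|]. intros w Hw. specialize (H w Hw).
    apply unit_near; [exact Uz|]. fold M.
    apply Rle_trans with ((M + 1) * (1 / 2 / (M + 1))).
    - apply Rmult_le_compat; auto using norm_pos. lra.
    - right; field; lra. }
  destruct Hnear as [d0 [Hd0 Hnear]].
  assert (Ediff : forall w, Cmod (w - z) < d0 ->
            (inv (f w) - inv (f z) = inv (f w) * (f z - f w) * inv (f z))%A).
  { intros w Hw. destruct (Hnear w Hw) as [Uw _].
    replace (inv (f w) * (f z - f w) * inv (f z))%A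
      with (inv (f w) * (f z * inv (f z)) - (inv (f w) * f w) * inv (f z))%A by nring.
    rewrite inv_r, inv_l by assumption. nring. }
  assert (Ci : ccont (fun w => inv (f w)) z).
  { intros eps Heps.
    destruct (Cf (eps / (2 * (M + 1) * (M + 1)))) as [d [Hd H]].
    { apply Rdiv_lt_0_compat; [lra|]. apply Rmult_lt_0_compat; lra. }
    exists (Rmin d0 d). split; [now apply Rmin_glb_lt|]. intros w Hw.
    specialize (H w (Rlt_le_trans _ _ _ Hw (Rmin_r _ _))).
    assert (Hw0 := Rlt_le_trans _ _ _ Hw (Rmin_l _ _)). rewrite (Ediff w Hw0).
    destruct (Hnear w Hw0) as [_ Bw].
    eapply Rle_trans; [apply norm_mul|]. fold M.
    apply Rle_trans with (2 * (M + 1) * (eps / (2 * (M + 1) * (M + 1))) * (M + 1)).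
    2:{ right; field; lra. }
    apply Rmult_le_compat; auto using norm_pos; [|lra].
    eapply Rle_trans; [apply norm_mul|].
    apply Rmult_le_compat; auto using norm_pos; [lra|]. rewrite norm_sub_sym. exact H. }
  destruct Hf as [phi [d [Hd [Cphi Hf]]]].
  exists (fun w => - (inv (f w) * phi w * inv (f z)))%A, (Rmin d0 d).
  split; [now apply Rmin_glb_lt|]. split.
  { apply ccont_opp. apply (ccont_mul (fun w => inv (f w) * phi w)%A (fun _ => inv (f z))).
    - now apply ccont_mul.
    - apply ccont_const. }
  intros w Hw.
  pose proof (Ediff w (Rlt_le_trans _ _ _ Hw (Rmin_l _ _))) as E1.
  pose proof (Hf w (Rlt_le_trans _ _ _ Hw (Rmin_r _ _))) as E2.
  rewrite vscal_opp_r, <- scal_mul_l, <- scal_mul_r.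
  replace ((w - z)%C ⋅ phi w)%A with (f w - f z)%A by (rewrite E2; nring).
  replace (inv (f w)) with (inv (f z) + (inv (f w) - inv (f z)))%A at 1 by nring.
  rewrite E1. nring.
Qed.

Lemma cdiff_ex_derive f z :
  cdiff f z <-> ex_derive (K := C_AbsRing) (V := CompleteNormedModule.NormedModule C_AbsRing A) f z.
Proof.
  split.
  - intros [phi [d [Hd [Cphi Hf]]]]. exists (phi z). split.
    { apply is_linear_scal_l. }
    intros x Hx eps. apply (is_filter_lim_locally_unique (V := AbsRing_NormedModule C_AbsRing)) in Hx. subst x.
    destruct (Cphi eps (cond_pos eps)) as [e [He H]].
    assert (Hm : 0 < Rmin d e) by now apply Rmin_glb_lt.
    exists (mkposreal _ Hm). intros w Hw. change (Cmod (w - z) < Rmin d e) in Hw.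
    change (⟪(f w - f z) - (w - z)%C ⋅ phi z⟫ <= eps * Cmod (w - z)).
    rewrite (Hf w) by (eapply Rlt_le_trans; [exact Hw | apply Rmin_l]).
    specialize (H w (Rlt_le_trans _ _ _ Hw (Rmin_r _ _))).
    replace (f z + (w - z)%C ⋅ phi w - f z - (w - z)%C ⋅ phi z)%A with ((w - z)%C ⋅ (phi w - phi z))%A
      by (rewrite scal_sub_r; nring).
    eapply Rle_trans; [apply norm_scale|]. rewrite Rmult_comm.
    apply Rmult_le_compat_r; [apply Cmod_ge_0 | exact H].
  - intros [l [_ Hl]].
    specialize (Hl z (fun P HP => HP)).
    exists (fun w => if excluded_middle_informative (w = z) then l else (/ (w - z))%C ⋅ (f w - f z))%A, 1.
    split; [lra|]. split.
    + intros eps Heps. destruct (Hl (mkposreal eps Heps)) as [d H].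
      exists d. split; [apply cond_pos|]. intros w Hw. specialize (H w Hw). simpl in H.
      change (⟪(f w - f z) - (w - z)%C ⋅ l⟫ <= eps * Cmod (w - z)) in H.
      destruct (excluded_middle_informative (z = z)) as [_|N]; [|easy].
      destruct (excluded_middle_informative (w = z)) as [->|N].
      { replace (l - l)%A with (0 : A)%A by nring. rewrite norm_0. lra. }
      pose proof (Csub_neq _ _ N) as N'. pose proof (Cmod_sub_pos _ _ N) as P.
      replace ((/ (w - z))%C ⋅ (f w - f z) - l)%A with ((/ (w - z))%C ⋅ ((f w - f z) - (w - z)%C ⋅ l))%A.
      2:{ rewrite scal_sub_r, scal_scal, Cinv_l, scal_1; auto. }
      eapply Rle_trans; [apply norm_scale|]. rewrite Cmod_inv by exact N'.
      apply Rle_trans with (/ Cmod (w - z) * (eps * Cmod (w - z))).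
      * apply Rmult_le_compat_l; [|exact H]. now apply Rlt_le, Rinv_0_lt_compat.
      * right. field. lra.
    + intros w _. destruct (excluded_middle_informative (w = z)) as [->|N].
      * replace (z - z)%C with (RtoC 0) by ring. rewrite scal_0_l. nring.
      * rewrite scal_scal, Cinv_r, scal_1; [nring|]. now apply Csub_neq.
Qed.
End Calculus.

(** * Integrals along segments *)

Ltac Cnz := let E := fresh in intros E; apply RtoC_inj in E; lra.

(** Integrals over real intervals need a real Banach space: the scalars of the
    algebra are restricted, and the norm and the topology are kept. *)
Section RealScalars.
Variable A : BanachAlgebra.

Definition real_module : ModuleSpace R_Ring.
Proof.
  refine (ModuleSpace.Pack R_Ring A (ModuleSpace.Class R_Ring A
    (AbelianGroup.class (CompleteNormedModule.AbelianGroup C_AbsRing A))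
    (ModuleSpace.Mixin R_Ring (CompleteNormedModule.AbelianGroup C_AbsRing A)
      (fun (r : R) (x : A) => scal (RtoC r) x) _ _ _ _)) A).
  - intros r s x. change (mult r s) with (r * s). rewrite RtoC_mult. apply (@scal_assoc C_Ring A).
  - intros x. apply (@scal_one C_Ring A).
  - intros r x y. apply (@scal_distr_l C_Ring A).
  - intros r s x. change (plus r s) with (r + s). rewrite RtoC_plus. apply (@scal_distr_r C_Ring A).
Defined.

Definition real_normed_aux : NormedModuleAux R_AbsRing :=
  NormedModuleAux.Pack R_AbsRing A (NormedModuleAux.Class R_AbsRing A
    (ModuleSpace.class R_Ring real_module)
    (UniformSpace.class (CompleteNormedModule.UniformSpace C_AbsRing A))) A.

Definition real_normed : NormedModule R_AbsRing.
Proof.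
  refine (NormedModule.Pack R_AbsRing A (NormedModule.Class R_AbsRing A
    (NormedModuleAux.class R_AbsRing real_normed_aux)
    (NormedModule.Mixin R_AbsRing real_normed_aux
       (fun x : A => norm (V := CompleteNormedModule.NormedModule C_AbsRing A) x)
       (@norm_factor C_AbsRing A) _ _ _ _ _)) A).
  - intros x y. apply (@norm_triangle C_AbsRing A).
  - intros r x. change (abs r) with (Rabs r). rewrite <- Cmod_R. apply (@norm_scal C_AbsRing A).
  - intros x y eps. apply (@norm_compat1 C_AbsRing A).
  - intros x y eps. apply (@norm_compat2 C_AbsRing A).
  - intros x. apply (@norm_eq_zero C_AbsRing A).
Defined.

Definition realify : CompleteNormedModule R_AbsRing :=
  CompleteNormedModule.Pack R_AbsRing A (CompleteNormedModule.Class R_AbsRing A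
    (NormedModule.class R_AbsRing real_normed)
    (CompleteSpace.class (CompleteNormedModule.CompleteSpace C_AbsRing A))) A.
End RealScalars.

Section Segments.
Context {A : BanachAlgebra}.
Implicit Types (f g : C -> A) (p q z w : C) (t : R).

Definition pt p q t : C := (p + RtoC t * (q - p))%C.

Definition int01 (F : R -> A) : A := RInt (V := realify A) F 0 1.

Definition seg p q f : A := int01 (fun t => (q - p)%C ⋅ f (pt p q t))%A.

Definition rcont (F : R -> A) t := continuous (U := CompleteNormedModule.UniformSpace R_AbsRing (realify A)) F t.

Lemma rcont_intro (F : R -> A) t :
  (forall eps, 0 < eps -> exists d, 0 < d /\ forall s, Rabs (s - t) < d -> ⟪F s - F t⟫ <= eps) ->
  rcont F t.
Proof.
  intros H. apply filterlim_locally. intros eps.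
  destruct (H (eps / 2)) as [d [Hd HF]]; [destruct eps; simpl; lra|].
  exists (mkposreal d Hd). intros s Hs. apply (norm_compat1 (V := ba_space A)).
  change (⟪F s - F t⟫ < eps). specialize (HF s Hs). destruct eps; simpl in *; lra.
Qed.

Lemma ccont_rcont f p q t : ccont f (pt p q t) -> rcont (fun t => f (pt p q t)) t.
Proof.
  intros H. apply rcont_intro. intros eps Heps. destruct (H eps Heps) as [d [Hd Hf]].
  pose proof (Cmod_ge_0 (q - p)) as Hc.
  exists (d / (Cmod (q - p) + 1)). split; [apply Rdiv_lt_0_compat; lra|].
  intros s Hs. apply Hf. unfold pt.
  replace (p + s * (q - p) - (p + t * (q - p)))%C with (RtoC (s - t) * (q - p))%C
    by (rewrite RtoC_minus; ring).
  rewrite Cmod_mult, Cmod_R.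
  apply Rle_lt_trans with (Rabs (s - t) * (Cmod (q - p) + 1)).
  { apply Rmult_le_compat_l; [apply Rabs_pos | lra]. }
  apply (Rmult_lt_compat_r (Cmod (q - p) + 1)) in Hs; [|lra].
  replace (d / (Cmod (q - p) + 1) * (Cmod (q - p) + 1)) with d in Hs by (field; lra). exact Hs.
Qed.

Definition segcont p q f := forall t, 0 <= t <= 1 -> ccont f (pt p q t).

Lemma segcont_ex p q f : segcont p q f ->
  ex_RInt (V := realify A) (fun t => (q - p)%C ⋅ f (pt p q t))%A 0 1.
Proof.
  intros H. apply (ex_RInt_continuous (V := realify A)). intros t Ht.
  rewrite Rmin_left, Rmax_right in Ht by lra.
  apply (ccont_rcont (fun z => (q - p)%C ⋅ f z)%A). now apply ccont_scal, H.
Qed.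

Lemma seg_ext p q f g : (forall t, 0 <= t <= 1 -> f (pt p q t) = g (pt p q t)) ->
  seg p q f = seg p q g.
Proof.
  intros H. apply (RInt_ext (V := realify A)). intros t Ht.
  rewrite Rmin_left, Rmax_right in Ht by lra. rewrite H by lra. reflexivity.
Qed.

Lemma seg_add p q f g : segcont p q f -> segcont p q g ->
  seg p q (fun z => f z + g z)%A = (seg p q f + seg p q g)%A.
Proof.
  intros Hf Hg. unfold seg, int01.
  etransitivity; [|exact (RInt_plus (V := realify A) _ _ 0 1 (segcont_ex p q f Hf) (segcont_ex p q g Hg))].
  apply (RInt_ext (V := realify A)). intros t _. apply scal_add_r.
Qed.

(** Integration is real linear by construction; it commutes with complex scalars
    since the Riemann sums do and multiplication by a scalar is continuous. *)
Lemma is_RInt_vscal (c : C) (F : R -> A) a b (I : A) :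
  is_RInt (V := realify A) F a b I ->
  is_RInt (V := realify A) (fun t => c ⋅ F t)%A a b (c ⋅ I)%A.
Proof.
  intros H. unfold is_RInt.
  assert (HR : forall s : SF_seq, Riemann_sum (V := realify A) (fun t => c ⋅ F t)%A s
                    = (c ⋅ Riemann_sum (V := realify A) F s)%A).
  { intros s. apply (SF_cons_ind (fun s => Riemann_sum (V := realify A) (fun t => c ⋅ F t)%A s
                    = (c ⋅ Riemann_sum (V := realify A) F s)%A)).
    - intros x. simpl. symmetry. apply scal_0_r.
    - intros h s' IH. rewrite !Riemann_sum_cons, IH.
      change (plus ?x ?y) with (vadd (A := A) x y).
      change (scal (V := CompleteNormedModule.ModuleSpace R_AbsRing (realify A)) ?r ?x)
        with (vscal (A := A) (RtoC r) x).
      rewrite scal_add_r, !scal_scal. do 2 f_equal. apply Cmult_comm. }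
  apply (filterlim_ext (fun s => c ⋅ (scal (V := realify A) (sign (b - a)) (Riemann_sum (V := realify A) F s)))%A).
  { intros s. rewrite HR.
    change (c ⋅ (RtoC (sign (b - a)) ⋅ Riemann_sum (V := realify A) F s)
      = RtoC (sign (b - a)) ⋅ (c ⋅ Riemann_sum (V := realify A) F s))%A.
    rewrite !scal_scal. f_equal. apply Cmult_comm. }
  apply (filterlim_comp _ _ _ _ (fun x : A => c ⋅ x)%A _ _ _ H).
  apply (@filterlim_scal_r C_AbsRing A c I).
Qed.

Lemma seg_scal (c : C) p q f : segcont p q f ->
  seg p q (fun z => c ⋅ f z)%A = (c ⋅ seg p q f)%A.
Proof.
  intros Hf. unfold seg, int01. apply (is_RInt_unique (V := realify A)).
  apply (is_RInt_ext (V := realify A) (fun t => c ⋅ ((q - p)%C ⋅ f (pt p q t)))%A).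
  { intros t _. rewrite !scal_scal. f_equal. apply Cmult_comm. }
  apply is_RInt_vscal, (RInt_correct (V := realify A)), segcont_ex, Hf.
Qed.

Lemma seg_norm p q f M : segcont p q f ->
  (forall t, 0 <= t <= 1 -> ⟪f (pt p q t)⟫ <= M) -> ⟪seg p q f⟫ <= Cmod (q - p) * M.
Proof.
  intros Hf HM.
  pose proof (RInt_correct (V := realify A) _ _ _ (segcont_ex p q f Hf)) as H.
  apply (norm_RInt_le_const (V := realify A) _ _ _ _ (Cmod (q - p) * M)) in H.
  - change (⟪seg p q f⟫ <= (1 - 0) * (Cmod (q - p) * M)) in H. lra.
  - lra.
  - intros t Ht. eapply Rle_trans; [apply norm_scale|].
    apply Rmult_le_compat_l; [apply Cmod_ge_0 | now apply HM].
Qed.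

Lemma pt_rev p q t : pt q p (1 - t) = pt p q t.
Proof. unfold pt. rewrite RtoC_minus. ring. Qed.

Lemma seg_rev p q f : segcont p q f -> seg q p f = (- seg p q f)%A.
Proof.
  intros H. unfold seg, int01.
  assert (E : RInt (V := realify A) (fun t => (q - p)%C ⋅ f (pt p q t))%A 1 0
     = RInt (V := realify A) (fun t => (p - q)%C ⋅ f (pt q p t))%A 0 1).
  { replace (RInt (V := realify A) (fun t => (q - p)%C ⋅ f (pt p q t))%A 1 0)
     with (RInt (V := realify A) (fun t => (q - p)%C ⋅ f (pt p q t))%A (-1 * 0 + 1) (-1 * 1 + 1))
     by (f_equal; lra).
    rewrite <- (RInt_comp_lin (V := realify A)).
    - apply (RInt_ext (V := realify A)). intros t _.
      change (scal (V := CompleteNormedModule.ModuleSpace R_AbsRing (realify A)) ?r ?x)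
        with (vscal (A := A) (RtoC r) x).
      rewrite scal_scal. replace (-1 * t + 1) with (1 - t) by ring.
      rewrite pt_rev. replace (RtoC (-1)) with (- RtoC 1)%C by (rewrite <- RtoC_opp; f_equal; ring).
      f_equal. ring.
    - replace (-1 * 0 + 1) with 1 by ring. replace (-1 * 1 + 1) with 0 by ring.
      apply (ex_RInt_swap (V := realify A)). now apply segcont_ex. }
  rewrite <- E. symmetry.
  exact (opp_RInt_swap (V := realify A) _ 0 1 (segcont_ex p q f H)).
Qed.

Definition mid p q : C := pt p q (1 / 2).

Lemma pt_mid_l p q t : pt p (mid p q) t = pt p q (t / 2).
Proof. unfold mid, pt. unfold Rdiv. rewrite !RtoC_mult. ring. Qed.
Lemma pt_mid_r p q t : pt (mid p q) q t = pt p q (1 / 2 + t / 2).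
Proof. unfold mid, pt. unfold Rdiv. rewrite !RtoC_plus, !RtoC_mult, RtoC_inv by lra. field; Cnz. Qed.
Lemma mid_comm p q : mid q p = mid p q.
Proof. unfold mid, pt, Rdiv. rewrite !RtoC_mult, RtoC_inv by lra. field; Cnz. Qed.

Lemma seg_mid p q f : segcont p q f -> seg p q f = (seg p (mid p q) f + seg (mid p q) q f)%A.
Proof.
  intros H. pose proof (segcont_ex p q f H) as E. unfold seg, int01.
  assert (E1 : ex_RInt (V := realify A) (fun t => (q - p)%C ⋅ f (pt p q t))%A 0 (1 / 2))
   by (apply (ex_RInt_Chasles_1 (V := realify A) _ _ _ 1); [lra | exact E]).
  assert (E2 : ex_RInt (V := realify A) (fun t => (q - p)%C ⋅ f (pt p q t))%A (1 / 2) 1)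
   by (apply (ex_RInt_Chasles_2 (V := realify A) _ 0); [lra | exact E]).
  etransitivity; [exact (eq_sym (RInt_Chasles (V := realify A) _ 0 (1 / 2) 1 E1 E2))|].
  change (plus (G := CompleteNormedModule.AbelianMonoid R_AbsRing (realify A)) ?x ?y) with (vadd (A := A) x y).
  f_equal.
  - replace (RInt (V := realify A) (fun t => (q - p)%C ⋅ f (pt p q t))%A 0 (1 / 2))
      with (RInt (V := realify A) (fun t => (q - p)%C ⋅ f (pt p q t))%A (1 / 2 * 0 + 0) (1 / 2 * 1 + 0))
      by (f_equal; lra).
    rewrite <- (RInt_comp_lin (V := realify A)).
    + apply (RInt_ext (V := realify A)). intros t _.
      change (scal (V := CompleteNormedModule.ModuleSpace R_AbsRing (realify A)) ?r ?x)
        with (vscal (A := A) (RtoC r) x).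
      rewrite pt_mid_l, scal_scal. replace (1 / 2 * t + 0) with (t / 2) by field.
      f_equal. unfold mid, pt. ring.
    + replace (1 / 2 * 0 + 0) with 0 by ring. replace (1 / 2 * 1 + 0) with (1 / 2) by ring. exact E1.
  - replace (RInt (V := realify A) (fun t => (q - p)%C ⋅ f (pt p q t))%A (1 / 2) 1)
      with (RInt (V := realify A) (fun t => (q - p)%C ⋅ f (pt p q t))%A (1 / 2 * 0 + 1 / 2) (1 / 2 * 1 + 1 / 2))
      by (f_equal; lra).
    rewrite <- (RInt_comp_lin (V := realify A)).
    + apply (RInt_ext (V := realify A)). intros t _.
      change (scal (V := CompleteNormedModule.ModuleSpace R_AbsRing (realify A)) ?r ?x)
        with (vscal (A := A) (RtoC r) x).
      rewrite pt_mid_r, scal_scal. replace (1 / 2 * t + 1 / 2) with (1 / 2 + t / 2) by field.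
      f_equal. unfold mid, pt, Rdiv. rewrite !RtoC_mult, RtoC_inv by lra. field; Cnz.
    + replace (1 / 2 * 0 + 1 / 2) with (1 / 2) by ring. replace (1 / 2 * 1 + 1 / 2) with 1 by lra. exact E2.
Qed.

(** The fundamental theorem of calculus for a real combination of two fixed
    vectors; all explicit integrals below are of this kind. *)
Lemma int01_comb (a b a' b' : R -> R) (x y : A) :
  (forall t, is_derive a t (a' t)) -> (forall t, is_derive b t (b' t)) ->
  (forall t, continuous a' t) -> (forall t, continuous b' t) ->
  int01 (fun t => RtoC (a' t) ⋅ x + RtoC (b' t) ⋅ y)%A
    = (RtoC (a 1 - a 0)%R ⋅ x + RtoC (b 1 - b 0)%R ⋅ y)%A.
Proof.
  intros Ha Hb Ca Cb.
  assert (H := is_RInt_derive (V := realify A) (fun t => RtoC (a t) ⋅ x + RtoC (b t) ⋅ y)%A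
    (fun t => RtoC (a' t) ⋅ x + RtoC (b' t) ⋅ y)%A 0 1).
  unfold int01. erewrite (is_RInt_unique (V := realify A)); [|apply H].
  - change (minus ?u ?v) with (vsub (A := A) u v). rewrite !RtoC_minus, !scal_sub_l. nring.
  - intros t _. apply (is_derive_plus (V := realify A)
      (fun t => RtoC (a t) ⋅ x)%A (fun t => RtoC (b t) ⋅ y)%A).
    + apply (is_derive_scal_l (V := realify A) a). apply Ha.
    + apply (is_derive_scal_l (V := realify A) b). apply Hb.
  - intros t _. apply (continuous_plus (V := realify A)
      (fun t => RtoC (a' t) ⋅ x)%A (fun t => RtoC (b' t) ⋅ y)%A).
    + apply (continuous_scal_l (V := realify A) a'). apply Ca.
    + apply (continuous_scal_l (V := realify A) b'). apply Cb.
Qed.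
End Segments.

(** * Goursat's theorem *)

(** Produces the nested triangles of Goursat's theorem and the successive
    solutions of the exhaustion. *)
Lemma dependent_choice {X : Type} (P : nat -> X -> Prop) (Rel : nat -> X -> X -> Prop) (x0 : X) :
  P 0%nat x0 -> (forall n x, P n x -> exists y, P (S n) y /\ Rel n x y) ->
  exists u, u 0%nat = x0 /\ forall n, P n (u n) /\ Rel n (u n) (u (S n)).
Proof.
  intros H0 HS.
  set (newton_next := fun n x => epsilon (inhabits x0) (fun y => P (S n) y /\ Rel n x y)).
  set (u := fix u n := match n with O => x0 | S n => newton_next n (u n) end).
  assert (Hu : forall n, P n (u n)).
  { induction n as [|n IH]; [exact H0|].
    exact (proj1 (epsilon_spec (inhabits x0) _ (HS n (u n) IH))). }
  exists u. split; [reflexivity|]. intros n. split; [apply Hu|].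
  exact (proj2 (epsilon_spec (inhabits x0) _ (HS n (u n) (Hu n)))).
Qed.

(** The complex numbers as a Banach algebra, so that [complete_geometric] applies
    to the vertices of nested triangles. *)
Definition C_algebra : BanachAlgebra.
Proof.
  refine (Build_BanachAlgebra C_CompleteNormedModule
    (Ring.mixin _ (Ring.class C_Ring)) _ _ _).
  - intros c x y. apply eq_sym, Cmult_assoc.
  - intros c x y. change (x * (c * y) = c * (x * y))%C. ring.
  - intros x y. right. apply Cmod_mult.
Defined.

Section Rectangles.
Implicit Types z p q : C.

Definition crect (a b c d : R) z : Prop := a <= Re z <= b /\ c <= Im z <= d.

Lemma pt_Re p q t : Re (pt p q t) = Re p + t * (Re q - Re p).
Proof. destruct p, q. unfold pt. simpl. ring. Qed.
Lemma pt_Im p q t : Im (pt p q t) = Im p + t * (Im q - Im p).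
Proof. destruct p, q. unfold pt. simpl. ring. Qed.

Lemma between_pt u v a b t : 0 <= t <= 1 -> a <= u <= b -> a <= v <= b -> a <= u + t * (v - u) <= b.
Proof.
  intros Ht Hu Hv. replace (u + t * (v - u)) with ((1 - t) * u + t * v) by ring.
  pose proof (Rmult_le_compat_l (1 - t) _ _ ltac:(lra) (proj1 Hu)).
  pose proof (Rmult_le_compat_l (1 - t) _ _ ltac:(lra) (proj2 Hu)).
  pose proof (Rmult_le_compat_l t _ _ ltac:(lra) (proj1 Hv)).
  pose proof (Rmult_le_compat_l t _ _ ltac:(lra) (proj2 Hv)). lra.
Qed.

Lemma crect_pt a b c d p q t : crect a b c d p -> crect a b c d q -> 0 <= t <= 1 ->
  crect a b c d (pt p q t).
Proof.
  intros [Hp1 Hp2] [Hq1 Hq2] Ht. split; [rewrite pt_Re | rewrite pt_Im]; now apply between_pt.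
Qed.

Lemma crect_mid a b c d p q : crect a b c d p -> crect a b c d q -> crect a b c d (mid p q).
Proof. intros; apply crect_pt; auto; lra. Qed.

Lemma crect_closed a b c d z : 
  (forall eps, 0 < eps -> exists w, crect a b c d w /\ Cmod (w - z) <= eps) -> crect a b c d z.
Proof.
  intros H.
  assert (Hx : forall eps, 0 < eps -> a - eps <= Re z <= b + eps /\ c - eps <= Im z <= d + eps).
  { intros eps Heps. destruct (H eps Heps) as [w [[H1 H2] Hw]].
    pose proof (Rmax_Cmod (w - z)%C) as HM.
    assert (Rabs (Re w - Re z) <= eps).
    { eapply Rle_trans; [|exact Hw]. eapply Rle_trans; [|exact HM].
      destruct w, z; apply Rmax_l. }
    assert (Rabs (Im w - Im z) <= eps).
    { eapply Rle_trans; [|exact Hw]. eapply Rle_trans; [|exact HM].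
      destruct w, z; apply Rmax_r. }
    split; apply Rabs_le_between in H0; apply Rabs_le_between in H3; lra. }
  split; split; apply le_epsilon; intros eps Heps; destruct (Hx eps Heps); lra.
Qed.
End Rectangles.

Section Goursat.
Context {A : BanachAlgebra}.
Implicit Types (f g : C -> A) (p q r z w : C) (t : R).

Definition tri p q r f : A := (seg p q f + seg q r f + seg r p f)%A.

(** Each side is cut at its midpoint, and the three inner segments are traversed
    once in each direction. *)
Lemma tri_split p q r f (D : C -> Prop) :
  (forall u v t, D u -> D v -> 0 <= t <= 1 -> D (pt u v t)) -> (forall u, D u -> ccont f u) ->
  D p -> D q -> D r ->
  tri p q r f = (tri p (mid p q) (mid r p) f + tri (mid p q) q (mid q r) f
     + tri (mid r p) (mid q r) r f + tri (mid p q) (mid q r) (mid r p) f)%A.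
Proof.
  intros HD Hf Hp Hq Hr.
  assert (HM : forall u v, D u -> D v -> D (mid u v)) by (intros; apply HD; auto; lra).
  assert (HS : forall u v, D u -> D v -> segcont u v f) by (intros u v Hu Hv t Ht; apply Hf, HD; auto).
  unfold tri. rewrite (seg_mid p q f), (seg_mid q r f), (seg_mid r p f) by auto.
  rewrite (seg_rev (mid p q) (mid r p)), (seg_rev (mid q r) (mid p q)), (seg_rev (mid q r) (mid r p)), (seg_rev (mid r p) (mid p q)).
  all: auto.
  rewrite (seg_rev (mid p q) (mid r p)) by auto. nring.
Qed.

Lemma seg_affine p q w (x l : A) :
  seg p q (fun z => x + (z - w)%C ⋅ l)%A
    = ((q - p)%C ⋅ x + (((q - w) * (q - w) - (p - w) * (p - w)) / RtoC 2)%C ⋅ l)%A.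
Proof.
  unfold seg.
  transitivity (int01 (fun t => RtoC 1 ⋅ ((q - p)%C ⋅ x + ((q - p) * (p - w))%C ⋅ l)
     + RtoC t ⋅ (((q - p) * (q - p))%C ⋅ l))%A).
  - apply (RInt_ext (V := realify A)). intros t _. unfold pt.
    change (((q - p)%C ⋅ (x + (p + t * (q - p) - w)%C ⋅ l))%A =
     (RtoC 1 ⋅ ((q - p)%C ⋅ x + ((q - p) * (p - w))%C ⋅ l)
     + RtoC t ⋅ (((q - p) * (q - p))%C ⋅ l))%A).
    rewrite scal_1, scal_add_r, !scal_scal.
    replace ((q - p) * (p + t * (q - p) - w))%C
      with ((q - p) * (p - w) + t * ((q - p) * (q - p)))%C by ring.
    rewrite scal_add_l. nring.
  - rewrite (int01_comb (fun t => t) (fun t => t * t / 2) (fun _ => 1) (fun t => t)).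
    + replace (RtoC (1 - 0)) with (RtoC 1) by (f_equal; ring).
      replace (1 * 1 / 2 - 0 * 0 / 2) with (/ 2) by field.
      rewrite scal_1, scal_scal.
      replace (((q - w) * (q - w) - (p - w) * (p - w)) / RtoC 2)%C
        with ((q - p) * (p - w) + RtoC (/ 2) * ((q - p) * (q - p)))%C
        by (rewrite RtoC_inv by lra; field; Cnz).
      rewrite scal_add_l. nring.
    + intros t. apply (is_derive_id t).
    + intros t. auto_derive; auto. field.
    + intros t. apply continuous_const.
    + intros t. apply continuous_id.
Qed.

(** Affine functions have a primitive. *)
Lemma tri_affine p q r w (x l : A) : tri p q r (fun z => x + (z - w)%C ⋅ l)%A = 0%A.
Proof.
  unfold tri. rewrite !seg_affine.
  set (P := (((q - w) * (q - w) - (p - w) * (p - w)) / RtoC 2)%C).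
  set (Q := (((r - w) * (r - w) - (q - w) * (q - w)) / RtoC 2)%C).
  replace (((p - w) * (p - w) - (r - w) * (r - w)) / RtoC 2)%C with (- (P + Q))%C
    by (unfold P, Q; field; Cnz).
  replace (p - r)%C with (- ((q - p) + (r - q)))%C by ring.
  rewrite !vscal_opp_l, !scal_add_l. nring.
Qed.

Lemma Cmod_pt_le p q w t M : 0 <= t <= 1 -> Cmod (p - w) <= M -> Cmod (q - w) <= M ->
  Cmod (pt p q t - w) <= M.
Proof.
  intros Ht Hp Hq.
  replace (pt p q t - w)%C with (RtoC (1 - t) * (p - w) + RtoC t * (q - w))%C
    by (unfold pt; rewrite RtoC_minus; ring).
  eapply Rle_trans; [apply Cmod_triangle|]. rewrite !Cmod_mult, !Cmod_R, !Rabs_pos_eq by lra.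
  pose proof (Rmult_le_compat_l (1 - t) _ _ ltac:(lra) Hp).
  pose proof (Rmult_le_compat_l t _ _ ltac:(lra) Hq). lra.
Qed.

(** Near [w] the function is affine up to [eps * |z - w|], the affine part
    contributes nothing, and the perimeter is at most [3 * s]. *)
Lemma tri_small f phi p q r w s eps d :
  (forall z, Cmod (z - w) < d -> f z = (f w + (z - w)%C ⋅ phi z)%A) ->
  (forall z, Cmod (z - w) < d -> ⟪phi z - phi w⟫ <= eps) ->
  (forall u v t, (u = p \/ u = q \/ u = r) -> (v = p \/ v = q \/ v = r) -> 0 <= t <= 1 ->
     ccont f (pt u v t)) ->
  0 <= s -> 3 * s < d -> Cmod (p - w) <= 3 * s -> Cmod (q - w) <= 3 * s -> Cmod (r - w) <= 3 * s ->
  Cmod (q - p) <= s -> Cmod (r - q) <= s -> Cmod (p - r) <= s ->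
  ⟪tri p q r f⟫ <= 9 * eps * (s * s).
Proof.
  intros Hf Hphi Cf Hs0 Hs Hp Hq Hr Hqp Hrq Hpr.
  set (aff := fun z => (f w + (z - w)%C ⋅ phi w)%A).
  assert (Caff : forall z, ccont aff z).
  { intros z. apply ccont_add; [apply ccont_const | apply ccont_scal_var, ccont_const]. }
  assert (Hseg : forall u v, (u = p \/ u = q \/ u = r) -> (v = p \/ v = q \/ v = r) ->
     Cmod (v - u) <= s -> ⟪seg u v f - seg u v aff⟫ <= s * (3 * s * eps)).
  { intros u v Hu Hv Huv.
    assert (Hu' : Cmod (u - w) <= 3 * s) by (destruct Hu as [->|[->| ->]]; assumption).
    assert (Hv' : Cmod (v - w) <= 3 * s) by (destruct Hv as [->|[->| ->]]; assumption).
    set (rem := fun z => (f z + (- RtoC 1)%C ⋅ aff z)%A).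
    assert (Srem : segcont u v rem).
    { intros t Ht. apply ccont_add; [now apply Cf | apply ccont_scal, Caff]. }
    replace (seg u v f - seg u v aff)%A with (seg u v rem).
    2:{ unfold rem. rewrite seg_add, seg_scal.
        - replace ((- RtoC 1)%C ⋅ seg u v aff)%A with (- (RtoC 1 ⋅ seg u v aff))%A by now rewrite vscal_opp_l.
          rewrite scal_1. nring.
        - intros t _; apply Caff.
        - intros t Ht. now apply Cf.
        - intros t _. apply ccont_scal, Caff. }
    pose proof (Cmod_ge_0 (v - u)) as G0.
    assert (Heps : 0 <= eps).
    { eapply Rle_trans; [apply (norm_pos (phi w - phi w)%A) | apply (Hphi w)]. rewrite Cmod_self. lra. }
    eapply Rle_trans; [apply (seg_norm _ _ _ (3 * s * eps) Srem)|].
    - intros t Ht. pose proof (Cmod_pt_le u v w t _ Ht Hu' Hv') as Hpt.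
      unfold rem, aff. rewrite (Hf (pt u v t)) by lra.
      replace (f w + (pt u v t - w)%C ⋅ phi (pt u v t) + (- RtoC 1)%C ⋅ (f w + (pt u v t - w)%C ⋅ phi w))%A
        with ((pt u v t - w)%C ⋅ (phi (pt u v t) - phi w))%A.
      + eapply Rle_trans; [apply norm_scale|].
        apply Rmult_le_compat; auto using norm_pos, Cmod_ge_0. apply Hphi. lra.
      + rewrite scal_sub_r, vscal_opp_l, scal_1. nring.
    - apply Rmult_le_compat_r; [|exact Huv]. apply Rmult_le_pos; [lra | exact Heps]. }
  replace (tri p q r f) with ((seg p q f - seg p q aff) + (seg q r f - seg q r aff)
     + (seg r p f - seg r p aff) + tri p q r aff)%A by (unfold tri; nring).
  replace (tri p q r aff) with (0 : A)%A by (symmetry; apply tri_affine).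
  pose proof (Hseg p q ltac:(auto) ltac:(auto) Hqp) as H1.
  pose proof (Hseg q r ltac:(auto) ltac:(auto) Hrq) as H2.
  pose proof (Hseg r p ltac:(auto) ltac:(auto) Hpr) as H3.
  set (X := (seg p q f - seg p q aff)%A) in *. set (Y := (seg q r f - seg q r aff)%A) in *.
  set (Z := (seg r p f - seg r p aff)%A) in *.
  replace (X + Y + Z + 0)%A with (X + Y + Z)%A by nring.
  pose proof (norm_add (X + Y)%A Z). pose proof (norm_add X Y). lra.
Qed.

Lemma Cmod_mid p q : Cmod (mid p q - p) = Cmod (q - p) / 2.
Proof.
  unfold mid, pt. replace (p + RtoC (1 / 2) * (q - p) - p)%C with (RtoC (1 / 2) * (q - p))%C by ring.
  rewrite Cmod_mult, Cmod_R, Rabs_pos_eq by lra. field.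
Qed.
Lemma Cmod_mid' p q : Cmod (q - mid p q) = Cmod (q - p) / 2.
Proof. rewrite Cmod_sub_sym, <- mid_comm, Cmod_mid, Cmod_sub_sym. reflexivity. Qed.
Lemma Cmod_mid_mid p q r : Cmod (mid q r - mid p q) = Cmod (r - p) / 2.
Proof.
  replace (mid q r - mid p q)%C with (RtoC (/ 2) * (r - p))%C.
  - rewrite Cmod_mult, Cmod_R, Rabs_pos_eq by lra. field.
  - unfold mid, pt, Rdiv. rewrite !RtoC_mult, !RtoC_inv by lra. field.
Qed.

(** If the integral over a triangle were not zero, then at each bisection one of the
    four smaller triangles would keep at least a quarter of its norm.  The
    triangles shrink to a point of the rectangle, where [tri_small] contradicts the
    accumulated lower bound. *)
Lemma goursat (a b c d : R) f p q r :
  (forall z, crect a b c d z -> cdiff f z) ->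
  crect a b c d p -> crect a b c d q -> crect a b c d r -> tri p q r f = 0%A.
Proof.
  intros Hf Hp Hq Hr. apply norm_0_eq.
  destruct (Rle_lt_or_eq_dec _ _ (norm_pos (tri p q r f))) as [Hpos|E]; [exfalso|now symmetry].
  set (s := 1 + Cmod (q - p) + Cmod (r - q) + Cmod (p - r)).
  assert (Hs : 1 <= s).
  { unfold s. pose proof (Cmod_ge_0 (q - p)). pose proof (Cmod_ge_0 (r - q)). pose proof (Cmod_ge_0 (p - r)). lra. }
  set (eps := ⟪tri p q r f⟫ / 2 / (s * s)).
  assert (Heps : 0 < eps).
  { apply Rdiv_lt_0_compat; [lra|]. apply Rmult_lt_0_compat; lra. }
  set (len := fun n : nat => s * (1 / 2) ^ n).
  assert (Hlen : forall n, 0 < len n).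
  { intros n. apply Rmult_lt_0_compat; [lra|]. apply pow_lt; lra. }
  assert (HlenS : forall n, len (S n) = len n / 2) by (intros n; unfold len; simpl; field).
  set (P := fun n (T : C * C * C) => let '(p, q, r) := T in
     (crect a b c d p /\ crect a b c d q /\ crect a b c d r) /\
     (Cmod (q - p) <= len n /\ Cmod (r - q) <= len n /\ Cmod (p - r) <= len n) /\
     eps * (len n * len n) < ⟪tri p q r f⟫).
  set (Rel := fun n (T T' : C * C * C) => Cmod (fst (fst T') - fst (fst T)) <= len n).
  destruct (dependent_choice P Rel (p, q, r)) as [u [Hu0 Hu]].
  { unfold P. split; [auto|]. unfold len. simpl.
    pose proof (Cmod_ge_0 (q - p)). pose proof (Cmod_ge_0 (r - q)). pose proof (Cmod_ge_0 (p - r)).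
    split; [unfold s; lra|]. unfold eps.
    replace (⟪tri p q r f⟫ / 2 / (s * s) * (s * 1 * (s * 1))) with (⟪tri p q r f⟫ / 2) by (field; lra).
    lra. }
  { clear Hp Hq Hr Hpos. intros n [[p0 q0] r0] [[Hp [Hq Hr]] [[L1 [L2 L3]] Hbad]].
    pose proof (tri_split p0 q0 r0 f (crect a b c d)
      (fun u v t Hu Hv Ht => crect_pt a b c d u v t Hu Hv Ht)
      (fun z Hz => cdiff_cont f z (Hf z Hz)) Hp Hq Hr) as Hsplit.
    assert (Hsq : eps * (len n * len n) = 4 * (eps * (len (S n) * len (S n)))) by (rewrite HlenS; field).
    assert (Hcase : eps * (len (S n) * len (S n)) < ⟪tri p0 (mid p0 q0) (mid r0 p0) f⟫ \/
      eps * (len (S n) * len (S n)) < ⟪tri (mid p0 q0) q0 (mid q0 r0) f⟫ \/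
      eps * (len (S n) * len (S n)) < ⟪tri (mid r0 p0) (mid q0 r0) r0 f⟫ \/
      eps * (len (S n) * len (S n)) < ⟪tri (mid p0 q0) (mid q0 r0) (mid r0 p0) f⟫).
    { destruct (Rlt_le_dec (eps * (len (S n) * len (S n))) ⟪tri p0 (mid p0 q0) (mid r0 p0) f⟫); [auto|].
      destruct (Rlt_le_dec (eps * (len (S n) * len (S n))) ⟪tri (mid p0 q0) q0 (mid q0 r0) f⟫); [auto|].
      destruct (Rlt_le_dec (eps * (len (S n) * len (S n))) ⟪tri (mid r0 p0) (mid q0 r0) r0 f⟫); [auto|].
      destruct (Rlt_le_dec (eps * (len (S n) * len (S n))) ⟪tri (mid p0 q0) (mid q0 r0) (mid r0 p0) f⟫); [auto|].
      exfalso. rewrite Hsplit in Hbad.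
      pose proof (norm_add (tri p0 (mid p0 q0) (mid r0 p0) f + tri (mid p0 q0) q0 (mid q0 r0) f
         + tri (mid r0 p0) (mid q0 r0) r0 f)%A (tri (mid p0 q0) (mid q0 r0) (mid r0 p0) f)).
      pose proof (norm_add (tri p0 (mid p0 q0) (mid r0 p0) f + tri (mid p0 q0) q0 (mid q0 r0) f)%A
         (tri (mid r0 p0) (mid q0 r0) r0 f)).
      pose proof (norm_add (tri p0 (mid p0 q0) (mid r0 p0) f) (tri (mid p0 q0) q0 (mid q0 r0) f)).
      lra. }
    assert (M1 := Cmod_mid p0 q0). assert (M2 := Cmod_mid q0 r0). assert (M3 := Cmod_mid r0 p0).
    assert (M1' := Cmod_mid' p0 q0). assert (M2' := Cmod_mid' q0 r0). assert (M3' := Cmod_mid' r0 p0).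
    assert (N1 := Cmod_mid_mid p0 q0 r0). assert (N2 := Cmod_mid_mid q0 r0 p0). assert (N3 := Cmod_mid_mid r0 p0 q0).
    rewrite (Cmod_sub_sym r0 p0) in N1. rewrite (Cmod_sub_sym p0 q0) in N2. rewrite (Cmod_sub_sym q0 r0) in N3.
    pose proof (crect_mid _ _ _ _ _ _ Hp Hq). pose proof (crect_mid _ _ _ _ _ _ Hq Hr).
    pose proof (crect_mid _ _ _ _ _ _ Hr Hp).
    pose proof (Hlen n) as Hl. pose proof (HlenS n) as HlS.
    assert (S1 := Cmod_sub_sym (mid p0 q0) (mid r0 p0)).
    assert (S2 := Cmod_sub_sym (mid q0 r0) (mid p0 q0)).
    assert (S3 := Cmod_sub_sym (mid r0 p0) (mid q0 r0)).
    assert (Z0 := Cmod_self p0).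
    assert (T3 := Cmod_sub_sym (mid r0 p0) p0).
    destruct Hcase as [Hc|[Hc|[Hc|Hc]]].
    - exists (p0, mid p0 q0, mid r0 p0). unfold P, Rel. simpl fst.
      split; [split; [auto | split; [split; [|split]; lra | exact Hc]] | lra].
    - exists (mid p0 q0, q0, mid q0 r0). unfold P, Rel. simpl fst.
      split; [split; [auto | split; [split; [|split]; lra | exact Hc]] | lra].
    - exists (mid r0 p0, mid q0 r0, r0). unfold P, Rel. simpl fst.
      split; [split; [auto | split; [split; [|split]; lra | exact Hc]] | lra].
    - exists (mid p0 q0, mid q0 r0, mid r0 p0). unfold P, Rel. simpl fst.
      split; [split; [auto | split; [split; [|split]; lra | exact Hc]] | lra]. }
  destruct (complete_geometric (A := C_algebra) (fun n => fst (fst (u n))) s (1 / 2) ltac:(lra)) as [w [_ Hw]].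
  { intros n. exact (proj2 (Hu n)). }
  assert (Hw' : forall n, Cmod (fst (fst (u n)) - w) <= 2 * len n).
  { intros n. rewrite Cmod_sub_sym. eapply Rle_trans; [exact (Hw n)|].
    unfold len. right. field. }
  assert (Hlim : forall e, 0 < e -> exists n, 3 * len n < e).
  { intros e He. destruct (pow_lt_1_zero (1 / 2) ltac:(rewrite Rabs_pos_eq; lra) (e / (3 * s))) as [N HN].
    { apply Rdiv_lt_0_compat; lra. }
    exists N. specialize (HN N (le_n _)). rewrite Rabs_pos_eq in HN by (apply pow_le; lra).
    unfold len. apply (Rmult_lt_compat_l (3 * s)) in HN; [|lra].
    replace (3 * s * (e / (3 * s))) with e in HN by (field; lra). lra. }
  assert (Dw : crect a b c d w).
  { apply crect_closed. intros e He. destruct (Hlim e He) as [n Hn].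
    exists (fst (fst (u n))). split.
    - pose proof (proj1 (Hu n)) as H. destruct (u n) as [[p0 q0] r0]. apply H.
    - specialize (Hw' n). pose proof (Hlen n). lra. }
  destruct (Hf w Dw) as [phi [e0 [He0 [Cphi Hphi]]]].
  destruct (Cphi (eps / 9) ltac:(lra)) as [e1 [He1 Hphi1]].
  destruct (Hlim (Rmin e0 e1) ltac:(now apply Rmin_glb_lt)) as [n Hn].
  pose proof (proj1 (Hu n)) as H. specialize (Hw' n). pose proof (Hlen n) as Hl.
  destruct (u n) as [[p0 q0] r0]. simpl in Hw'. destruct H as [[Hp0 [Hq0 Hr0]] [[L1 [L2 L3]] Hbad]].
  pose proof (Cmod_sub_trans q0 p0 w). pose proof (Cmod_sub_trans r0 p0 w).
  rewrite (Cmod_sub_sym r0 p0) in H0.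
  assert (⟪tri p0 q0 r0 f⟫ <= 9 * (eps / 9) * (len n * len n)).
  { apply (tri_small f phi p0 q0 r0 w (len n) (eps / 9) (Rmin e0 e1)); try lra.
    - intros z Hz. apply Hphi. eapply Rlt_le_trans; [exact Hz | apply Rmin_l].
    - intros z Hz. apply Hphi1. eapply Rlt_le_trans; [exact Hz | apply Rmin_r].
    - intros u' v' t Hu' Hv' Ht. apply cdiff_cont, Hf, crect_pt; [| |exact Ht].
      + destruct Hu' as [->|[->| ->]]; assumption.
      + destruct Hv' as [->|[->| ->]]; assumption. }
  lra.
Qed.
End Goursat.

(** * Cauchy's integral formula *)

Section Cauchy.
Context {A : BanachAlgebra}.
Implicit Types (f g h : C -> A) (p q z w : C) (t : R).

Lemma quad_zero (a b c d : R) f p q p' q' :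
  (forall z, crect a b c d z -> cdiff f z) ->
  crect a b c d p -> crect a b c d q -> crect a b c d p' -> crect a b c d q' ->
  (seg p q f + seg q q' f - seg p' q' f - seg p p' f = 0)%A.
Proof.
  intros Hf Hp Hq Hp' Hq'.
  pose proof (goursat a b c d f p q q' Hf Hp Hq Hq') as H1.
  pose proof (goursat a b c d f p q' p' Hf Hp Hq' Hp') as H2.
  assert (HS : forall u v, crect a b c d u -> crect a b c d v -> segcont u v f).
  { intros u v Hu Hv t Ht. apply cdiff_cont, Hf, crect_pt; assumption. }
  unfold tri in *. rewrite (seg_rev p q') in H1 by auto.
  rewrite (seg_rev p' q'), (seg_rev p p') in H2 by auto.
  replace (seg p q f + seg q q' f - seg p' q' f - seg p p' f)%A
    with ((seg p q f + seg q q' f + - seg p q' f) + (seg p q' f + - seg p' q' f + - seg p p' f))%A by nring.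
  rewrite H1, H2. nring.
Qed.

Definition contour (a b c d : R) f : A :=
  (seg (a, c) (b, c) f + seg (b, c) (b, d) f + seg (b, d) (a, d) f + seg (a, d) (a, c) f)%A.

(** The region between the two rectangles is cut into four trapezoids along the
    segments joining corresponding corners.  Each of them lies in a closed
    rectangle where [f] is differentiable, and the cuts cancel. *)
Lemma contour_shrink (a b c d a' b' c' d' : R) f :
  a <= a' -> a' < b' -> b' <= b -> c <= c' -> c' < d' -> d' <= d ->
  (forall z, crect a b c d z -> ~ (a' < Re z < b' /\ c' < Im z < d') -> cdiff f z) ->
  contour a b c d f = contour a' b' c' d' f.
Proof.
  intros Ha Hab Hb Hc Hcd Hd Hf.
  assert (Q1 := quad_zero a b c c' f (a, c) (b, c) (a', c') (b', c')).
  assert (Q2 := quad_zero b' b c d f (b, c) (b, d) (b', c') (b', d')).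
  assert (Q3 := quad_zero a b d' d f (b, d) (a, d) (b', d') (a', d')).
  assert (Q4 := quad_zero a a' c d f (a, d) (a, c) (a', d') (a', c')).
  unfold crect in *; simpl in *.
  specialize (Q1 ltac:(intros z Hz; apply Hf; lra) ltac:(lra) ltac:(lra) ltac:(lra) ltac:(lra)).
  specialize (Q2 ltac:(intros z Hz; apply Hf; lra) ltac:(lra) ltac:(lra) ltac:(lra) ltac:(lra)).
  specialize (Q3 ltac:(intros z Hz; apply Hf; lra) ltac:(lra) ltac:(lra) ltac:(lra) ltac:(lra)).
  specialize (Q4 ltac:(intros z Hz; apply Hf; lra) ltac:(lra) ltac:(lra) ltac:(lra) ltac:(lra)).
  apply sub_0_eq. unfold contour. revert Q1 Q2 Q3 Q4.
  set (A1 := seg (a, c) (b, c) f). set (A2 := seg (b, c) (b, d) f).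
  set (A3 := seg (b, d) (a, d) f). set (A4 := seg (a, d) (a, c) f).
  set (B1 := seg (a', c') (b', c') f). set (B2 := seg (b', c') (b', d') f).
  set (B3 := seg (b', d') (a', d') f). set (B4 := seg (a', d') (a', c') f).
  set (D1 := seg (a, c) (a', c') f). set (D2 := seg (b, c) (b', c') f).
  set (D3 := seg (b, d) (b', d') f). set (D4 := seg (a, d) (a', d') f).
  intros Q1 Q2 Q3 Q4.
  replace (A1 + A2 + A3 + A4 - (B1 + B2 + B3 + B4))%A
    with ((A1 + D2 - B1 - D1) + (A2 + D3 - B2 - D2) + (A3 + D4 - B3 - D3) + (A4 + D1 - B4 - D4))%A by nring.
  rewrite Q1, Q2, Q3, Q4. nring.
Qed.

Definition half_pi_i : C := (0, PI / 2).
Definition two_pi_i : C := (0, 2 * PI).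

Lemma two_pi_i_neq_0 : two_pi_i <> 0%C.
Proof. intros E. injection E. pose proof PI_RGT_0. lra. Qed.

(** The side from [p] to [q] of a square centred at [z] is a rotated and scaled copy
    of the segment from [-1 - i] to [1 - i], so that the integrand is
    [2 / (2 t - 1 - i)] for all four sides: each contributes [i pi / 2].  Its real
    and imaginary parts have the primitives
    [ln ((2 t - 1) ^ 2 + 1) / 2] and [atan (2 t - 1)]. *)
Lemma seg_square_side (x : A) p q z :
  (forall t, exists e : C, e <> 0%C /\ (q - p = RtoC 2 * e)%C /\
     (pt p q t - z = ((2 * t - 1)%R, (-1)%R) * e)%C) ->
  seg p q (fun w => (/ (w - z))%C ⋅ x)%A = (half_pi_i ⋅ x)%A.
Proof.
  intros H. unfold seg.
  transitivity (int01 (fun t => RtoC (2 * (2 * t - 1) / ((2 * t - 1) * (2 * t - 1) + 1)) ⋅ x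
     + RtoC (2 / ((2 * t - 1) * (2 * t - 1) + 1)) ⋅ (Ci ⋅ x))%A).
  - apply (RInt_ext (V := realify A)). intros t _.
    set (u := 2 * t - 1) in *.
    change (((q - p)%C ⋅ ((/ (pt p q t - z))%C ⋅ x))%A =
      (RtoC (2 * u / (u * u + 1)) ⋅ x + RtoC (2 / (u * u + 1)) ⋅ (Ci ⋅ x))%A).
    rewrite !scal_scal, <- scal_add_l. f_equal.
    destruct (H t) as [e [He [E1 E2]]]. rewrite E1, E2. fold u.
    assert (Hu : 0 < u * u + 1) by nra.
    assert (Hne : ((u, -1) : C) <> 0%C) by (intros E; injection E; intros; lra).
    assert (Ek : (RtoC 2 = (RtoC (2 * u / (u * u + 1))%R + RtoC (2 / (u * u + 1))%R * Ci) * (u, (-1)%R))%C).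
    { apply injective_projections; simpl; field; lra. }
    rewrite Ek at 1. field. split; assumption.
  - rewrite (int01_comb (fun t => ln ((2 * t - 1) * (2 * t - 1) + 1) / 2) (fun t => atan (2 * t - 1))
      (fun t => 2 * (2 * t - 1) / ((2 * t - 1) * (2 * t - 1) + 1)) (fun t => 2 / ((2 * t - 1) * (2 * t - 1) + 1))).
    + replace (2 * 1 - 1) with 1 by ring. replace (2 * 0 - 1) with (Ropp 1) by ring.
      replace (Ropp 1 * Ropp 1) with (1 * 1) by ring.
      rewrite atan_opp, atan_1.
      replace (ln (1 * 1 + 1) / 2 - ln (1 * 1 + 1) / 2) with 0 by ring.
      replace (PI / 4 - - (PI / 4)) with (PI / 2) by field.
      rewrite scal_0_l, scal_scal.
      replace (RtoC (PI / 2)%R * Ci)%C with half_pi_i.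
      * nring.
      * apply injective_projections; simpl; ring.
    + intros t. assert (0 < (2 * t - 1) * (2 * t - 1) + 1) by nra. auto_derive; [lra|]. field. lra.
    + intros t. assert (0 < (2 * t - 1) * (2 * t - 1) + 1) by nra. auto_derive; [auto|]. field.
      unfold Rsqr; nra.
    + intros t. assert (0 < (2 * t - 1) * (2 * t - 1) + 1) by nra.
      apply (ex_derive_continuous (V := R_NormedModule)). auto_derive. lra.
    + intros t. assert (0 < (2 * t - 1) * (2 * t - 1) + 1) by nra.
      apply (ex_derive_continuous (V := R_NormedModule)). auto_derive. lra.
Qed.

(** One side of a small square centred at [z]: replacing [h w] by [h z] changes the
    integrand by at most [eps / r] on a segment of length at most [2 * r]. *)
Lemma seg_kernel_near h p q z r eps : 0 < r ->
  (forall t, 0 <= t <= 1 -> ccont h (pt p q t)) ->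
  (forall t, exists e : C, e <> 0%C /\ (q - p = RtoC 2 * e)%C /\
     (pt p q t - z = ((2 * t - 1)%R, (-1)%R) * e)%C) ->
  Cmod (q - p) <= 2 * r ->
  (forall t, 0 <= t <= 1 -> r <= Cmod (pt p q t - z)) ->
  (forall t, 0 <= t <= 1 -> ⟪h (pt p q t) - h z⟫ <= eps) ->
  ⟪seg p q (fun w => (/ (w - z))%C ⋅ h w)%A - half_pi_i ⋅ h z⟫ <= 2 * eps.
Proof.
  intros Hr Ch Hside Hlen Hdist Hh.
  rewrite <- (seg_square_side (h z) p q z Hside).
  assert (Hne : forall t, 0 <= t <= 1 -> pt p q t <> z).
  { intros t Ht E. specialize (Hdist t Ht). rewrite E, Cmod_self in Hdist. lra. }
  set (rem := fun w => ((/ (w - z))%C ⋅ (h w + - h z))%A).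
  assert (Crem : segcont p q rem).
  { intros t Ht. apply ccont_div; [now apply Hne|]. apply ccont_add; [now apply Ch | apply ccont_const]. }
  assert (E : (seg p q (fun w => (/ (w - z))%C ⋅ h w) = seg p q rem + seg p q (fun w => (/ (w - z))%C ⋅ h z))%A).
  { rewrite <- seg_add; [|exact Crem|].
    - apply seg_ext. intros t Ht. unfold rem. rewrite <- scal_add_r. f_equal. nring.
    - intros t Ht. apply ccont_div; [now apply Hne | apply ccont_const]. }
  rewrite E. replace (seg p q rem + seg p q (fun w => (/ (w - z))%C ⋅ h z)
    - seg p q (fun w => (/ (w - z))%C ⋅ h z))%A with (seg p q rem) by nring.
  assert (Heps : 0 <= eps).
  { eapply Rle_trans; [apply (norm_pos (h (pt p q 0) - h z)%A) | apply Hh; lra]. }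
  eapply Rle_trans; [apply (seg_norm _ _ _ (/ r * eps) Crem)|].
  - intros t Ht. eapply Rle_trans; [apply norm_scale|].
    rewrite Cmod_inv by now apply Csub_neq, Hne.
    apply Rmult_le_compat.
    + apply Rlt_le, Rinv_0_lt_compat. specialize (Hdist t Ht). lra.
    + apply norm_pos.
    + apply Rinv_le_contravar; [exact Hr | now apply Hdist].
    + replace (h (pt p q t) + - h z)%A with (h (pt p q t) - h z)%A by nring. now apply Hh.
  - apply Rle_trans with (2 * r * (/ r * eps)).
    + apply Rmult_le_compat_r; [|exact Hlen]. apply Rmult_le_pos; [|exact Heps].
      now apply Rlt_le, Rinv_0_lt_compat.
    + right. field. lra.
Qed.

Lemma Cmod_ge_Re z : Rabs (Re z) <= Cmod z.
Proof. eapply Rle_trans; [|apply Rmax_Cmod]. apply Rmax_l. Qed.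
Lemma Cmod_ge_Im z : Rabs (Im z) <= Cmod z.
Proof. eapply Rle_trans; [|apply Rmax_Cmod]. apply Rmax_r. Qed.
Lemma Cmod_le_sum z : Cmod z <= Rabs (Re z) + Rabs (Im z).
Proof.
  destruct z as [x y].
  replace ((x, y) : C) with (RtoC x + RtoC y * Ci)%C by (apply injective_projections; simpl; ring).
  eapply Rle_trans; [apply Cmod_triangle|]. rewrite Cmod_mult, !Cmod_R.
  replace (Cmod Ci) with 1.
  - simpl. replace (x + (y * 0 - 0 * 1)) with x by ring. replace (0 + (y * 1 + 0 * 0)) with y by ring. lra.
  - unfold Cmod, Ci; simpl. replace (0 * (0 * 1) + 1 * (1 * 1)) with 1 by ring. now rewrite sqrt_1.
Qed.

(** [contour_shrink] moves the contour to small squares centred at [z], where the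
    integral tends to [2 pi i] times [h z] by continuity of [h]. *)
Lemma cauchy_formula (a b c d : R) h z :
  (forall w, crect a b c d w -> cdiff h w) -> a < Re z < b -> c < Im z < d ->
  contour a b c d (fun w => (/ (w - z))%C ⋅ h w)%A = (two_pi_i ⋅ h z)%A.
Proof.
  intros Hh Hx Hy.
  assert (Hhz : ccont h z) by (apply cdiff_cont, Hh; unfold crect; lra).
  apply norm_small_eq. intros eps Heps.
  destruct (Hhz (eps / 8) ltac:(lra)) as [e [He Hhe]].
  destruct z as [x y]. simpl in Hx, Hy.
  set (r := Rmin (e / 3) (Rmin (Rmin (x - a) (b - x)) (Rmin (y - c) (d - y)))).
  assert (Hr : 0 < r) by (unfold r; repeat apply Rmin_glb_lt; lra).
  assert (Hre : r <= e / 3) by apply Rmin_l.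
  assert (Hr1 : r <= Rmin (x - a) (b - x)).
  { eapply Rle_trans; [apply Rmin_r | apply Rmin_l]. }
  assert (Hr2 : r <= Rmin (y - c) (d - y)).
  { eapply Rle_trans; [apply Rmin_r | apply Rmin_r]. }
  pose proof (Rmin_l (x - a) (b - x)). pose proof (Rmin_r (x - a) (b - x)).
  pose proof (Rmin_l (y - c) (d - y)). pose proof (Rmin_r (y - c) (d - y)).
  clearbody r.
  rewrite (contour_shrink a b c d (x - r) (x + r) (y - r) (y + r)); try lra.
  2:{ intros w Hw Hout. apply cdiff_div; [|now apply Hh]. intros ->. apply Hout. simpl. lra. }
  assert (Hside : forall p q, (exists e : C, e <> 0%C /\ (q - p = RtoC 2 * e)%C /\
     (forall t, pt p q t - (x, y) = ((2 * t - 1)%R, (-1)%R) * e)%C) ->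
     Cmod (q - p) <= 2 * r ->
     (forall t, 0 <= t <= 1 -> r <= Cmod (pt p q t - (x, y))) ->
     (forall t, 0 <= t <= 1 -> Rabs (Re (pt p q t) - x) <= r /\ Rabs (Im (pt p q t) - y) <= r) ->
     ⟪seg p q (fun w => (/ (w - (x, y)))%C ⋅ h w)%A - half_pi_i ⋅ h (x, y)⟫ <= 2 * (eps / 8)).
  { intros p q [ee [H1' [H2' H3']]] Hl Hd Hb. apply (seg_kernel_near h p q (x, y) r); try assumption.
    - intros t Ht. apply cdiff_cont, Hh. destruct (Hb t Ht) as [B1 B2].
      apply Rabs_le_between in B1. apply Rabs_le_between in B2. unfold crect. lra.
    - intros t. exists ee. auto.
    - intros t Ht. apply Hhe. destruct (Hb t Ht) as [B1 B2].
      eapply Rle_lt_trans; [apply Cmod_le_sum|].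
      change (Rabs (Re (pt p q t) + - x) + Rabs (Im (pt p q t) + - y) < e).
      unfold Rminus in B1, B2. lra. }
  assert (Hbd : forall u v : R, (u = r \/ u = - r) -> (v = r \/ v = - r) -> forall t, 0 <= t <= 1 ->
    Rabs (x + u + t * ((x + v) - (x + u)) - x) <= r).
  { intros u v Hu Hv t Ht. apply Rabs_le.
    pose proof (between_pt u v (- r) r t Ht ltac:(lra) ltac:(lra)). lra. }
  assert (Hbd' : forall u v : R, (u = r \/ u = - r) -> (v = r \/ v = - r) -> forall t, 0 <= t <= 1 ->
    Rabs (y + u + t * ((y + v) - (y + u)) - y) <= r).
  { intros u v Hu Hv t Ht. apply Rabs_le.
    pose proof (between_pt u v (- r) r t Ht ltac:(lra) ltac:(lra)). lra. }
  assert (S1 := Hside (x - r, y - r) (x + r, y - r)).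
  assert (S2 := Hside (x + r, y - r) (x + r, y + r)).
  assert (S3 := Hside (x + r, y + r) (x - r, y + r)).
  assert (S4 := Hside (x - r, y + r) (x - r, y - r)).
  clear Hside.
  assert (K : forall X Y Z W V : A, ⟪X - V⟫ <= 2 * (eps / 8) -> ⟪Y - V⟫ <= 2 * (eps / 8) ->
     ⟪Z - V⟫ <= 2 * (eps / 8) -> ⟪W - V⟫ <= 2 * (eps / 8) ->
     ⟪X + Y + Z + W - (V + V + V + V)⟫ <= eps).
  { intros X Y Z W V H1' H2' H3' H4'.
    replace (X + Y + Z + W - (V + V + V + V))%A with ((X - V) + (Y - V) + (Z - V) + (W - V))%A by nring.
    pose proof (norm_add ((X - V) + (Y - V) + (Z - V))%A (W - V)%A).
    pose proof (norm_add ((X - V) + (Y - V))%A (Z - V)%A). pose proof (norm_add (X - V)%A (Y - V)%A). lra. }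
  replace (two_pi_i ⋅ h (x, y))%A
    with (half_pi_i ⋅ h (x, y) + half_pi_i ⋅ h (x, y) + half_pi_i ⋅ h (x, y) + half_pi_i ⋅ h (x, y))%A.
  2:{ rewrite <- !scal_add_l. f_equal. apply injective_projections; simpl; field. }
  unfold contour.
  assert (Hne : forall u v : R, (u <> 0 \/ v <> 0) -> ((u, v) : C) <> 0%C).
  { intros u v Huv E. injection E. intros. lra. }
  apply K; clear K.
  - apply S1.
    + exists (r, 0). split; [apply Hne; lra|]. split; [apply injective_projections; simpl; ring|].
      intros t. apply injective_projections; simpl; ring.
    + eapply Rle_trans; [apply Cmod_le_sum|]. simpl.
      replace (x + r + - (x - r)) with (2 * r) by ring. replace (y - r + - (y - r)) with 0 by ring.
      rewrite Rabs_R0, Rabs_pos_eq; lra.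
    + intros t Ht. eapply Rle_trans; [|apply Cmod_ge_Im]. simpl.
      replace (y - r + (t * (y - r + - (y - r)) + 0 * (x + r + - (x - r))) + - y) with (- r) by ring.
      rewrite Rabs_Ropp, Rabs_pos_eq; lra.
    + intros t Ht. rewrite pt_Re, pt_Im. simpl. split; [apply Hbd | apply Hbd']; auto.
  - apply S2.
    + exists (0, r). split; [apply Hne; lra|]. split; [apply injective_projections; simpl; ring|].
      intros t. apply injective_projections; simpl; ring.
    + eapply Rle_trans; [apply Cmod_le_sum|]. simpl.
      replace (x + r + - (x + r)) with 0 by ring. replace (y + r + - (y - r)) with (2 * r) by ring.
      rewrite Rabs_R0, Rabs_pos_eq; lra.
    + intros t Ht. eapply Rle_trans; [|apply Cmod_ge_Re]. simpl.
      replace (x + r + (t * (x + r + - (x + r)) - 0 * (y + r + - (y - r))) + - x) with r by ring.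
      rewrite Rabs_pos_eq; lra.
    + intros t Ht. rewrite pt_Re, pt_Im. simpl. split; [apply Hbd | apply Hbd']; auto.
  - apply S3.
    + exists (- r, 0). split; [apply Hne; lra|]. split; [apply injective_projections; simpl; ring|].
      intros t. apply injective_projections; simpl; ring.
    + eapply Rle_trans; [apply Cmod_le_sum|]. simpl.
      replace (x - r + - (x + r)) with (- (2 * r)) by ring. replace (y + r + - (y + r)) with 0 by ring.
      rewrite Rabs_R0, Rabs_Ropp, Rabs_pos_eq; lra.
    + intros t Ht. eapply Rle_trans; [|apply Cmod_ge_Im]. simpl.
      replace (y + r + (t * (y + r + - (y + r)) + 0 * (x - r + - (x + r))) + - y) with r by ring.
      rewrite Rabs_pos_eq; lra.
    + intros t Ht. rewrite pt_Re, pt_Im. simpl. split; [apply Hbd | apply Hbd']; auto.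
  - apply S4.
    + exists (0, - r). split; [apply Hne; lra|]. split; [apply injective_projections; simpl; ring|].
      intros t. apply injective_projections; simpl; ring.
    + eapply Rle_trans; [apply Cmod_le_sum|]. simpl.
      replace (x - r + - (x - r)) with 0 by ring. replace (y - r + - (y + r)) with (- (2 * r)) by ring.
      rewrite Rabs_R0, Rabs_Ropp, Rabs_pos_eq; lra.
    + intros t Ht. eapply Rle_trans; [|apply Cmod_ge_Re]. simpl.
      replace (x - r + (t * (x - r + - (x - r)) - 0 * (y - r + - (y + r))) + - x) with (- r) by ring.
      rewrite Rabs_Ropp, Rabs_pos_eq; lra.
    + intros t Ht. rewrite pt_Re, pt_Im. simpl. split; [apply Hbd | apply Hbd']; auto.
Qed.
End Cauchy.

(** * Cauchy transforms of segments and Weierstrass's theorem *)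

Section EdgeTransform.
Context {A : BanachAlgebra}.
Implicit Types (f g h : C -> A) (p q z w a : C) (t : R).

Lemma segcont_bounded p q h : segcont p q h ->
  exists M, 0 < M /\ forall t, 0 <= t <= 1 -> ⟪h (pt p q t)⟫ <= M.
Proof.
  intros Hh.
  destruct (continuity_ab_maj (fun t => ⟪h (pt p q t)⟫) 0 1 ltac:(lra)) as [t0 [H0 _]].
  { intros t Ht. apply continuity_pt_filterlim.
    apply (continuous_comp (V := CompleteNormedModule.UniformSpace R_AbsRing (realify A))
      (fun t => h (pt p q t)) (fun x : A => ⟪x⟫)).
    - exact (ccont_rcont h p q t (Hh t Ht)).
    - apply (@filterlim_norm R_AbsRing (realify A)). }
  exists (⟪h (pt p q t0)⟫ + 1). split; [pose proof (norm_pos (h (pt p q t0))); lra|].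
  intros t Ht. specialize (H0 t Ht). lra.
Qed.

Definition cauchy_transform p q h z : A := seg p q (fun w => (/ (w - z))%C ⋅ h w)%A.

Definition away p q z d := 0 < d /\ forall t, 0 <= t <= 1 -> d <= Cmod (pt p q t - z).

Lemma away_neq p q z d t : away p q z d -> 0 <= t <= 1 -> pt p q t <> z.
Proof.
  intros [Hd H] Ht E. specialize (H t Ht). rewrite E, Cmod_self in H. lra.
Qed.

Lemma segcont_div p q h z d : segcont p q h -> away p q z d ->
  segcont p q (fun w => (/ (w - z))%C ⋅ h w)%A.
Proof.
  intros Hh Ha t Ht. apply ccont_div; [now apply (away_neq p q z d) | now apply Hh].
Qed.

Lemma norm_div_le p q h z d t M : away p q z d -> 0 <= t <= 1 -> ⟪h (pt p q t)⟫ <= M ->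
  ⟪(/ (pt p q t - z))%C ⋅ h (pt p q t)⟫ <= / d * M.
Proof.
  intros Ha Ht HM. eapply Rle_trans; [apply norm_scale|].
  rewrite Cmod_inv by now apply Csub_neq, (away_neq p q z d).
  destruct Ha as [Hd Ha]. specialize (Ha t Ht).
  apply Rmult_le_compat; auto using norm_pos.
  - apply Rlt_le, Rinv_0_lt_compat. lra.
  - now apply Rinv_le_contravar.
Qed.

Lemma trans_norm p q h z d M : segcont p q h -> away p q z d ->
  (forall t, 0 <= t <= 1 -> ⟪h (pt p q t)⟫ <= M) ->
  ⟪cauchy_transform p q h z⟫ <= Cmod (q - p) * (/ d * M).
Proof.
  intros Hh Ha HM. apply seg_norm.
  - now apply (segcont_div p q h z d).
  - intros t Ht. apply norm_div_le; auto.
Qed.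

(** The resolvent identity
    [/ (x - w) - / (x - z) = (w - z) * (/ (x - w) * / (x - z))] under the integral.
    It yields continuity and differentiability of the transform, and its expansion
    around a distant centre. *)
Lemma trans_sub p q h z w d e : segcont p q h -> away p q z d -> away p q w e ->
  (cauchy_transform p q h w - cauchy_transform p q h z = (w - z)%C ⋅ cauchy_transform p q (fun x => (/ (x - z))%C ⋅ h x) w)%A.
Proof.
  intros Hh Hz Hw.
  assert (S1 : segcont p q (fun x => (/ (x - w))%C ⋅ ((/ (x - z))%C ⋅ h x))%A).
  { apply (segcont_div p q _ w e); [|exact Hw]. now apply (segcont_div p q h z d). }
  unfold cauchy_transform. rewrite <- seg_scal by exact S1.
  assert (E : seg p q (fun x => (/ (x - w))%C ⋅ h x)%A
    = seg p q (fun x => (w - z)%C ⋅ ((/ (x - w))%C ⋅ ((/ (x - z))%C ⋅ h x)) + (/ (x - z))%C ⋅ h x)%A).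
  { apply seg_ext. intros t Ht.
    pose proof (Csub_neq _ _ (away_neq p q z d t Hz Ht)) as Nz.
    pose proof (Csub_neq _ _ (away_neq p q w e t Hw Ht)) as Nw.
    rewrite !scal_scal, <- scal_add_l. f_equal. field. auto. }
  rewrite E, seg_add.
  - nring.
  - intros t Ht. apply ccont_scal. now apply S1.
  - now apply (segcont_div p q h z d).
Qed.

Lemma away_near p q z d w : away p q z d -> Cmod (w - z) < d / 2 -> away p q w (d / 2).
Proof.
  intros [Hd Ha] Hw. split; [lra|]. intros t Ht. specialize (Ha t Ht).
  pose proof (Cmod_sub_trans (pt p q t) w z). lra.
Qed.

Lemma trans_cont p q h z d : segcont p q h -> away p q z d -> ccont (cauchy_transform p q h) z.
Proof.
  intros Hh Ha. pose proof (segcont_div p q h z d Hh Ha) as Hh'.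
  destruct (segcont_bounded p q _ Hh') as [M [HM HB]].
  set (K := Cmod (q - p) * (/ (d / 2) * M) + 1).
  assert (Hd : 0 < d) by apply Ha.
  assert (HK : 0 < K).
  { unfold K. apply Rplus_le_lt_0_compat; [|lra]. apply Rmult_le_pos; [apply Cmod_ge_0|].
    apply Rmult_le_pos; [|lra]. apply Rlt_le, Rinv_0_lt_compat. lra. }
  intros eps Heps. exists (Rmin (d / 2) (eps / K)). split.
  { apply Rmin_glb_lt; [lra|]. now apply Rdiv_lt_0_compat. }
  intros w Hw. assert (Hw1 := Rlt_le_trans _ _ _ Hw (Rmin_l _ _)).
  assert (Hw2 := Rlt_le_trans _ _ _ Hw (Rmin_r _ _)).
  rewrite (trans_sub p q h z w d (d / 2)) by eauto using away_near.
  eapply Rle_trans; [apply norm_scale|].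
  apply Rle_trans with (eps / K * K); [|right; field; lra].
  apply Rmult_le_compat; auto using Cmod_ge_0, norm_pos, Rlt_le.
  eapply Rle_trans; [apply (trans_norm p q _ w (d / 2) M); eauto using away_near|].
  unfold K. lra.
Qed.

(** By [trans_sub] the difference quotient at [z] is again a transform. *)
Lemma trans_diff p q h z d : segcont p q h -> away p q z d -> cdiff (cauchy_transform p q h) z.
Proof.
  intros Hh Ha. exists (cauchy_transform p q (fun x => (/ (x - z))%C ⋅ h x)%A), (d / 2).
  split; [destruct Ha; lra|]. split.
  - apply (trans_cont p q _ z d); [|exact Ha]. now apply (segcont_div p q h z d).
  - intros w Hw. rewrite <- (trans_sub p q h z w d (d / 2)) by eauto using away_near. nring.
Qed.

Lemma away_vert (x c d : R) z e : 0 < e -> e <= Rabs (x - Re z) -> away (x, c) (x, d) z e.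
Proof.
  intros He H. split; [exact He|]. intros t Ht. eapply Rle_trans; [exact H|].
  eapply Rle_trans; [|apply Cmod_ge_Re]. right. f_equal.
  change (x - Re z = Re (pt (x, c) (x, d) t) - Re z). rewrite pt_Re. simpl. ring.
Qed.
Lemma away_horiz (y a b : R) z e : 0 < e -> e <= Rabs (y - Im z) -> away (a, y) (b, y) z e.
Proof.
  intros He H. split; [exact He|]. intros t Ht. eapply Rle_trans; [exact H|].
  eapply Rle_trans; [|apply Cmod_ge_Im]. right. f_equal.
  change (y - Im z = Im (pt (a, y) (b, y) t) - Im z). rewrite pt_Im. simpl. ring.
Qed.

Lemma segcont_crect (a b c d : R) h p q : (forall w, crect a b c d w -> ccont h w) ->
  crect a b c d p -> crect a b c d q -> segcont p q h.
Proof. intros H Hp Hq t Ht. apply H, crect_pt; assumption. Qed.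

Lemma cauchy_trans (a b c d : R) h z :
  (forall w, crect a b c d w -> cdiff h w) -> a < Re z < b -> c < Im z < d ->
  h z = ((/ two_pi_i)%C ⋅ (cauchy_transform (a, c) (b, c) h z + cauchy_transform (b, c) (b, d) h z
     + cauchy_transform (b, d) (a, d) h z + cauchy_transform (a, d) (a, c) h z))%A.
Proof.
  intros Hh Hx Hy. pose proof (cauchy_formula a b c d h z Hh Hx Hy) as E.
  unfold contour in E. unfold cauchy_transform. rewrite E, scal_scal, Cinv_l, scal_1; auto using two_pi_i_neq_0.
Qed.

Lemma sum_trans_diff (a b c d : R) h z :
  (forall w, crect a b c d w -> ccont h w) -> a < Re z < b -> c < Im z < d ->
  cdiff (fun z => (/ two_pi_i)%C ⋅ (cauchy_transform (a, c) (b, c) h z + cauchy_transform (b, c) (b, d) h z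
     + cauchy_transform (b, d) (a, d) h z + cauchy_transform (a, d) (a, c) h z))%A z.
Proof.
  intros Hh Hx Hy. apply cdiff_scal.
  apply cdiff_add; [apply cdiff_add; [apply cdiff_add|]|].
  - apply (trans_diff _ _ _ _ (Im z - c)).
    + apply (segcont_crect a b c d); unfold crect; simpl; auto; lra.
    + apply away_horiz; [lra|]. rewrite Rabs_left; lra.
  - apply (trans_diff _ _ _ _ (b - Re z)).
    + apply (segcont_crect a b c d); unfold crect; simpl; auto; lra.
    + apply away_vert; [lra|]. rewrite Rabs_pos_eq; lra.
  - apply (trans_diff _ _ _ _ (d - Im z)).
    + apply (segcont_crect a b c d); unfold crect; simpl; auto; lra.
    + apply away_horiz; [lra|]. rewrite Rabs_pos_eq; lra.
  - apply (trans_diff _ _ _ _ (Re z - a)).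
    + apply (segcont_crect a b c d); unfold crect; simpl; auto; lra.
    + apply away_vert; [lra|]. rewrite Rabs_left; lra.
Qed.

(** On a small square around [z], Cauchy's formula passes to the uniform limit and
    exhibits [f] as a sum of four transforms of its own boundary values. *)
Lemma weierstrass (u : nat -> C -> A) f z rho : 0 < rho ->
  (forall n w, Cmod (w - z) < rho -> cdiff (u n) w) ->
  (forall eps, 0 < eps -> exists N, forall n w, (N <= n)%nat -> Cmod (w - z) < rho -> ⟪u n w - f w⟫ <= eps) ->
  cdiff f z.
Proof.
  intros Hrho Hu Hlim.
  assert (Cf : forall w, Cmod (w - z) < rho -> ccont f w).
  { intros w Hw eps Heps. destruct (Hlim (eps / 3) ltac:(lra)) as [N HN].
    destruct (cdiff_cont _ _ (Hu N w Hw) (eps / 3) ltac:(lra)) as [d [Hd Hc]].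
    exists (Rmin d (rho - Cmod (w - z))). split; [apply Rmin_glb_lt; lra|]. intros x Hx.
    specialize (Hc x (Rlt_le_trans _ _ _ Hx (Rmin_l _ _))).
    assert (Hx2 := Rlt_le_trans _ _ _ Hx (Rmin_r _ _)).
    pose proof (Cmod_sub_trans x w z).
    pose proof (HN N x (le_n _) ltac:(lra)) as H1. pose proof (HN N w (le_n _) Hw) as H2.
    replace (f x - f w)%A with ((f x - u N x) + (u N x - u N w) + (u N w - f w))%A by nring.
    rewrite norm_sub_sym in H1.
    pose proof (norm_add ((f x - u N x) + (u N x - u N w))%A (u N w - f w)%A).
    pose proof (norm_add (f x - u N x)%A (u N x - u N w)%A). lra. }
  set (r := rho / 3). destruct z as [x y].
  assert (Hin : forall w, crect (x - r) (x + r) (y - r) (y + r) w -> Cmod (w - (x, y)) < rho).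
  { intros w [H1 H2]. eapply Rle_lt_trans; [apply Cmod_le_sum|].
    change (Rabs (Re w + - x) + Rabs (Im w + - y) < rho).
    assert (Rabs (Re w + - x) <= r) by (apply Rabs_le; lra).
    assert (Rabs (Im w + - y) <= r) by (apply Rabs_le; lra). unfold r in *. lra. }
  set (F := fun w => ((/ two_pi_i)%C ⋅
     (cauchy_transform (x - r, y - r)%R (x + r, y - r)%R f w + cauchy_transform (x + r, y - r)%R (x + r, y + r)%R f w
     + cauchy_transform (x + r, y + r)%R (x - r, y + r)%R f w + cauchy_transform (x - r, y + r)%R (x - r, y - r)%R f w))%A).
  assert (Hr : 0 < r) by (unfold r; lra).
  apply (cdiff_local F f (x, y) r Hr).
  2:{ apply sum_trans_diff; [|simpl; lra..]. intros w Hw. apply Cf, Hin, Hw. }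
  intros w Hw. symmetry.
  assert (Hw1 : x - r < Re w < x + r).
  { pose proof (Rle_lt_trans _ _ _ (Cmod_ge_Re (w - (x, y))) Hw) as H.
    change (Rabs (Re w - x) < r) in H. apply Rabs_lt_between in H. lra. }
  assert (Hw2 : y - r < Im w < y + r).
  { pose proof (Rle_lt_trans _ _ _ (Cmod_ge_Im (w - (x, y))) Hw) as H.
    change (Rabs (Im w - y) < r) in H. apply Rabs_lt_between in H. lra. }
  assert (Hside : forall p q e, crect (x - r) (x + r) (y - r) (y + r) p ->
    crect (x - r) (x + r) (y - r) (y + r) q -> away p q w e ->
    forall eps, 0 < eps -> exists N, forall n, (N <= n)%nat -> ⟪cauchy_transform p q (u n) w - cauchy_transform p q f w⟫ <= eps).
  { intros p q e Hp Hq Ha eps Heps. pose proof (proj1 Ha) as He. pose proof (Cmod_ge_0 (q - p)) as HL.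
    destruct (Hlim (eps * e / (Cmod (q - p) + 1))) as [N HN].
    { apply Rdiv_lt_0_compat; [|lra]. now apply Rmult_lt_0_compat. }
    exists N. intros n Hn.
    assert (Sf : segcont p q f) by (apply (segcont_crect _ _ _ _ f p q (fun w Hw => Cf w (Hin w Hw)) Hp Hq)).
    assert (Sn : segcont p q (fun w => u n w + - f w)%A).
    { intros t Ht. apply ccont_add; [|now apply ccont_opp, Sf].
      apply cdiff_cont, Hu, Hin, crect_pt; assumption. }
    replace (cauchy_transform p q (u n) w - cauchy_transform p q f w)%A with (cauchy_transform p q (fun w => u n w + - f w) w)%A.
    - eapply Rle_trans; [apply (trans_norm p q _ w e (eps * e / (Cmod (q - p) + 1)) Sn Ha)|].
      + intros t Ht. replace (u n (pt p q t) + - f (pt p q t))%A with (u n (pt p q t) - f (pt p q t))%A by nring.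
        apply HN; [exact Hn|]. now apply Hin, crect_pt.
      + replace (Cmod (q - p) * (/ e * (eps * e / (Cmod (q - p) + 1))))
          with (Cmod (q - p) * (eps / (Cmod (q - p) + 1))) by (field; lra).
        apply Rle_trans with ((Cmod (q - p) + 1) * (eps / (Cmod (q - p) + 1))); [|right; field; lra].
        apply Rmult_le_compat_r; [|lra]. apply Rlt_le, Rdiv_lt_0_compat; lra.
    - apply sub_0_eq. unfold cauchy_transform.
      assert (E : seg p q (fun w0 => (/ (w0 - w))%C ⋅ u n w0)%A =
        (seg p q (fun w0 => (/ (w0 - w))%C ⋅ (u n w0 + - f w0)) + seg p q (fun w0 => (/ (w0 - w))%C ⋅ f w0))%A).
      { rewrite <- seg_add.
        - apply seg_ext. intros t _. rewrite <- scal_add_r. f_equal. nring.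
        - now apply (segcont_div p q _ w e).
        - now apply (segcont_div p q _ w e). }
      rewrite E. nring. }
  apply norm_small_eq. intros eps Heps.
  destruct (Hside (x - r, y - r) (x + r, y - r) (Im w - (y - r))) with (eps := eps / 5) as [N1 H1].
  1-4: try (unfold crect; simpl; lra). { apply away_horiz; [lra|]. rewrite Rabs_left; lra. }
  destruct (Hside (x + r, y - r) (x + r, y + r) (x + r - Re w)) with (eps := eps / 5) as [N2 H2].
  1-4: try (unfold crect; simpl; lra). { apply away_vert; [lra|]. rewrite Rabs_pos_eq; lra. }
  destruct (Hside (x + r, y + r) (x - r, y + r) (y + r - Im w)) with (eps := eps / 5) as [N3 H3].
  1-4: try (unfold crect; simpl; lra). { apply away_horiz; [lra|]. rewrite Rabs_pos_eq; lra. }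
  destruct (Hside (x - r, y + r) (x - r, y - r) (Re w - (x - r))) with (eps := eps / 5) as [N4 H4].
  1-4: try (unfold crect; simpl; lra). { apply away_vert; [lra|]. rewrite Rabs_left; lra. }
  destruct (Hlim (eps / 5) ltac:(lra)) as [N0 H0].
  set (n := (N0 + N1 + N2 + N3 + N4)%nat).
  specialize (H1 n ltac:(unfold n; lia)). specialize (H2 n ltac:(unfold n; lia)).
  specialize (H3 n ltac:(unfold n; lia)). specialize (H4 n ltac:(unfold n; lia)).
  specialize (H0 n w ltac:(unfold n; lia) ltac:(unfold r in Hw; lra)).
  pose proof (cauchy_trans (x - r) (x + r) (y - r) (y + r) (u n) w
    (fun w' Hw' => Hu n w' (Hin w' Hw')) Hw1 Hw2) as E.
  unfold F. revert H1 H2 H3 H4 E.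
  set (X1 := cauchy_transform _ _ (u n) w). set (X2 := cauchy_transform _ _ (u n) w).
  set (X3 := cauchy_transform _ _ (u n) w). set (X4 := cauchy_transform _ _ (u n) w).
  set (Y1 := cauchy_transform _ _ f w). set (Y2 := cauchy_transform _ _ f w).
  set (Y3 := cauchy_transform _ _ f w). set (Y4 := cauchy_transform _ _ f w).
  intros H1 H2 H3 H4 E.
  replace (f w - (/ two_pi_i)%C ⋅ (Y1 + Y2 + Y3 + Y4))%A
    with ((f w - u n w) + (/ two_pi_i)%C ⋅ ((X1 - Y1) + (X2 - Y2) + (X3 - Y3) + (X4 - Y4)))%A.
  2:{ replace ((X1 - Y1) + (X2 - Y2) + (X3 - Y3) + (X4 - Y4))%A
       with ((X1 + X2 + X3 + X4) - (Y1 + Y2 + Y3 + Y4))%A by nring.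
      rewrite scal_sub_r, <- E. nring. }
  rewrite norm_sub_sym in H0.
  eapply Rle_trans; [apply norm_add|].
  assert (⟪(/ two_pi_i)%C ⋅ ((X1 - Y1) + (X2 - Y2) + (X3 - Y3) + (X4 - Y4))⟫ <= 4 * (eps / 5)).
  { eapply Rle_trans; [apply norm_scale|].
    pose proof (norm_add ((X1 - Y1) + (X2 - Y2) + (X3 - Y3))%A (X4 - Y4)%A).
    pose proof (norm_add ((X1 - Y1) + (X2 - Y2))%A (X3 - Y3)%A). pose proof (norm_add (X1 - Y1)%A (X2 - Y2)%A).
    apply Rle_trans with (1 * (4 * (eps / 5))); [|lra].
    apply Rmult_le_compat; auto using Cmod_ge_0, norm_pos.
    - rewrite Cmod_inv by apply two_pi_i_neq_0. rewrite <- Rinv_1. apply Rinv_le_contravar; [lra|].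
      eapply Rle_trans; [|apply Cmod_ge_Im]. simpl. pose proof PI2_1. rewrite Rabs_pos_eq; lra.
    - lra. }
  lra.
Qed.
End EdgeTransform.

(** * Runge's theorem *)

Section Runge.
Context {A : BanachAlgebra}.
Implicit Types (f g h : C -> A) (p q z w : C) (t : R).

(** Partial sums of the Taylor expansion of the transform around [e]:
    [/ (x - z)] is expanded in powers of [(z - e) / (x - e)]. *)
Fixpoint expansion p q (e : C) (N : nat) h z : A :=
  match N with
  | O => 0%A
  | S N => (cauchy_transform p q h e + (z - e)%C ⋅ expansion p q e N (fun w => (/ (w - e))%C ⋅ h w) z)%A
  end.

Lemma expansion_diff p q e N h z : cdiff (expansion p q e N h) z.
Proof.
  revert h. induction N as [|N IH]; intros h; simpl; [apply cdiff_const|].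
  apply cdiff_add; [apply cdiff_const | apply cdiff_scal_var, IH].
Qed.

Lemma expansion_error p q e X Y d N : 0 <= X -> away p q e Y -> forall h z M,
  segcont p q h -> away p q z d -> Cmod (z - e) <= X ->
  (forall t, 0 <= t <= 1 -> ⟪h (pt p q t)⟫ <= M) ->
  ⟪cauchy_transform p q h z - expansion p q e N h z⟫ <= (X / Y) ^ N * (Cmod (q - p) * (/ d * M)).
Proof.
  intros HX HY. induction N as [|N IH]; intros h z M Hh Hz HzX HM; simpl.
  - replace (cauchy_transform p q h z - 0)%A with (cauchy_transform p q h z) by nring. rewrite Rmult_1_l.
    now apply trans_norm.
  - set (h' := fun w => ((/ (w - e))%C ⋅ h w)%A).
    replace (cauchy_transform p q h z - (cauchy_transform p q h e + (z - e)%C ⋅ expansion p q e N h' z))%A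
      with ((z - e)%C ⋅ (cauchy_transform p q h' z - expansion p q e N h' z))%A.
    2:{ rewrite scal_sub_r. unfold h' at 1. rewrite <- (trans_sub p q h e z Y d) by assumption. nring. }
    eapply Rle_trans; [apply norm_scale|].
    replace (X / Y * (X / Y) ^ N * (Cmod (q - p) * (/ d * M)))
      with (X * ((X / Y) ^ N * (Cmod (q - p) * (/ d * (/ Y * M))))) by (unfold Rdiv; ring).
    apply Rmult_le_compat; auto using Cmod_ge_0, norm_pos.
    apply IH; auto.
    + now apply (segcont_div p q h e Y).
    + intros t Ht. apply norm_div_le; auto.
Qed.

(** A half-plane is a union of discs: a bounded set [K] at distance at least [eta]
    from the line of the segment lies in a disc with a far centre [m * (n1, n2)],
    inside a concentric disc that avoids the segment.  The expansion around that
    centre converges uniformly on [K]. *)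
Lemma trans_approx p q h (K : C -> Prop) (n1 n2 l eta rho : R) :
  segcont p q h -> n1 * n1 + n2 * n2 = 1 -> 0 < eta ->
  (forall t, 0 <= t <= 1 -> n1 * Re (pt p q t) + n2 * Im (pt p q t) = l) ->
  (forall z, K z -> l + eta <= n1 * Re z + n2 * Im z) ->
  (forall z, K z -> Re z * Re z + Im z * Im z <= rho) ->
  forall eps, 0 < eps -> exists Q : C -> A, (forall z, cdiff Q z) /\
    forall z, K z -> ⟪cauchy_transform p q h z - Q z⟫ <= eps.
Proof.
  intros Hh Hn Heta Hl HK Hrho eps Heps.
  destruct (excluded_middle_informative (exists z, K z)) as [[z0 Hz0]|Hempty].
  2:{ exists (fun _ => 0%A). split; [intros; apply cdiff_const|]. intros z Hz. exfalso; eauto. }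
  assert (Hrho0 : 0 <= rho).
  { eapply Rle_trans; [|apply (Hrho z0 Hz0)]. nra. }
  set (m := 1 + 2 * Rabs l + rho / eta).
  assert (Hq0 : 0 <= rho / eta) by (apply Rcomplements.Rdiv_le_0_compat; lra).
  assert (Hm1 : 1 <= m) by (unfold m; pose proof (Rabs_pos l); lra).
  assert (Hm2 : 2 * l < m) by (unfold m; pose proof (Rle_abs l); pose proof (Rabs_pos l); lra).
  assert (Hm3 : rho < 2 * m * eta).
  { assert (rho / eta * eta = rho) by (field; lra). unfold m. pose proof (Rabs_pos l). nra. }
  set (X2 := rho - 2 * m * (l + eta) + m * m). set (Y2 := m * m - 2 * m * l).
  assert (HXY : X2 < Y2) by (unfold X2, Y2; lra).
  assert (HY2 : 0 < Y2).
  { unfold Y2. replace (m * m - 2 * m * l) with (m * (m - 2 * l)) by ring. apply Rmult_lt_0_compat; lra. }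
  set (e := ((m * n1, m * n2) : C)).
  assert (HX : forall z, K z -> Cmod (z - e) <= sqrt X2).
  { intros [x y] Hz. apply sqrt_le_1_alt. specialize (HK _ Hz). specialize (Hrho _ Hz). simpl in *.
    unfold X2.
    assert (m * (l + eta) <= m * (n1 * x + n2 * y)) by (apply Rmult_le_compat_l; lra).
    assert (m * m * (n1 * n1 + n2 * n2) = m * m) by (rewrite Hn; ring). lra. }
  assert (HY : away p q e (sqrt Y2)).
  { split; [now apply sqrt_lt_R0|]. intros t Ht. specialize (Hl t Ht).
    destruct (pt p q t) as [x y]. apply sqrt_le_1_alt. simpl in *. unfold Y2.
    assert (m * (n1 * x + n2 * y) = m * l) by now rewrite Hl.
    assert (m * m * (n1 * n1 + n2 * n2) = m * m) by (rewrite Hn; ring).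
    pose proof (Rle_0_sqr x). pose proof (Rle_0_sqr y). unfold Rsqr in *. lra. }
  assert (HZ : forall z, K z -> away p q z eta).
  { intros z Hz. split; [exact Heta|]. intros t Ht. specialize (Hl t Ht). specialize (HK z Hz).
    set (s := (pt p q t - z)%C). pose proof (Cmod_ge_0 s) as Hs.
    assert (Es : n1 * Re s + n2 * Im s <= - eta).
    { unfold s. destruct (pt p q t), z; simpl in *. lra. }
    assert (E2 : Cmod s * Cmod s = Re s * Re s + Im s * Im s).
    { unfold Cmod. rewrite sqrt_sqrt; [|nra]. destruct s; simpl; ring. }
    assert (CS : (n1 * Re s + n2 * Im s) * (n1 * Re s + n2 * Im s) <= Cmod s * Cmod s).
    { rewrite E2. replace (Re s * Re s + Im s * Im s) with
        ((n1 * n1 + n2 * n2) * (Re s * Re s + Im s * Im s)) by (rewrite Hn; ring).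
      pose proof (Rle_0_sqr (n1 * Im s - n2 * Re s)). unfold Rsqr in *. lra. }
    apply Rnot_lt_le. intros Hlt. nra. }
  destruct (segcont_bounded p q h Hh) as [M [HM HB]].
  assert (HsY : 0 < sqrt Y2) by now apply sqrt_lt_R0.
  assert (Hq : 0 <= sqrt X2 / sqrt Y2 < 1).
  { pose proof (sqrt_pos X2). split; [apply Rcomplements.Rdiv_le_0_compat; lra|].
    apply (Rmult_lt_reg_r (sqrt Y2)); [exact HsY|].
    replace (sqrt X2 / sqrt Y2 * sqrt Y2) with (sqrt X2) by (field; lra). rewrite Rmult_1_l.
    destruct (Rle_lt_dec 0 X2); [apply sqrt_lt_1_alt; lra|].
    rewrite sqrt_neg_0 by lra. exact HsY. }
  set (L := Cmod (q - p) * (/ eta * M) + 1).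
  assert (HL : 1 <= L).
  { assert (0 <= Cmod (q - p) * (/ eta * M)); [|unfold L; lra].
    apply Rmult_le_pos; [apply Cmod_ge_0|]. apply Rmult_le_pos; [|lra].
    now apply Rlt_le, Rinv_0_lt_compat. }
  destruct (pow_lt_1_zero (sqrt X2 / sqrt Y2) ltac:(rewrite Rabs_pos_eq; lra) (eps / L)) as [N HN].
  { apply Rdiv_lt_0_compat; lra. }
  specialize (HN N (le_n _)). pose proof (pow_le (sqrt X2 / sqrt Y2) N (proj1 Hq)) as Hp.
  rewrite Rabs_pos_eq in HN by exact Hp.
  exists (expansion p q e N h). split; [intros; apply expansion_diff|].
  intros z Hz. eapply Rle_trans.
  - apply (expansion_error p q e (sqrt X2) (sqrt Y2) eta N (sqrt_pos X2) HY h z M); auto.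
  - apply Rle_trans with (eps / L * L); [|right; field; lra].
    apply Rmult_le_compat; auto; try lra.
    all: unfold L in *; lra.
Qed.

Lemma Cmod_inv_two_pi_i : Cmod (/ two_pi_i) <= 1.
Proof.
  rewrite Cmod_inv by apply two_pi_i_neq_0. rewrite <- Rinv_1. apply Rinv_le_contravar; [lra|].
  eapply Rle_trans; [|apply Cmod_ge_Im]. simpl. pose proof PI2_1. rewrite Rabs_pos_eq; lra.
Qed.

Lemma norm_cauchy_le (x : A) : ⟪(/ two_pi_i)%C ⋅ x⟫ <= ⟪x⟫.
Proof.
  eapply Rle_trans; [apply norm_scale|]. rewrite <- (Rmult_1_l ⟪x⟫) at 2.
  apply Rmult_le_compat_r; [apply norm_pos | apply Cmod_inv_two_pi_i].
Qed.

(** Cauchy's formula writes [h] as a sum of transforms of the four sides, and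
    each of them is approximated by [trans_approx]. *)
Lemma runge (a b c d eta : R) h :
  (forall w, crect a b c d w -> cdiff h w) -> 0 < eta ->
  forall eps, 0 < eps -> exists Q : C -> A, (forall z, cdiff Q z) /\
    forall z, crect (a + eta) (b - eta) (c + eta) (d - eta) z -> ⟪Q z - h z⟫ <= eps.
Proof.
  intros Hh Heta eps Heps. set (K := crect (a + eta) (b - eta) (c + eta) (d - eta)).
  destruct (excluded_middle_informative (exists z, K z)) as [[z0 [Hz1 Hz2]]|Hempty].
  2:{ exists (fun _ => 0%A). split; [intros; apply cdiff_const|]. intros z Hz. exfalso; eauto. }
  assert (Ch : forall w, crect a b c d w -> ccont h w) by (intros; now apply cdiff_cont, Hh).
  set (rho := (Rabs a + Rabs b) * (Rabs a + Rabs b) + (Rabs c + Rabs d) * (Rabs c + Rabs d)).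
  assert (Hrho : forall z, K z -> Re z * Re z + Im z * Im z <= rho).
  { intros z [H1 H2]. unfold rho.
    assert (forall u v x, u + eta <= x <= v - eta -> x * x <= (Rabs u + Rabs v) * (Rabs u + Rabs v)).
    { intros u v x Hx. rewrite <- (Rabs_pos_eq (x * x)), Rabs_mult by nra.
      assert (Rabs x <= Rabs u + Rabs v).
      { apply Rabs_le. pose proof (Rle_abs v). pose proof (Rle_abs (- u)). rewrite Rabs_Ropp in H0.
        pose proof (Rabs_pos u). pose proof (Rabs_pos v). lra. }
      pose proof (Rabs_pos x). apply Rmult_le_compat; lra. }
    pose proof (H _ _ _ H1). pose proof (H _ _ _ H2). lra. }
  destruct (trans_approx (a, c) (b, c) h K 0 1 c eta rho) with (eps := eps / 4) as [Q1 [D1 E1]]; try lra; auto.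
  { apply (segcont_crect a b c d); unfold crect; simpl; auto; lra. }
  { intros t Ht. rewrite pt_Re, pt_Im. simpl. ring. }
  { intros z [H1 H2]. lra. }
  destruct (trans_approx (b, c) (b, d) h K (-1) 0 (- b) eta rho) with (eps := eps / 4) as [Q2 [D2 E2]]; try lra; auto.
  { apply (segcont_crect a b c d); unfold crect; simpl; auto; lra. }
  { intros t Ht. rewrite pt_Re, pt_Im. simpl. ring. }
  { intros z [H1 H2]. lra. }
  destruct (trans_approx (b, d) (a, d) h K 0 (-1) (- d) eta rho) with (eps := eps / 4) as [Q3 [D3 E3]]; try lra; auto.
  { apply (segcont_crect a b c d); unfold crect; simpl; auto; lra. }
  { intros t Ht. rewrite pt_Re, pt_Im. simpl. ring. }
  { intros z [H1 H2]. lra. }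
  destruct (trans_approx (a, d) (a, c) h K 1 0 a eta rho) with (eps := eps / 4) as [Q4 [D4 E4]]; try lra; auto.
  { apply (segcont_crect a b c d); unfold crect; simpl; auto; lra. }
  { intros t Ht. rewrite pt_Re, pt_Im. simpl. ring. }
  { intros z [H1 H2]. lra. }
  exists (fun z => (/ two_pi_i)%C ⋅ (Q1 z + Q2 z + Q3 z + Q4 z))%A. split.
  { intros z. apply cdiff_scal. apply cdiff_add; [apply cdiff_add; [apply cdiff_add|]|]; auto. }
  intros z Hz. specialize (E1 z Hz). specialize (E2 z Hz). specialize (E3 z Hz). specialize (E4 z Hz).
  rewrite (cauchy_trans a b c d h z) by (try exact Hh; unfold K, crect in Hz; lra).
  rewrite <- scal_sub_r. eapply Rle_trans; [apply norm_cauchy_le|]. rewrite norm_sub_sym.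
  revert E1 E2 E3 E4.
  set (X1 := cauchy_transform _ _ h z). set (X2 := cauchy_transform _ _ h z).
  set (X3 := cauchy_transform _ _ h z). set (X4 := cauchy_transform _ _ h z). intros E1 E2 E3 E4.
  replace (X1 + X2 + X3 + X4 - (Q1 z + Q2 z + Q3 z + Q4 z))%A
    with ((X1 - Q1 z) + (X2 - Q2 z) + (X3 - Q3 z) + (X4 - Q4 z))%A by nring.
  pose proof (norm_add ((X1 - Q1 z) + (X2 - Q2 z) + (X3 - Q3 z))%A (X4 - Q4 z)%A).
  pose proof (norm_add ((X1 - Q1 z) + (X2 - Q2 z))%A (X3 - Q3 z)%A).
  pose proof (norm_add (X1 - Q1 z)%A (X2 - Q2 z)%A). lra.
Qed.
End Runge.

(** * Multiplicative approximation *)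

(** Compactness of closed rectangles, as a Lebesgue number for a gauge. *)
Lemma gauge (a b c d : R) (delta : C -> R) : (forall z, crect a b c d z -> 0 < delta z) ->
  exists r, 0 < r /\ forall z, crect a b c d z ->
    exists u, crect a b c d u /\ Cmod (z - u) < delta u /\ r <= delta u.
Proof.
  intros Hd.
  set (dl := fun u v : R => match Rlt_dec 0 (delta (u, v)) with
     | left H => mkposreal (delta (u, v) / 2) (Rdiv_lt_0_compat _ _ H Rlt_0_2)
     | right _ => mkposreal 1 Rlt_0_1 end).
  destruct (compactness_value_2d a b c d dl) as [r Hr].
  exists r. split; [apply cond_pos|]. intros [x y] [Hx Hy].
  destruct (NNPP _ (Hr x y Hx Hy)) as [u [v [Hu [Hv [H1 [H2 H3]]]]]].
  assert (Huv : crect a b c d (u, v)) by (split; assumption).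
  specialize (Hd _ Huv). exists (u, v). split; [exact Huv|].
  unfold dl in *. destruct (Rlt_dec 0 (delta (u, v))); [|lra]. simpl in *. split; [|lra].
  eapply Rle_lt_trans; [apply Cmod_le_sum|]. simpl. unfold Rminus in *. lra.
Qed.

Section Compactness.
Context {A : BanachAlgebra}.
Implicit Types (f g h : C -> A) (z w u : C).

Lemma uniform_cont (a b c d : R) f : (forall z, crect a b c d z -> ccont f z) ->
  forall eps, 0 < eps -> exists r, 0 < r /\ forall w w', crect a b c d w -> Cmod (w' - w) < r ->
    ⟪f w' - f w⟫ <= eps.
Proof.
  intros Hf eps Heps.
  set (P := fun u dl => 0 < dl /\ forall w, Cmod (w - u) < dl -> ⟪f w - f u⟫ <= eps / 2).
  set (dl := fun u => epsilon (inhabits 0) (P u)).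
  assert (HP : forall u, crect a b c d u -> P u (dl u)).
  { intros u Hu. apply epsilon_spec. exact (Hf u Hu (eps / 2) ltac:(lra)). }
  destruct (gauge a b c d (fun u => dl u / 2)) as [r [Hr H]].
  { intros u Hu. destruct (HP u Hu). lra. }
  exists r. split; [exact Hr|]. intros w w' Hw Hww.
  destruct (H w Hw) as [u [Hu [H1 H2]]]. destruct (HP u Hu) as [H3 H4].
  pose proof (Cmod_sub_trans w' w u).
  pose proof (H4 w ltac:(lra)) as F1. pose proof (H4 w' ltac:(lra)) as F2.
  rewrite norm_sub_sym in F1. pose proof (norm_sub_trans (f w') (f u) (f w)). lra.
Qed.

(** The gauge is made so small where [f] is large that its Lebesgue number bounds
    [f] at the nearby tags. *)
Lemma bounded_on_crect (a b c d : R) f : (forall z, crect a b c d z -> ccont f z) ->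
  exists M, 0 < M /\ forall z, crect a b c d z -> ⟪f z⟫ <= M.
Proof.
  intros Hf.
  set (P := fun u dl => 0 < dl /\ forall w, Cmod (w - u) < dl -> ⟪f w - f u⟫ <= 1).
  set (dl := fun u => epsilon (inhabits 0) (P u)).
  assert (HP : forall u, crect a b c d u -> P u (dl u)).
  { intros u Hu. apply epsilon_spec. exact (Hf u Hu 1 ltac:(lra)). }
  destruct (gauge a b c d (fun u => Rmin (dl u) (/ (1 + ⟪f u⟫)))) as [r [Hr H]].
  { intros u Hu. apply Rmin_glb_lt; [apply HP, Hu|]. apply Rinv_0_lt_compat.
    pose proof (norm_pos (f u)). lra. }
  exists (/ r + 1). pose proof (Rinv_0_lt_compat r Hr). split; [lra|].
  intros z Hz. destruct (H z Hz) as [u [Hu [H1 H2]]].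
  pose proof (proj2 (HP u Hu) z (Rlt_le_trans _ _ _ H1 (Rmin_l _ _))) as H3.
  assert (H4 : r <= / (1 + ⟪f u⟫)) by (eapply Rle_trans; [exact H2 | apply Rmin_r]).
  pose proof (norm_pos (f u)) as H5.
  assert (H6 : 1 + ⟪f u⟫ <= / r).
  { rewrite <- (Rinv_inv (1 + ⟪f u⟫)). apply Rinv_le_contravar; assumption. }
  pose proof (norm_le_sub (f z) (f u)). lra.
Qed.
End Compactness.

Section MultiplicativeRunge.
Context {A : BanachAlgebra}.
Implicit Types (f g h E F : C -> A) (z w : C).

(** The error is quadratic in [k * norm y], uniformly in [k]: with [y = q / k] the
    power [(1 + q / k) ^ k] replaces the exponential of [q]. *)
Lemma norm_power_error (y : A) (k : nat) : INR k * ⟪y⟫ <= 1 ->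
  ⟪vpow (1 + y)%A k - 1 - RtoC (INR k) ⋅ y⟫ <= (INR k * ⟪y⟫) * (INR k * ⟪y⟫).
Proof.
  pose proof (norm_pos y) as Hy. induction k as [|k IH]; intros Hk.
  - simpl. rewrite scal_0_l. replace (1 - 1 - 0 : A)%A with (0 : A)%A by nring. rewrite norm_0. lra.
  - rewrite S_INR in *. pose proof (pos_INR k) as Hk0.
    specialize (IH ltac:(nra)). set (P := vpow (1 + y)%A k) in *.
    set (ky := (RtoC (INR k) ⋅ y)%A) in *.
    assert (Hky : ⟪ky⟫ <= INR k * ⟪y⟫).
    { eapply Rle_trans; [apply norm_scale|]. rewrite Cmod_R, Rabs_pos_eq; lra. }
    replace (vpow (1 + y) (S k) - 1 - RtoC (INR k + 1)%R ⋅ y)%A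
      with ((P - 1 - ky) + y * ((P - 1 - ky) + ky))%A.
    2:{ rewrite RtoC_plus, scal_add_l, scal_1. fold ky. simpl. fold P. nring. }
    pose proof (norm_add (P - 1 - ky)%A (y * ((P - 1 - ky) + ky))%A) as H1.
    pose proof (norm_mul y ((P - 1 - ky) + ky)%A) as H2.
    pose proof (norm_add (P - 1 - ky)%A ky) as H3.
    assert (Hp : 0 <= INR k * ⟪y⟫) by now apply Rmult_le_pos.
    assert (H4 : ⟪P - 1 - ky + ky⟫ <= 2 * (INR k * ⟪y⟫)).
    { assert (INR k * ⟪y⟫ * (INR k * ⟪y⟫) <= INR k * ⟪y⟫ * 1) by (apply Rmult_le_compat_l; lra). lra. }
    assert (H5 : ⟪y⟫ * ⟪P - 1 - ky + ky⟫ <= ⟪y⟫ * (2 * (INR k * ⟪y⟫))) by (apply Rmult_le_compat_l; lra).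
    nra.
Qed.

Lemma cdiff_vpow f k z : cdiff f z -> cdiff (fun w => vpow (f w) k) z.
Proof.
  intros Hf. induction k as [|k IH]; simpl; [apply cdiff_const | now apply cdiff_mul].
Qed.

Lemma unit_vpow (x : A) k : is_unit x -> is_unit (vpow x k).
Proof. intros H. induction k; simpl; [apply unit_1 | now apply unit_mul]. Qed.

Definition hol_units (U : C -> Prop) f := forall z, U z -> cdiff f z /\ is_unit (f z).

Lemma hol_units_mul (U : C -> Prop) f g : hol_units U f -> hol_units U g ->
  hol_units U (fun z => f z * g z)%A.
Proof.
  intros Hf Hg z Hz. destruct (Hf z Hz), (Hg z Hz). split; [now apply cdiff_mul | now apply unit_mul].
Qed.
Lemma hol_units_inv (U : C -> Prop) f : hol_units U f -> hol_units U (fun z => inv (f z)).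
Proof.
  intros Hf z Hz. destruct (Hf z Hz). split; [now apply cdiff_inv | now apply unit_inv].
Qed.

(** One step of successive approximation: [E] is the inverse of
    [(1 + Q / N) ^ N], where the entire function [Q] approximates [F - 1]. *)
Lemma near_one_step (a b c d eta a0 b0 c0 d0 rho : R) F :
  (forall z, crect a b c d z -> cdiff F z) -> 0 < eta -> 0 < rho <= 1 / 16 ->
  (forall z, crect (a + eta) (b - eta) (c + eta) (d - eta) z -> crect a0 b0 c0 d0 z) ->
  (forall z, crect (a + eta) (b - eta) (c + eta) (d - eta) z -> ⟪F z - 1⟫ <= rho) ->
  exists E, hol_units (crect a0 b0 c0 d0) E /\
    forall z, crect (a + eta) (b - eta) (c + eta) (d - eta) z -> ⟪E z * F z - 1⟫ <= rho / 2.
Proof.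
  intros HF Heta Hrho HB Hnear.
  destruct (runge a b c d eta (fun z => F z - 1)%A) with (eps := rho * rho) as [Q [DQ HQ]].
  { intros z Hz. apply cdiff_sub; [now apply HF | apply cdiff_const]. }
  { exact Heta. }
  { apply Rmult_lt_0_compat; lra. }
  destruct (bounded_on_crect a0 b0 c0 d0 Q) as [M [HM HMB]].
  { intros z _. apply cdiff_cont, DQ. }
  (* N exceeds the norm of Q on the large rectangle, so that 1 + Q / N is invertible there *)
  destruct (INR_unbounded (M + 1)) as [N HN].
  assert (HN0 : 0 < INR N) by lra.
  set (y := fun z => (RtoC (/ INR N) ⋅ Q z)%A).
  assert (Hy : forall z, INR N * ⟪y z⟫ <= ⟪Q z⟫).
  { intros z. unfold y. eapply Rle_trans.
    - apply Rmult_le_compat_l; [lra | apply norm_scale].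
    - rewrite Cmod_R, Rabs_pos_eq by (apply Rlt_le, Rinv_0_lt_compat, HN0). right. field. lra. }
  set (G := fun z => vpow (1 + y z)%A N).
  assert (HG : hol_units (crect a0 b0 c0 d0) G).
  { intros z Hz. split.
    - apply cdiff_vpow, cdiff_add; [apply cdiff_const | apply cdiff_scal, DQ].
    - apply unit_vpow, unit_1_add. specialize (Hy z). specialize (HMB z Hz).
      apply (Rmult_lt_reg_l (INR N)); [exact HN0|]. lra. }
  exists (fun z => inv (G z)). split; [now apply hol_units_inv|].
  intros z Hz. specialize (Hnear z Hz). specialize (HQ z Hz). specialize (Hy z).
  pose proof (HG z (HB z Hz)) as [_ UG].
  assert (HQn : ⟪Q z⟫ <= 17 / 16 * rho).
  { pose proof (norm_le_sub (Q z) (F z - 1)%A). nra. }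
  pose proof (norm_pos (y z)) as Hy0.
  assert (HGQ : ⟪G z - 1 - Q z⟫ <= (17 / 16 * rho) * (17 / 16 * rho)).
  { pose proof (norm_power_error (y z) N ltac:(lra)) as HE.
    unfold y in HE at 2. rewrite scal_scal, <- RtoC_mult, Rinv_r, scal_1 in HE by lra.
    eapply Rle_trans; [exact HE|]. apply Rmult_le_compat; nra. }
  assert (HGF : ⟪G z - F z⟫ <= rho / 4).
  { replace (G z - F z)%A with ((G z - 1 - Q z) + (Q z - (F z - 1)))%A by nring.
    pose proof (norm_add (G z - 1 - Q z)%A (Q z - (F z - 1))%A). nra. }
  assert (HG1 : ⟪G z - 1⟫ <= 1 / 2).
  { replace (G z - 1)%A with ((G z - F z) + (F z - 1))%A by nring.
    pose proof (norm_add (G z - F z)%A (F z - 1)%A). lra. }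
  eapply Rle_trans; [apply (norm_div_l (G z - 1)%A _ HG1)|].
  replace ((1 + (G z - 1)) * (inv (G z) * F z - 1))%A with ((G z * inv (G z)) * F z - G z)%A by nring.
  rewrite inv_r by exact UG. replace (1 * F z - G z)%A with (F z - G z)%A by nring.
  rewrite norm_sub_sym. lra.
Qed.

Lemma near_one_approx (a b c d eta a0 b0 c0 d0 : R) F :
  (forall z, crect a b c d z -> cdiff F z) -> 0 < eta ->
  (forall z, crect a b c d z -> crect a0 b0 c0 d0 z) ->
  (forall z, crect (a + eta) (b - eta) (c + eta) (d - eta) z -> ⟪F z - 1⟫ <= 1 / 16) ->
  forall eps, 0 < eps -> exists E, hol_units (crect a0 b0 c0 d0) E /\
    forall z, crect (a + eta) (b - eta) (c + eta) (d - eta) z -> ⟪E z * F z - 1⟫ <= eps.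
Proof.
  intros HF Heta HB Hnear eps Heps.
  assert (Hn : forall n, exists E, hol_units (crect a0 b0 c0 d0) E /\
    forall z, crect (a + eta) (b - eta) (c + eta) (d - eta) z -> ⟪E z * F z - 1⟫ <= 1 / 16 * (1 / 2) ^ n).
  { induction n as [|n [E [HE IH]]].
    - exists (fun _ => 1%A). split.
      + intros z _. split; [apply cdiff_const | apply unit_1].
      + intros z Hz. replace (1 * F z - 1)%A with (F z - 1)%A by nring. simpl. rewrite Rmult_1_r. auto.
    - destruct (near_one_step a b c d eta a0 b0 c0 d0 (1 / 16 * (1 / 2) ^ n) (fun z => E z * F z)%A)
        as [E' [HE' H']].
      + intros z Hz. apply cdiff_mul; [apply HE; auto | now apply HF].
      + exact Heta.
      + assert (0 < (1 / 2) ^ n <= 1); [|lra]. split; [apply pow_lt; lra|].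
        apply Rle_trans with (1 ^ n); [apply pow_incr; lra | rewrite pow1; lra].
      + intros z Hz. apply HB. unfold crect in *. lra.
      + exact IH.
      + exists (fun z => E' z * E z)%A. split; [now apply hol_units_mul|].
        intros z Hz. replace (E' z * E z * F z)%A with (E' z * (E z * F z))%A by nring.
        eapply Rle_trans; [now apply H'|]. simpl ((1 / 2) ^ S n). lra. }
  destruct (pow_lt_1_zero (1 / 2) ltac:(rewrite Rabs_pos_eq; lra) eps Heps) as [N HN].
  specialize (HN N (le_n _)). pose proof (pow_le (1 / 2) N ltac:(lra)).
  rewrite Rabs_pos_eq in HN by assumption.
  destruct (Hn N) as [E [HE H']]. exists E. split; [exact HE|]. intros z Hz.
  specialize (H' z Hz). lra.
Qed.

(** Put [f_j z = f (z0 + (j / m) (z - z0))].  By uniform continuity the quotients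
    [inv (f_j) * f_(j + 1)] are near 1.  If [E * f_j] is near 1 then so is
    [E * f_(j + 1)], and [near_one_approx] brings it back within the initial
    tolerance, so that the errors do not accumulate along the [m] steps. *)
Lemma hol_runge (a b c d eta a0 b0 c0 d0 : R) f :
  hol_units (crect a b c d) f -> 0 < eta ->
  (forall z, crect a b c d z -> crect a0 b0 c0 d0 z) ->
  forall eps, 0 < eps -> exists E, hol_units (crect a0 b0 c0 d0) E /\
    forall z, crect (a + eta) (b - eta) (c + eta) (d - eta) z -> ⟪E z * f z - 1⟫ <= eps.
Proof.
  intros Hf Heta HB eps Heps. set (K := crect (a + eta) (b - eta) (c + eta) (d - eta)).
  destruct (excluded_middle_informative (exists z, K z)) as [[z1 Hz1]|Hempty].
  2:{ exists (fun _ => 1%A). split; [intros z _; split; [apply cdiff_const | apply unit_1]|].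
      intros z Hz. exfalso; eauto. }
  assert (HKQ : forall z, K z -> crect a b c d z) by (unfold K, crect; intros; lra).
  set (z0 := ((a, c) : C)).
  assert (Hz0 : crect a b c d z0) by (unfold K, crect in *; simpl; lra).
  assert (Cf : forall z, crect a b c d z -> ccont f z) by (intros; now apply cdiff_cont, Hf).
  destruct (bounded_on_crect a b c d (fun z => inv (f z))) as [M [HM HMB]].
  { intros z Hz. apply cdiff_cont, cdiff_inv; now apply Hf. }
  destruct (uniform_cont a b c d f Cf (1 / 64 / M)) as [r [Hr Hunif]]; [apply Rdiv_lt_0_compat; lra|].
  set (D := (b - a) + (d - c)).
  assert (HD : forall z, crect a b c d z -> Cmod (z - z0) <= D).
  { intros z [H1 H2]. eapply Rle_trans; [apply Cmod_le_sum|].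
    change (Rabs (Re z + - a) + Rabs (Im z + - c) <= D). rewrite !Rabs_pos_eq by lra. unfold D. lra. }
  destruct (INR_unbounded (D / r + 1)) as [m Hm].
  assert (HD0 : 0 <= D) by (eapply Rle_trans; [apply Cmod_ge_0 | apply (HD z0 Hz0)]).
  assert (HDr : 0 <= D / r) by (apply Rcomplements.Rdiv_le_0_compat; lra).
  assert (Hm0 : 0 < INR m) by lra.
  set (t := fun j : nat => INR j / INR m).
  assert (Ht : forall j, (j <= m)%nat -> 0 <= t j <= 1).
  { intros j Hj. apply le_INR in Hj. pose proof (pos_INR j). unfold t. split.
    - apply Rcomplements.Rdiv_le_0_compat; lra.
    - apply (Rmult_le_reg_r (INR m)); [lra|]. replace (INR j / INR m * INR m) with (INR j) by (field; lra). lra. }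
  set (fj := fun j z => f (pt z0 z (t j))).
  assert (Hin : forall j z, (j <= m)%nat -> crect a b c d z -> crect a b c d (pt z0 z (t j))).
  { intros j z Hj Hz. apply crect_pt; auto. }
  assert (Hfj : forall j, (j <= m)%nat -> hol_units (crect a b c d) (fj j)).
  { intros j Hj z Hz. pose proof (Hf _ (Hin j z Hj Hz)) as [H1 H2]. split; [|exact H2].
    assert (E : forall w, pt z0 w (t j) = (RtoC (1 - t j) * z0 + RtoC (t j) * w)%C).
    { intros w. unfold pt. rewrite RtoC_minus. ring. }
    apply (cdiff_local (fun w => f (RtoC (1 - t j) * z0 + RtoC (t j) * w)%C) _ z 1 Rlt_0_1).
    - intros w _. unfold fj. now rewrite E.
    - apply cdiff_affine. rewrite <- E. exact H1. }
  assert (Hstep : forall j z, (S j <= m)%nat -> crect a b c d z ->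
     ⟪inv (fj j z) * fj (S j) z - 1⟫ <= 1 / 64).
  { intros j z Hj Hz. pose proof (Hfj j ltac:(lia) z Hz) as [_ U].
    replace (inv (fj j z) * fj (S j) z - 1)%A with (inv (fj j z) * (fj (S j) z - fj j z))%A.
    2:{ replace (inv (fj j z) * (fj (S j) z - fj j z))%A
          with (inv (fj j z) * fj (S j) z - inv (fj j z) * fj j z)%A by nring.
        now rewrite inv_l. }
    eapply Rle_trans; [apply norm_mul|].
    replace (1 / 64) with (M * (1 / 64 / M)) by (field; lra).
    apply Rmult_le_compat; auto using norm_pos.
    - apply HMB, Hin; [lia | exact Hz].
    - apply Hunif; [apply Hin; [lia | exact Hz]|].
      replace (pt z0 z (t (S j)) - pt z0 z (t j))%C with (RtoC (/ INR m) * (z - z0))%C.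
      + rewrite Cmod_mult, Cmod_R, Rabs_pos_eq by (apply Rlt_le, Rinv_0_lt_compat, Hm0).
        apply Rle_lt_trans with (/ INR m * D).
        * apply Rmult_le_compat_l; [apply Rlt_le, Rinv_0_lt_compat, Hm0 | now apply HD].
        * apply (Rmult_lt_reg_l (INR m)); [lra|].
          replace (INR m * (/ INR m * D)) with (D / r * r) by (field; lra). nra.
      + unfold pt, t. rewrite S_INR. unfold Rdiv. rewrite !RtoC_mult, RtoC_plus. ring. }
  assert (Hj : forall j, (j <= m)%nat -> exists E, hol_units (crect a0 b0 c0 d0) E /\
     forall z, K z -> ⟪E z * fj j z - 1⟫ <= 1 / 64).
  { induction j as [|j IH]; intros Hj.
    - exists (fun _ => inv (f z0)). pose proof (Hf z0 Hz0) as [_ U]. split.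
      + intros z _. split; [apply cdiff_const | now apply unit_inv].
      + intros z Hz. unfold fj, t. replace (pt z0 z (INR 0 / INR m)) with z0.
        * rewrite inv_l by exact U. replace (1 - 1 : A)%A with (0 : A)%A by nring. rewrite norm_0. lra.
        * unfold pt. simpl. unfold Rdiv. rewrite Rmult_0_l. ring.
    - destruct (IH ltac:(lia)) as [E [HE HEj]].
      destruct (near_one_approx a b c d eta a0 b0 c0 d0 (fun z => E z * fj (S j) z)%A)
        with (eps := 1 / 64) as [E' [HE' H']].
      + intros z Hz. apply cdiff_mul; [apply HE; auto | now apply Hfj].
      + exact Heta.
      + exact HB.
      + intros z Hz. fold K in Hz. specialize (HEj z Hz). specialize (Hstep j z Hj (HKQ z Hz)).
        pose proof (Hfj j ltac:(lia) z (HKQ z Hz)) as [_ U].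
        set (x := (E z * fj j z - 1)%A) in *. set (y := (inv (fj j z) * fj (S j) z - 1)%A) in *.
        replace (E z * fj (S j) z - 1)%A with (x + y + x * y)%A.
        2:{ unfold x, y.
            replace (E z * fj j z - 1 + (inv (fj j z) * fj (S j) z - 1) +
               (E z * fj j z - 1) * (inv (fj j z) * fj (S j) z - 1))%A
             with (E z * (fj j z * inv (fj j z)) * fj (S j) z - 1)%A by nring.
            rewrite inv_r by exact U. nring. }
        pose proof (norm_add (x + y)%A (x * y)%A). pose proof (norm_add x y). pose proof (norm_mul x y).
        pose proof (norm_pos x). pose proof (norm_pos y). nra.
      + lra.
      + exists (fun z => E' z * E z)%A. split; [now apply hol_units_mul|].
        intros z Hz. replace (E' z * E z * fj (S j) z)%A with (E' z * (E z * fj (S j) z))%A by nring.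
        now apply H'. }
  destruct (Hj m (le_n _)) as [E [HE HEm]].
  assert (Hfm : forall z, fj m z = f z).
  { intros z. unfold fj, t. replace (INR m / INR m) with 1 by (field; lra). f_equal. unfold pt. ring. }
  destruct (near_one_approx a b c d eta a0 b0 c0 d0 (fun z => E z * f z)%A) with (eps := eps)
    as [E' [HE' H']].
  - intros z Hz. apply cdiff_mul; [apply HE; auto | now apply Hf].
  - exact Heta.
  - exact HB.
  - intros z Hz. rewrite <- Hfm. specialize (HEm z Hz). lra.
  - exact Heps.
  - exists (fun z => E' z * E z)%A. split; [now apply hol_units_mul|].
    intros z Hz. replace (E' z * E z * f z)%A with (E' z * (E z * f z))%A by nring. now apply H'.
Qed.
End MultiplicativeRunge.

(** * Cartan's lemma on compact rectangles *)

Section OpenSets.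
Implicit Types (z w : C) (U V : C -> Prop).

Definition is_open (U : C -> Prop) := forall z, U z -> exists rho, 0 < rho /\ forall w, Cmod (w - z) < rho -> U w.

Lemma is_open_and U V : is_open U -> is_open V -> is_open (fun z => U z /\ V z).
Proof.
  intros HU HV z [H1 H2]. destruct (HU z H1) as [r [Hr Br]]. destruct (HV z H2) as [s [Hs Bs]].
  exists (Rmin r s). split; [now apply Rmin_glb_lt|]. intros w Hw. split.
  - apply Br. eapply Rlt_le_trans; [exact Hw | apply Rmin_l].
  - apply Bs. eapply Rlt_le_trans; [exact Hw | apply Rmin_r].
Qed.
Lemma open_Re_lt (b : R) : is_open (fun z => Re z < b).
Proof.
  intros z Hz. exists (b - Re z). split; [lra|]. intros w Hw.
  pose proof (Cmod_ge_Re (w - z)) as H. change (Rabs (Re w - Re z) <= Cmod (w - z)) in H.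
  apply Rabs_le_between in H. lra.
Qed.
Lemma open_Re_gt (a : R) : is_open (fun z => a < Re z).
Proof.
  intros z Hz. exists (Re z - a). split; [lra|]. intros w Hw.
  pose proof (Cmod_ge_Re (w - z)) as H. change (Rabs (Re w - Re z) <= Cmod (w - z)) in H.
  apply Rabs_le_between in H. lra.
Qed.
Lemma open_Im_between (c d : R) : is_open (fun z => c < Im z < d).
Proof.
  intros z Hz. exists (Rmin (Im z - c) (d - Im z)). split; [apply Rmin_glb_lt; lra|]. intros w Hw.
  pose proof (Cmod_ge_Im (w - z)) as H. change (Rabs (Im w - Im z) <= Cmod (w - z)) in H.
  pose proof (Rmin_l (Im z - c) (d - Im z)). pose proof (Rmin_r (Im z - c) (d - Im z)).
  apply Rabs_le_between in H. lra.
Qed.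

Definition orect (a b c d : R) z : Prop := a < Re z < b /\ c < Im z < d.

Lemma open_orect (a b c d : R) : is_open (orect a b c d).
Proof.
  apply is_open_and; [apply is_open_and; [apply open_Re_gt | apply open_Re_lt] | apply open_Im_between].
Qed.
End OpenSets.

Section Products.
Context {A : BanachAlgebra}.
Implicit Types (f g h F : C -> A) (u : nat -> C -> A) (z w : C).

Fixpoint prods u (n : nat) z : A :=
  match n with O => 1%A | S n => ((1 + u n z) * prods u n z)%A end.

(** The partial products stay within [1/2] of 1 and form a Cauchy sequence
    uniformly on [U]. *)
Lemma product_limit (U : C -> Prop) u : is_open U ->
  (forall n z, U z -> cdiff (u n) z) ->
  (forall n z, U z -> ⟪u n z⟫ <= 1 / 8 * (1 / 2) ^ n) ->
  exists p, hol_units U p /\ forall z, U z -> converges (fun n => prods u n z) (p z).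
Proof.
  intros HU Hd Hn.
  assert (Hpow : forall n, 0 < (1 / 2) ^ n) by (intros; apply pow_lt; lra).
  assert (Hp1 : forall n z, U z -> ⟪prods u n z - 1⟫ <= 1 / 2 * (1 - (1 / 2) ^ n)).
  { intros n z Hz. induction n as [|n IH]; simpl.
    - replace (1 - 1 : A)%A with (0 : A)%A by nring. rewrite norm_0. lra.
    - set (P := prods u n z) in *. specialize (Hn n z Hz).
      replace ((1 + u n z) * P - 1)%A with ((P - 1) + (u n z * (P - 1) + u n z))%A by nring.
      pose proof (norm_add (P - 1)%A (u n z * (P - 1) + u n z)%A).
      pose proof (norm_add (u n z * (P - 1))%A (u n z)).
      assert (⟪u n z * (P - 1)⟫ <= 1 / 8 * (1 / 2) ^ n * 1).
      { eapply Rle_trans; [apply norm_mul|]. specialize (Hpow n).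
        apply Rmult_le_compat; auto using norm_pos. lra. }
      lra. }
  assert (Hstep : forall z, U z -> forall n, ⟪prods u (S n) z - prods u n z⟫ <= 1 / 4 * (1 / 2) ^ n).
  { intros z Hz n. specialize (Hp1 n z Hz). specialize (Hn n z Hz). specialize (Hpow n). simpl.
    set (P := prods u n z) in *.
    replace ((1 + u n z) * P - P)%A with (u n z * (P - 1) + u n z)%A by nring.
    pose proof (norm_add (u n z * (P - 1))%A (u n z)).
    assert (⟪u n z * (P - 1)⟫ <= 1 / 8 * (1 / 2) ^ n * 1).
    { eapply Rle_trans; [apply norm_mul|].
      apply Rmult_le_compat; auto using norm_pos. lra. }
    lra. }
  set (Q := fun z l => converges (fun n => prods u n z) l /\
      forall n, ⟪l - prods u n z⟫ <= 1 / 4 / (1 - 1 / 2) * (1 / 2) ^ n).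
  set (p := fun z => epsilon (inhabits (0 : A)%A) (Q z)).
  assert (HQ : forall z, U z -> Q z (p z)).
  { intros z Hz. apply epsilon_spec. apply complete_geometric; [lra | now apply Hstep]. }
  exists p. split; [|intros z Hz; apply HQ, Hz].
  assert (Hdp : forall n z, U z -> cdiff (prods u n) z).
  { intros n z Hz. induction n as [|n IH]; simpl; [apply cdiff_const|].
    apply cdiff_mul; [apply cdiff_add; [apply cdiff_const | now apply Hd] | exact IH]. }
  intros z Hz. split.
  - destruct (HU z Hz) as [rho [Hrho Hball]].
    apply (weierstrass (prods u) p z rho Hrho); [auto|].
    intros eps Heps.
    destruct (pow_lt_1_zero (1 / 2) ltac:(rewrite Rabs_pos_eq; lra) eps Heps) as [N HN].
    exists N. intros n w Hnn Hw. specialize (HN n Hnn). specialize (Hpow n).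
    rewrite Rabs_pos_eq in HN by lra. pose proof (proj2 (HQ w (Hball w Hw)) n) as H.
    rewrite norm_sub_sym. lra.
  - replace (p z) with (1 + (p z - 1))%A by nring. apply unit_1_add.
    pose proof (proj2 (HQ z Hz) 0%nat) as H. simpl in H. lra.
Qed.
End Products.

Section Newton.
Context {A : BanachAlgebra}.
Implicit Types (f g h F : C -> A) (z w : C).

(** In the decomposition [F - 1 = left_part - right_part] given by Cauchy's formula,
    [right_part] is the contribution, with opposite sign, of the right side: it is
    holomorphic to the left of that side. *)
Definition right_part (a b c d : R) F z : A :=
  (- ((/ two_pi_i)%C ⋅ cauchy_transform (b, c) (b, d) (fun w => F w - 1) z))%A.
Definition left_part (a b c d : R) F z : A :=
  ((/ two_pi_i)%C ⋅ (cauchy_transform (a, c) (b, c) (fun w => F w - 1) z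
     + cauchy_transform (b, d) (a, d) (fun w => F w - 1) z + cauchy_transform (a, d) (a, c) (fun w => F w - 1) z))%A.

Lemma Cmod_vert (x c d : R) : c <= d -> Cmod ((x, d) - (x, c)) <= d - c.
Proof.
  intros H. eapply Rle_trans; [apply Cmod_le_sum|].
  change (Rabs (x + - x) + Rabs (d + - c) <= d - c).
  replace (x + - x) with 0 by ring. rewrite Rabs_R0, Rabs_pos_eq; lra.
Qed.
Lemma Cmod_horiz (y a b : R) : a <= b -> Cmod ((b, y) - (a, y)) <= b - a.
Proof.
  intros H. eapply Rle_trans; [apply Cmod_le_sum|].
  change (Rabs (b + - a) + Rabs (y + - y) <= b - a).
  replace (y + - y) with 0 by ring. rewrite Rabs_R0, Rabs_pos_eq; lra.
Qed.

Section Step.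
Variables (a b c d k eps L : R) (F : C -> A).
Hypothesis (Hab : a <= b) (Hcd : c <= d) (Hk : 0 < k) (HLx : b - a <= L) (HLy : d - c <= L).
Hypothesis (HF : forall z, crect a b c d z -> cdiff F z).
Hypothesis (Hnear : forall z, crect a b c d z -> ⟪F z - 1⟫ <= eps).

Let phi w : A := (F w - 1)%A.

Lemma phi_seg p q : crect a b c d p -> crect a b c d q -> segcont p q phi.
Proof.
  intros Hp Hq. apply (segcont_crect a b c d); auto.
  intros w Hw. apply cdiff_cont, cdiff_sub; [now apply HF | apply cdiff_const].
Qed.

Lemma side_norm p q z : crect a b c d p -> crect a b c d q -> away p q z k -> Cmod (q - p) <= L ->
  ⟪cauchy_transform p q phi z⟫ <= L * eps / k.
Proof.
  intros Hp Hq Ha HL.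
  assert (Heps : 0 <= eps) by (eapply Rle_trans; [apply (norm_pos (F p - 1)%A) | apply (Hnear p Hp)]).
  eapply Rle_trans; [apply (trans_norm p q phi z k eps (phi_seg p q Hp Hq) Ha)|].
  - intros t Ht. apply Hnear, crect_pt; assumption.
  - replace (L * eps / k) with (L * (/ k * eps)) by (unfold Rdiv; ring).
    apply Rmult_le_compat_r; [|exact HL].
    apply Rmult_le_pos; [now apply Rlt_le, Rinv_0_lt_compat | exact Heps].
Qed.

Lemma right_diff z : Re z < b -> cdiff (right_part a b c d F) z.
Proof.
  intros Hz. apply cdiff_opp, cdiff_scal, (trans_diff _ _ _ _ (b - Re z)).
  - apply phi_seg; unfold crect; simpl; lra.
  - apply away_vert; [lra|]. rewrite Rabs_pos_eq; lra.
Qed.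
Lemma right_norm z : Re z <= b - k -> ⟪right_part a b c d F z⟫ <= L * eps / k.
Proof.
  intros Hz. unfold right_part. rewrite norm_neg. eapply Rle_trans; [apply norm_cauchy_le|].
  apply side_norm; [unfold crect; simpl; lra..| |].
  - apply away_vert; [lra|]. rewrite Rabs_pos_eq; lra.
  - eapply Rle_trans; [now apply Cmod_vert | exact HLy].
Qed.
Lemma left_diff z : a < Re z -> c < Im z < d -> cdiff (left_part a b c d F) z.
Proof.
  intros Hx Hy. apply cdiff_scal, cdiff_add; [apply cdiff_add|].
  - apply (trans_diff _ _ _ _ (Im z - c)); [apply phi_seg; unfold crect; simpl; lra|].
    apply away_horiz; [lra|]. rewrite Rabs_left; lra.
  - apply (trans_diff _ _ _ _ (d - Im z)); [apply phi_seg; unfold crect; simpl; lra|].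
    apply away_horiz; [lra|]. rewrite Rabs_pos_eq; lra.
  - apply (trans_diff _ _ _ _ (Re z - a)); [apply phi_seg; unfold crect; simpl; lra|].
    apply away_vert; [lra|]. rewrite Rabs_left; lra.
Qed.
Lemma left_norm z : a + k <= Re z -> c + k <= Im z <= d - k ->
  ⟪left_part a b c d F z⟫ <= 3 * (L * eps / k).
Proof.
  intros Hx Hy. unfold left_part. eapply Rle_trans; [apply norm_cauchy_le|].
  eapply Rle_trans; [apply norm_add|].
  assert (H1 : ⟪cauchy_transform (a, c) (b, c) phi z⟫ <= L * eps / k).
  { apply side_norm; [unfold crect; simpl; lra..| |].
    - apply away_horiz; [lra|]. rewrite Rabs_left; lra.
    - eapply Rle_trans; [now apply Cmod_horiz | exact HLx]. }
  assert (H2 : ⟪cauchy_transform (b, d) (a, d) phi z⟫ <= L * eps / k).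
  { apply side_norm; [unfold crect; simpl; lra..| |].
    - apply away_horiz; [lra|]. rewrite Rabs_pos_eq; lra.
    - rewrite Cmod_sub_sym. eapply Rle_trans; [now apply Cmod_horiz | exact HLx]. }
  assert (H3 : ⟪cauchy_transform (a, d) (a, c) phi z⟫ <= L * eps / k).
  { apply side_norm; [unfold crect; simpl; lra..| |].
    - apply away_vert; [lra|]. rewrite Rabs_left; lra.
    - rewrite Cmod_sub_sym. eapply Rle_trans; [now apply Cmod_vert | exact HLy]. }
  pose proof (norm_add (cauchy_transform (a, c) (b, c) phi z) (cauchy_transform (b, d) (a, d) phi z)).
  unfold phi in *. lra.
Qed.

Lemma parts_split z : a < Re z < b -> c < Im z < d ->
  (F z - 1 = left_part a b c d F z - right_part a b c d F z)%A.
Proof.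
  intros Hx Hy. unfold left_part, right_part.
  assert (Hd : forall w, crect a b c d w -> cdiff (fun w => F w - 1)%A w).
  { intros w Hw. apply cdiff_sub; [now apply HF | apply cdiff_const]. }
  rewrite (cauchy_trans a b c d _ z Hd Hx Hy).
  rewrite !scal_add_r. nring.
Qed.

Definition newton_next z : A := ((1 + right_part a b c d F z) * F z * inv (1 + left_part a b c d F z))%A.

Hypothesis (Hsmall : 3 * (L * eps / k) <= 1 / 2).

Lemma left_unit z : a + k <= Re z -> c + k <= Im z <= d - k -> is_unit (1 + left_part a b c d F z)%A.
Proof.
  intros Hx Hy. apply unit_1_add. pose proof (left_norm z Hx Hy). lra.
Qed.

Lemma newton_next_diff z : crect (a + k) (b - k) (c + k) (d - k) z -> cdiff newton_next z.
Proof.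
  intros [Hx Hy]. apply cdiff_mul; [apply cdiff_mul|].
  - apply cdiff_add; [apply cdiff_const | apply right_diff; lra].
  - apply HF. unfold crect. lra.
  - apply (cdiff_inv (fun z => 1 + left_part a b c d F z)%A); [apply left_unit; lra|].
    apply cdiff_add; [apply cdiff_const | apply left_diff; lra].
Qed.

(** Multiplying [newton_next - 1] by [1 + left_part] leaves [right_part * (F - 1)]. *)
Lemma newton_next_norm z : crect (a + k) (b - k) (c + k) (d - k) z ->
  ⟪newton_next z - 1⟫ <= 2 * (L * eps / k) * eps.
Proof.
  intros [Hx Hy]. unfold newton_next.
  pose proof (left_unit z ltac:(lra) ltac:(lra)) as U.
  pose proof (left_norm z ltac:(lra) ltac:(lra)) as HN2.
  pose proof (right_norm z ltac:(lra)) as HN1.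
  pose proof (Hnear z ltac:(unfold crect; lra)) as HN.
  pose proof (parts_split z ltac:(lra) ltac:(lra)) as E.
  set (x := right_part a b c d F z) in *. set (y := left_part a b c d F z) in *.
  eapply Rle_trans; [apply (norm_div_r y); lra|].
  replace (((1 + x) * F z * inv (1 + y) - 1) * (1 + y))%A
    with ((1 + x) * F z * (inv (1 + y) * (1 + y)) - (1 + y))%A by nring.
  rewrite inv_l by exact U.
  (* the terms of first order cancel *)
  replace ((1 + x) * F z * 1 - (1 + y))%A with ((F z - 1) - (y - x) + x * (F z - 1))%A by nring.
  rewrite E at 1. replace (y - x - (y - x) + x * (F z - 1))%A with (x * (F z - 1))%A by nring.
  pose proof (norm_mul x (F z - 1)%A).
  assert (⟪x⟫ * ⟪F z - 1⟫ <= L * eps / k * eps) by (apply Rmult_le_compat; auto using norm_pos).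
  lra.
Qed.
End Step.

(** Newton iteration on rectangles shrunk by [e n], which increases to [eta].  The
    margin gained at step [n] is [k n = eta / 2 ^ (n + 1)], and with
    [norm (F - 1) <= s / 8 ^ n] the corrections are bounded by
    [3 * L * s / (8 ^ n * k n)], which is of order [1 / 4 ^ n]; hence the choice
    [s = eta / (48 * L)]. *)
Lemma cartan_near_one (a b c d eta : R) : 0 < eta -> a + 2 * eta <= b -> c + 2 * eta <= d ->
  exists s, 0 < s /\ forall F : C -> A,
    (forall z, crect a b c d z -> cdiff F z) -> (forall z, crect a b c d z -> ⟪F z - 1⟫ <= s) ->
    exists g1 g2, hol_units (fun z => Re z < b - eta /\ c + eta < Im z < d - eta) g1 /\
      hol_units (fun z => a + eta < Re z /\ c + eta < Im z < d - eta) g2 /\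
      forall z, a + eta < Re z < b - eta -> c + eta < Im z < d - eta -> (g1 z * F z = g2 z)%A.
Proof.
  intros Heta Hab Hcd. set (L := (b - a) + (d - c)).
  assert (HL : 0 < L) by (unfold L; lra).
  set (s := eta / (48 * L)). assert (Hs : 0 < s) by (apply Rdiv_lt_0_compat; lra).
  exists s. split; [exact Hs|]. intros F HF Hnear.
  set (e := fun n : nat => eta * (1 - (1 / 2) ^ n)).
  set (k := fun n : nat => eta * (1 / 2) ^ S n).
  set (eps := fun n : nat => s * (1 / 8) ^ n).
  set (Fs := fix Fs n : C -> A := match n with
     | O => F
     | S n => newton_next (a + e n) (b - e n) (c + e n) (d - e n) (Fs n) end).
  assert (Hpow : forall n, 0 < (1 / 2) ^ n <= 1).
  { intros n. split; [apply pow_lt; lra|].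
    apply Rle_trans with (1 ^ n); [apply pow_incr; lra | rewrite pow1; lra]. }
  assert (Hpow4 : forall n, 0 < (1 / 4) ^ n <= (1 / 2) ^ n).
  { intros n. split; [apply pow_lt; lra | apply pow_incr; lra]. }
  assert (Hk : forall n, 0 < k n) by (intros n; apply Rmult_lt_0_compat; [lra | apply Hpow]).
  assert (HeS : forall n, e (S n) = e n + k n) by (intros n; unfold e, k; simpl; field).
  assert (He : forall n, 0 <= e n <= eta).
  { intros n. specialize (Hpow n). unfold e. nra. }
  assert (Hek : forall n, e n + k n <= eta) by (intros n; rewrite <- HeS; apply He).
  assert (Hratio : forall n, L * eps n / k n = 1 / 24 * (1 / 4) ^ n).
  { intros n. unfold eps, k, s. replace (1 / 8) with (1 / 2 * (1 / 4)) by field.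
    rewrite Rpow_mult_distr. simpl. specialize (Hpow n). field. lra. }
  assert (HFs : forall n, (forall z, crect (a + e n) (b - e n) (c + e n) (d - e n) z -> cdiff (Fs n) z) /\
     (forall z, crect (a + e n) (b - e n) (c + e n) (d - e n) z -> ⟪Fs n z - 1⟫ <= eps n)).
  { induction n as [|n [IH1 IH2]].
    - unfold e, eps. simpl. replace (eta * (1 - 1)) with 0 by ring. rewrite Rmult_1_r.
      split; intros z Hz; [apply HF | apply Hnear]; unfold crect in *; lra.
    - specialize (He n). pose proof (Hek n) as Hekn. specialize (Hratio n). specialize (Hpow4 n).
      specialize (Hpow n). specialize (Hk n). rewrite HeS.
      assert (Hz : forall z, crect (a + (e n + k n)) (b - (e n + k n)) (c + (e n + k n)) (d - (e n + k n)) z ->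
         crect (a + e n + k n) (b - e n - k n) (c + e n + k n) (d - e n - k n) z) by (unfold crect; intros; lra).
      assert (HS : eps (S n) = eps n / 8) by (unfold eps; simpl; field).
      split; intros z Hzz; apply Hz in Hzz.
      + apply (newton_next_diff _ _ _ _ (k n) (eps n) L); auto; try (unfold L; lra); rewrite Hratio; lra.
      + eapply Rle_trans.
        * apply (newton_next_norm _ _ _ _ (k n) (eps n) L); auto; try (unfold L; lra); rewrite Hratio; lra.
        * rewrite Hratio, HS.
          assert (0 < eps n) by (apply Rmult_lt_0_compat; [exact Hs | apply pow_lt; lra]). nra. }
  set (u1 := fun n => right_part (a + e n) (b - e n) (c + e n) (d - e n) (Fs n)).
  set (u2 := fun n => left_part (a + e n) (b - e n) (c + e n) (d - e n) (Fs n)).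
  set (U1 := fun z : C => Re z < b - eta /\ c + eta < Im z < d - eta).
  set (U2 := fun z : C => a + eta < Re z /\ c + eta < Im z < d - eta).
  assert (HB2 : forall n z, U2 z -> ⟪u2 n z⟫ <= 1 / 8 * (1 / 2) ^ n).
  { intros n z [Hx Hy]. destruct (HFs n) as [H1 H2].
    specialize (He n). specialize (Hek n). specialize (Hratio n). specialize (Hpow4 n). specialize (Hk n).
    eapply Rle_trans; [apply (left_norm _ _ _ _ (k n) (eps n) L); auto; unfold L; lra|]. rewrite Hratio. lra. }
  destruct (product_limit U1 u1) as [g1 [Hg1 Hlim1]].
  { apply is_open_and; [apply open_Re_lt | apply open_Im_between]. }
  { intros n z [Hx Hy]. destruct (HFs n) as [H1 H2]. specialize (He n).
    apply (right_diff (a + e n) (b - e n) (c + e n) (d - e n)); try exact H1; lra. }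
  { intros n z [Hx Hy]. destruct (HFs n) as [H1 H2].
    specialize (He n). specialize (Hek n). specialize (Hratio n). specialize (Hpow4 n). specialize (Hk n).
    eapply Rle_trans; [apply (right_norm _ _ _ _ (k n) (eps n) L); auto; unfold L; lra|]. rewrite Hratio. lra. }
  destruct (product_limit U2 u2) as [g2 [Hg2 Hlim2]].
  { apply is_open_and; [apply open_Re_gt | apply open_Im_between]. }
  { intros n z [Hx Hy]. destruct (HFs n) as [H1 H2]. specialize (He n).
    apply (left_diff (a + e n) (b - e n) (c + e n) (d - e n)); try exact H1; lra. }
  { exact HB2. }
  exists g1, g2. split; [exact Hg1|]. split; [exact Hg2|].
  intros z Hx Hy.
  assert (HU1 : U1 z) by (unfold U1; lra). assert (HU2 : U2 z) by (unfold U2; lra).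
  assert (Hid : forall n, (prods u1 n z * F z = Fs n z * prods u2 n z)%A).
  { induction n as [|n IH].
    - simpl. nring.
    - assert (Un : is_unit (1 + u2 n z)%A).
      { apply unit_1_add. specialize (HB2 n z HU2). specialize (Hpow n). lra. }
      change (Fs (S n) z) with ((1 + u1 n z) * Fs n z * inv (1 + u2 n z))%A. simpl.
      replace ((1 + u1 n z) * Fs n z * inv (1 + u2 n z) * ((1 + u2 n z) * prods u2 n z))%A
        with ((1 + u1 n z) * Fs n z * (inv (1 + u2 n z) * (1 + u2 n z)) * prods u2 n z)%A by nring.
      rewrite inv_l by exact Un.
      replace ((1 + u1 n z) * prods u1 n z * F z)%A with ((1 + u1 n z) * (prods u1 n z * F z))%A by nring.
      rewrite IH. nring. }
  assert (HF1 : converges (fun n => Fs n z) (1 : A)%A).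
  { intros ep Hep.
    destruct (pow_lt_1_zero (1 / 8) ltac:(rewrite Rabs_pos_eq; lra) (ep / s)) as [N HN].
    { now apply Rdiv_lt_0_compat. }
    exists N. intros n Hn. specialize (HN n Hn). rewrite Rabs_pos_eq in HN by (apply pow_le; lra).
    destruct (HFs n) as [_ H2]. specialize (He n).
    eapply Rle_trans; [apply H2; unfold crect; lra|]. unfold eps.
    apply (Rmult_lt_compat_l s) in HN; [|exact Hs].
    replace (s * (ep / s)) with ep in HN by (field; lra). lra. }
  apply (converges_unique (fun n => prods u1 n z * F z)%A).
  - apply converges_mul_r. now apply Hlim1.
  - replace (g2 z) with (1 * g2 z)%A by nring.
    apply (converges_ext (fun n => Fs n z * prods u2 n z)%A _ _ 0); [intros; now rewrite Hid|].
    apply converges_mul; [exact HF1 | now apply Hlim2].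
Qed.

(** [hol_runge] makes [f] near 1 by a left factor [E], which is absorbed into [g1]:
    this is why [g1] is only obtained inside the rectangle on which [E] is
    controlled. *)
Lemma cartan_compact (a b c d eta a0 b0 c0 d0 : R) f : 0 < eta -> a < b -> c < d ->
  hol_units (crect (a - 2 * eta) (b + 2 * eta) (c - 2 * eta) (d + 2 * eta)) f ->
  (forall z, crect (a - 2 * eta) (b + 2 * eta) (c - 2 * eta) (d + 2 * eta) z -> crect a0 b0 c0 d0 z) ->
  exists g1 g2, hol_units (fun z => crect a0 b0 c0 d0 z /\ Re z < b /\ c < Im z < d) g1 /\
      hol_units (fun z => crect a0 b0 c0 d0 z /\ a < Re z /\ c < Im z < d) g2 /\
      forall z, a < Re z < b -> c < Im z < d -> (g1 z * f z = g2 z)%A.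
Proof.
  intros Heta Hab Hcd Hf HB.
  destruct (cartan_near_one (a - eta) (b + eta) (c - eta) (d + eta) eta) as [s [Hs Hcartan]]; try lra.
  destruct (hol_runge _ _ _ _ eta a0 b0 c0 d0 f Hf Heta HB s Hs) as [E [HE HEf]].
  destruct (Hcartan (fun z => E z * f z)%A) as [h1 [h2 [Hh1 [Hh2 H]]]].
  - intros z Hz. assert (Hz' : crect (a - 2 * eta) (b + 2 * eta) (c - 2 * eta) (d + 2 * eta) z)
      by (unfold crect in *; lra).
    apply cdiff_mul; [apply HE, HB, Hz' | apply Hf, Hz'].
  - intros z Hz. apply HEf. unfold crect in *. lra.
  - exists (fun z => h1 z * E z)%A, h2. split; [|split].
    + intros z [HBz Hz]. destruct (HE z HBz). destruct (Hh1 z ltac:(lra)).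
      split; [now apply cdiff_mul | now apply unit_mul].
    + intros z [HBz Hz]. apply Hh2. lra.
    + intros z Hx Hy. rewrite <- H by lra. nring.
Qed.
End Newton.

(** * Exhaustion of the height *)

Section Exhaustion.
Context {A : BanachAlgebra}.
Implicit Types (f g h F : C -> A) (z w : C).

Lemma cdiff_open (U : C -> Prop) f g z : is_open U -> U z -> (forall w, U w -> f w = g w) ->
  cdiff f z -> cdiff g z.
Proof.
  intros HU Hz E. destruct (HU z Hz) as [r [Hr Br]]. apply (cdiff_local f g z r Hr). auto.
Qed.

Lemma hol_units_sub (U V : C -> Prop) f : (forall z, U z -> V z) -> hol_units V f -> hol_units U f.
Proof. intros H Hf z Hz. apply Hf, H, Hz. Qed.

Lemma hol_units_ext (U : C -> Prop) f g : is_open U -> (forall z, U z -> f z = g z) ->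
  hol_units U f -> hol_units U g.
Proof.
  intros HU E Hf z Hz. destruct (Hf z Hz). split; [now apply (cdiff_open U f)|]. now rewrite <- E.
Qed.

Lemma inv_mul (x y : A) : is_unit x -> is_unit y -> inv (x * y)%A = (inv y * inv x)%A.
Proof.
  intros Hx Hy. apply (unit_cancel_l (x * y)%A); [now apply unit_mul|].
  rewrite inv_r by now apply unit_mul.
  replace (x * y * (inv y * inv x))%A with (x * (y * inv y) * inv x)%A by nring.
  rewrite inv_r by exact Hy. replace (x * 1 * inv x)%A with (x * inv x)%A by nring. now rewrite inv_r.
Qed.

(** From any rank [m] on, [fs] is [fs m] multiplied by partial products of the
    convergent infinite product of the factors [1 + u n]. *)
Lemma limit_of_corrections (W : nat -> C -> Prop) (u fs : nat -> C -> A) :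
  (forall n, is_open (W n)) -> (forall n z, W n z -> W (S n) z) ->
  (forall n z, W n z -> cdiff (u n) z /\ ⟪u n z⟫ <= 1 / 8 * (1 / 2) ^ n) ->
  (forall n, hol_units (W n) (fs n)) ->
  (forall n z, W n z -> fs (S n) z = ((1 + u n z) * fs n z)%A) ->
  exists F, forall m, hol_units (W m) F /\ forall z, W m z -> converges (fun n => fs n z) (F z).
Proof.
  intros HO HW Hu Hfs HS.
  assert (HWk : forall m k z, W m z -> W (m + k)%nat z).
  { intros m k z Hz. induction k as [|k IH]; [now rewrite Nat.add_0_r|].
    rewrite <- plus_n_Sm. now apply HW. }
  assert (Hm : forall m, exists p, hol_units (W m) p /\
     forall z, W m z -> converges (fun n => fs n z) (p z * fs m z)%A).
  { intros m. destruct (product_limit (W m) (fun k => u (m + k)%nat) (HO m)) as [p [Hp Hlim]].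
    - intros k z Hz. now apply Hu, HWk.
    - intros k z Hz. eapply Rle_trans; [now apply Hu, HWk|].
      rewrite pow_add. assert (0 < (1 / 2) ^ k) by (apply pow_lt; lra).
      assert (0 < (1 / 2) ^ m <= 1).
      { split; [apply pow_lt; lra|].
        apply Rle_trans with (1 ^ m); [apply pow_incr; lra | rewrite pow1; lra]. }
      nra.
    - exists p. split; [exact Hp|]. intros z Hz eps Heps.
      assert (E : forall k, fs (m + k)%nat z = (prods (fun k => u (m + k)%nat) k z * fs m z)%A).
      { induction k as [|k IH]; [rewrite Nat.add_0_r; simpl; nring|].
        rewrite <- plus_n_Sm, HS, IH by now apply HWk. simpl. nring. }
      destruct (converges_mul_r _ _ (fs m z) (Hlim z Hz) eps Heps) as [N HN].
      exists (m + N)%nat. intros n Hn. replace n with (m + (n - m))%nat by lia.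
      rewrite E. apply HN. lia. }
  set (F := fun z => epsilon (inhabits (0 : A)%A) (fun l => converges (fun n => fs n z) l)).
  assert (HF : forall m z, W m z -> converges (fun n => fs n z) (F z)).
  { intros m z Hz. unfold F. apply epsilon_spec. destruct (Hm m) as [p [_ Hp]].
    exists (p z * fs m z)%A. now apply Hp. }
  exists F. intros m. split; [|apply HF].
  destruct (Hm m) as [p [Hp Hlim]].
  apply (hol_units_ext (W m) (fun z => p z * fs m z)%A); [apply HO | | now apply hol_units_mul].
  intros z Hz. apply (converges_unique (fun n => fs n z)); [now apply Hlim | now apply (HF m)].
Qed.

(** The states of the recursion are triples [(f1, f2, u)], where [u] is the correction
    that leads to the pair [(f1, f2)] from the preceding one; the same [u] serves for
    both components, since it comes from a map on the union of their domains. *)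
Lemma cartan_open (a1 b1 a2 b2 c d : R) f : a1 <= a2 -> a2 < b1 -> b1 <= b2 -> c < d ->
  hol_units (orect a2 b1 c d) f ->
  exists f1 f2, hol_units (orect a1 b1 c d) f1 /\ hol_units (orect a2 b2 c d) f2 /\
    forall z, orect a2 b1 c d z -> (f1 z * f z = f2 z)%A.
Proof.
  intros Ha Hab Hb Hcd Hf.
  set (w0 := (b1 - a2) / 3). set (al := a2 + w0). set (be := a2 + 2 * w0).
  assert (Hw0 : 0 < w0) by (unfold w0; lra).
  assert (Hal : al = a2 + w0) by reflexivity. assert (Hbe' : be = a2 + 2 * w0) by reflexivity.
  assert (Hbe : be + w0 = b1) by (unfold be, w0; field).
  clearbody al be w0.
  set (tau := Rmin 1 ((d - c) / 4)). assert (Htau : 0 < tau) by (apply Rmin_glb_lt; lra).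
  assert (Htau1 : tau <= 1) by apply Rmin_l. assert (Htau2 : tau <= (d - c) / 4) by apply Rmin_r.
  set (e := fun n : nat => tau * (1 / 2) ^ n).
  assert (He : forall n, 0 < e n <= tau).
  { intros n. assert (0 < (1 / 2) ^ n <= 1).
    { split; [apply pow_lt; lra|].
      apply Rle_trans with (1 ^ n); [apply pow_incr; lra | rewrite pow1; lra]. }
    unfold e. nra. }
  assert (HeS : forall n, e (S n) = e n / 2) by (intros n; unfold e; simpl; field).
  set (B := crect (a1 - 1) (b2 + 1) c d).
  (* S1 n and S2 n are the domains of the n-th solution; V n, where it is compared with
     the next one, has a slightly smaller height so that Runge approximation applies on it *)
  set (S1 := fun n z => B z /\ Re z < be /\ c + e n < Im z < d - e n).
  set (S2 := fun n z => B z /\ al < Re z /\ c + e n < Im z < d - e n).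
  set (V := fun n => orect a1 b2 (c + 3 / 2 * e n) (d - 3 / 2 * e n)).
  assert (Hlevel : forall n, exists g1 g2, hol_units (S1 n) g1 /\ hol_units (S2 n) g2 /\
     forall z, al < Re z < be -> c + e n < Im z < d - e n -> (g1 z * f z = g2 z)%A).
  { intros n. specialize (He n). set (eta := Rmin (w0 / 4) (e n / 4)).
    assert (Heta : 0 < eta) by (apply Rmin_glb_lt; lra).
    assert (H1 : eta <= w0 / 4) by apply Rmin_l. assert (H2 : eta <= e n / 4) by apply Rmin_r.
    apply (cartan_compact al be (c + e n) (d - e n) eta (a1 - 1) (b2 + 1) c d f Heta); try lra.
    - intros z Hz. apply Hf. unfold orect, crect in *. lra.
    - intros z Hz. unfold crect in *. lra. }
  set (P := fun n (x : (C -> A) * (C -> A) * (C -> A)) =>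
     hol_units (S1 n) (fst (fst x)) /\ hol_units (S2 n) (snd (fst x)) /\
     forall z, al < Re z < be -> c + e n < Im z < d - e n -> (fst (fst x) z * f z = snd (fst x) z)%A).
  set (Rel := fun n (x y : (C -> A) * (C -> A) * (C -> A)) =>
     forall z, V n z -> cdiff (snd y) z /\ ⟪snd y z⟫ <= 1 / 8 * (1 / 2) ^ n /\
       (Re z < be -> fst (fst y) z = ((1 + snd y z) * fst (fst x) z)%A) /\
       (al < Re z -> snd (fst y) z = ((1 + snd y z) * snd (fst x) z)%A)).
  destruct (Hlevel 0%nat) as [g01 [g02 Hg0]].
  destruct (dependent_choice P Rel (g01, g02, fun _ => 0%A)) as [x [_ Hx]].
  { exact Hg0. }
  { intros n [[f1 f2] v] [Hf1 [Hf2 Hff]]. simpl in Hf1, Hf2, Hff.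
    destruct (Hlevel (S n)) as [g1 [g2 [Hg1 [Hg2 Hgg]]]].
    specialize (He n). specialize (HeS n).
    assert (HS1 : forall z, S1 n z -> S1 (S n) z) by (unfold S1, B, crect; intros; lra).
    assert (HS2 : forall z, S2 n z -> S2 (S n) z) by (unfold S2, B, crect; intros; lra).
    (* f1 * f = f2 and g1 * f = g2, so that f cancels *)
    assert (Hglue : forall z, S1 n z -> S2 n z -> (g1 z * inv (f1 z) = g2 z * inv (f2 z))%A).
    { intros z Hz1 Hz2. destruct (Hf1 z Hz1) as [_ U1].
      assert (Uf : is_unit (f z)) by (apply Hf; unfold S1, S2, orect in *; lra).
      rewrite <- Hgg by (unfold S1, S2 in *; lra). rewrite <- Hff by (unfold S1, S2 in *; lra).
      rewrite inv_mul by assumption.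
      replace (g1 z * f z * (inv (f z) * inv (f1 z)))%A
        with (g1 z * (f z * inv (f z)) * inv (f1 z))%A by nring.
      rewrite inv_r by exact Uf. nring. }
    set (H := fun z => if Rlt_dec (Re z) be then (g1 z * inv (f1 z))%A else (g2 z * inv (f2 z))%A).
    assert (HH1 : forall z, S1 n z -> H z = (g1 z * inv (f1 z))%A).
    { intros z Hz. unfold H. destruct (Rlt_dec (Re z) be); [reflexivity|]. unfold S1 in Hz. lra. }
    assert (HH2 : forall z, S2 n z -> H z = (g2 z * inv (f2 z))%A).
    { intros z Hz. unfold H. destruct (Rlt_dec (Re z) be); [|reflexivity].
      apply Hglue; [|exact Hz]. unfold S1, S2, B, crect in *. lra. }
    assert (HQ1 : hol_units (S1 n) (fun z => g1 z * inv (f1 z))%A).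
    { apply hol_units_mul; [now apply (hol_units_sub _ _ g1 HS1) | now apply hol_units_inv]. }
    assert (HQ2 : hol_units (S2 n) (fun z => g2 z * inv (f2 z))%A).
    { apply hol_units_mul; [now apply (hol_units_sub _ _ g2 HS2) | now apply hol_units_inv]. }
    assert (HH : hol_units (orect (a1 - 1) (b2 + 1) (c + e n) (d - e n)) H).
    { intros z Hz. destruct (Rlt_le_dec (Re z) be) as [Hlt|Hle].
      - assert (Hz1 : S1 n z) by (unfold S1, B, crect, orect in *; lra).
        split; [|rewrite HH1 by exact Hz1; now apply HQ1].
        apply (cdiff_open (fun z => orect (a1 - 1) (b2 + 1) (c + e n) (d - e n) z /\ Re z < be)
          (fun z => g1 z * inv (f1 z))%A).
        + apply is_open_and; [apply open_orect | apply open_Re_lt].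
        + auto.
        + intros w Hw. symmetry. apply HH1. unfold S1, B, crect, orect in *; lra.
        + now apply HQ1.
      - assert (Hz2 : S2 n z) by (unfold S2, B, crect, orect in *; lra).
        split; [|rewrite HH2 by exact Hz2; now apply HQ2].
        apply (cdiff_open (fun z => orect (a1 - 1) (b2 + 1) (c + e n) (d - e n) z /\ al < Re z)
          (fun z => g2 z * inv (f2 z))%A).
        + apply is_open_and; [apply open_orect | apply open_Re_gt].
        + split; [exact Hz | apply Hz2].
        + intros w Hw. symmetry. apply HH2. unfold S2, B, crect, orect in *; lra.
        + now apply HQ2. }
    set (eta := e n / 4).
    destruct (hol_runge (a1 - eta) (b2 + eta) (c + 3 / 2 * e n - eta) (d - 3 / 2 * e n + eta) eta
       (a1 - 1) (b2 + 1) c d H) with (eps := 1 / 8 * (1 / 2) ^ n) as [E [HE HEH]].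
    - intros z Hz. apply HH. unfold crect, orect, eta in *. lra.
    - unfold eta. lra.
    - intros z Hz. unfold crect, eta in *. lra.
    - assert (0 < (1 / 2) ^ n) by (apply pow_lt; lra). lra.
    - exists ((fun z => E z * g1 z)%A, (fun z => E z * g2 z)%A, (fun z => E z * H z - 1)%A).
      split; [split; [|split]|]; simpl.
      + intros z Hz. destruct (HE z (proj1 Hz)). destruct (Hg1 z Hz).
        split; [now apply cdiff_mul | now apply unit_mul].
      + intros z Hz. destruct (HE z (proj1 Hz)). destruct (Hg2 z Hz).
        split; [now apply cdiff_mul | now apply unit_mul].
      + intros z Hz1 Hz2. rewrite <- Hgg by assumption. nring.
      + intros z Hz. unfold V in Hz. simpl.
        assert (HzB : B z) by (unfold B, crect, orect in *; lra).
        split; [|split; [|split]].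
        * apply cdiff_sub; [|apply cdiff_const]. apply cdiff_mul; [now apply HE|].
          apply HH. unfold orect in *. lra.
        * apply HEH. unfold crect, orect in *. lra.
        * intros Hlt. assert (Hz1 : S1 n z) by (split; [exact HzB|]; unfold orect in *; lra).
          rewrite (HH1 z Hz1). destruct (Hf1 z Hz1) as [_ U1].
          replace ((1 + (E z * (g1 z * inv (f1 z)) - 1)) * f1 z)%A
            with (E z * g1 z * (inv (f1 z) * f1 z))%A by nring.
          rewrite inv_l by exact U1. nring.
        * intros Hlt. assert (Hz2 : S2 n z) by (split; [exact HzB|]; unfold orect in *; lra).
          rewrite (HH2 z Hz2). destruct (Hf2 z Hz2) as [_ U2].
          replace ((1 + (E z * (g2 z * inv (f2 z)) - 1)) * f2 z)%A
            with (E z * g2 z * (inv (f2 z) * f2 z))%A by nring.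
          rewrite inv_l by exact U2. nring. }
  assert (HVS : forall n z, V n z -> V (S n) z).
  { intros n z Hz. specialize (He n). specialize (HeS n). unfold V, orect in *. lra. }
  assert (HVB : forall n z, V n z -> B z /\ c + e n < Im z < d - e n).
  { intros n z Hz. specialize (He n). unfold V, B, orect, crect in *. lra. }
  destruct (limit_of_corrections (fun n z => V n z /\ Re z < be)
    (fun n => snd (x (S n))) (fun n => fst (fst (x n)))) as [F1 HF1].
  { intros n. apply is_open_and; [apply open_orect | apply open_Re_lt]. }
  { intros n z [Hz1 Hz2]. auto. }
  { intros n z [Hz1 Hz2]. destruct (proj2 (Hx n) z Hz1) as [H1 [H2 _]]. auto. }
  { intros n z [Hz1 Hz2]. destruct (HVB n z Hz1) as [HzB Him].
    apply (proj1 (Hx n)). split; [exact HzB | split; [exact Hz2 | exact Him]]. }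
  { intros n z [Hz1 Hz2]. now apply (proj2 (Hx n) z Hz1). }
  destruct (limit_of_corrections (fun n z => V n z /\ al < Re z)
    (fun n => snd (x (S n))) (fun n => snd (fst (x n)))) as [F2 HF2].
  { intros n. apply is_open_and; [apply open_orect | apply open_Re_gt]. }
  { intros n z [Hz1 Hz2]. auto. }
  { intros n z [Hz1 Hz2]. destruct (proj2 (Hx n) z Hz1) as [H1 [H2 _]]. auto. }
  { intros n z [Hz1 Hz2]. destruct (HVB n z Hz1) as [HzB Him].
    apply (proj1 (Hx n)). split; [exact HzB | split; [exact Hz2 | exact Him]]. }
  { intros n z [Hz1 Hz2]. now apply (proj2 (Hx n) z Hz1). }
  assert (HVex : forall z, orect a1 b2 c d z -> exists m, V m z).
  { intros z [Hz1 Hz2].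
    destruct (pow_lt_1_zero (1 / 2) ltac:(rewrite Rabs_pos_eq; lra) (Rmin (Im z - c) (d - Im z) / 2)) as [N HN].
    { apply Rdiv_lt_0_compat; [apply Rmin_glb_lt; lra | lra]. }
    exists N. specialize (HN N (le_n _)). assert (Hp : 0 < (1 / 2) ^ N) by (apply pow_lt; lra).
    rewrite Rabs_pos_eq in HN by lra.
    pose proof (Rmin_l (Im z - c) (d - Im z)). pose proof (Rmin_r (Im z - c) (d - Im z)).
    assert (e N <= (1 / 2) ^ N) by (unfold e; nra).
    unfold V, orect. lra. }
  assert (HolF1 : hol_units (fun z => orect a1 b2 c d z /\ Re z < be) F1).
  { intros z [Hz1 Hz2]. destruct (HVex z Hz1) as [m Hm]. now apply (proj1 (HF1 m)). }
  assert (HolF2 : hol_units (fun z => orect a1 b2 c d z /\ al < Re z) F2).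
  { intros z [Hz1 Hz2]. destruct (HVex z Hz1) as [m Hm]. now apply (proj1 (HF2 m)). }
  assert (HF : forall z, orect a1 b2 c d z -> al < Re z < be -> (F1 z * f z = F2 z)%A).
  { intros z Hz Hre. destruct (HVex z Hz) as [m Hm].
    apply (converges_unique (fun n => fst (fst (x n)) z * f z)%A).
    - apply converges_mul_r. apply (proj2 (HF1 m)). split; [exact Hm | lra].
    - apply (converges_ext (fun n => snd (fst (x n)) z) _ _ m).
      + intros n Hn. symmetry. apply (proj1 (Hx n)); [exact Hre|].
        assert (HVn : V n z).
        { clear - HVS Hm Hn. induction Hn; auto. }
        apply (HVB n z HVn).
      + apply (proj2 (HF2 m)). split; [exact Hm | lra]. }
  (* F1 and F2 are extended across the lines Re z = be and Re z = al by F1 * f = F2 *)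
  exists (fun z => if Rlt_dec (Re z) be then F1 z else (F2 z * inv (f z))%A).
  exists (fun z => if Rlt_dec al (Re z) then F2 z else (F1 z * f z)%A).
  assert (Halbe : a2 < al < be) by lra.
  split; [|split].
  - intros z Hz. destruct (Rlt_le_dec (Re z) be) as [Hlt|Hle].
    + assert (Hz' : orect a1 b2 c d z /\ Re z < be) by (unfold orect in *; lra).
      split.
      * apply (cdiff_open (fun z => Re z < be) F1); [apply open_Re_lt | exact Hlt | | now apply HolF1].
        intros w Hw. destruct (Rlt_dec (Re w) be); [reflexivity | contradiction].
      * destruct (Rlt_dec (Re z) be); [now apply HolF1 | contradiction].
    + assert (HU : forall w, orect al b1 c d w -> (orect a1 b2 c d w /\ al < Re w) /\ orect a2 b1 c d w)
        by (unfold orect in *; intros; lra).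
      assert (Hz' : orect al b1 c d z) by (unfold orect in *; lra).
      split.
      * apply (cdiff_open (orect al b1 c d) (fun z => F2 z * inv (f z))%A); [apply open_orect | exact Hz' | |].
        -- intros w Hw. destruct (Rlt_dec (Re w) be); [|reflexivity].
           rewrite <- HF by (unfold orect in *; lra).
           destruct (Hf w (proj2 (HU w Hw))) as [_ Uw].
           replace (F1 w * f w * inv (f w))%A with (F1 w * (f w * inv (f w)))%A by nring.
           rewrite inv_r by exact Uw. nring.
        -- apply cdiff_mul; [now apply HolF2, HU|]. apply cdiff_inv; now apply Hf, HU.
      * destruct (Rlt_dec (Re z) be); [lra|].
        apply unit_mul; [now apply HolF2, HU | now apply unit_inv, Hf, HU].
  - intros z Hz. destruct (Rlt_le_dec al (Re z)) as [Hlt|Hle].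
    + assert (Hz' : orect a1 b2 c d z /\ al < Re z) by (unfold orect in *; lra).
      split.
      * apply (cdiff_open (fun z => al < Re z) F2); [apply open_Re_gt | exact Hlt | | now apply HolF2].
        intros w Hw. destruct (Rlt_dec al (Re w)); [reflexivity | contradiction].
      * destruct (Rlt_dec al (Re z)); [now apply HolF2 | contradiction].
    + assert (HU : forall w, orect a2 be c d w -> (orect a1 b2 c d w /\ Re w < be) /\ orect a2 b1 c d w)
        by (unfold orect in *; intros; lra).
      assert (Hz' : orect a2 be c d z) by (unfold orect in *; lra).
      split.
      * apply (cdiff_open (orect a2 be c d) (fun z => F1 z * f z)%A); [apply open_orect | exact Hz' | |].
        -- intros w Hw. destruct (Rlt_dec al (Re w)); [|reflexivity].
           apply HF; unfold orect in *; lra.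
        -- apply cdiff_mul; [now apply HolF1, HU | now apply Hf, HU].
      * destruct (Rlt_dec al (Re z)); [lra|].
        apply unit_mul; [now apply HolF1, HU | now apply Hf, HU].
  - intros z Hz. destruct (Hf z Hz) as [_ Uz].
    assert (Hz' : orect a1 b2 c d z) by (unfold orect in *; lra).
    destruct (Rlt_dec (Re z) be), (Rlt_dec al (Re z)); try lra.
    + apply HF; [exact Hz' | lra].
    + reflexivity.
    + replace (F2 z * inv (f z) * f z)%A with (F2 z * (inv (f z) * f z))%A by nring.
      rewrite inv_l by exact Uz. nring.
Qed.
End Exhaustion.

(** * Positions of two rectangles whose union is a rectangle *)

Section Splitting.
Context {A : BanachAlgebra}.
Implicit Types (f g : C -> A) (z w : C) (U V : C -> Prop).

Definition splits U V f := exists f1 f2, hol_units U f1 /\ hol_units V f2 /\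
  forall z, U z -> V z -> (f1 z * f z = f2 z)%A.

Lemma splits_swap U V f : hol_units (fun z => U z /\ V z) f ->
  splits V U (fun z => inv (f z)) -> splits U V f.
Proof.
  intros Hf [g1 [g2 [H1 [H2 H]]]]. exists g2, g1. split; [exact H2|]. split; [exact H1|].
  intros z HU HV. rewrite <- H by assumption. destruct (Hf z (conj HU HV)) as [_ Uz].
  replace (g1 z * inv (f z) * f z)%A with (g1 z * (inv (f z) * f z))%A by nring.
  rewrite inv_l by exact Uz. nring.
Qed.

Lemma splits_sub U V f : (forall z, V z -> U z) -> hol_units V f -> splits U V f.
Proof.
  intros H Hf. exists (fun _ => 1%A), f. split; [|split; [exact Hf|]].
  - intros z _. split; [apply cdiff_const | apply unit_1].
  - intros z _ _. nring.
Qed.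

Lemma splits_equiv U V U' V' f : (forall z, U z -> U' z) -> (forall z, V z -> V' z) ->
  splits U' V' f -> splits U V f.
Proof.
  intros HU HV [f1 [f2 [H1 [H2 H]]]]. exists f1, f2. split; [|split].
  - now apply (hol_units_sub U U').
  - now apply (hol_units_sub V V').
  - auto.
Qed.

Lemma hol_units_linear U f (k : C) : hol_units U f ->
  hol_units (fun z => U (k * z)%C) (fun z => f (k * z)%C).
Proof.
  intros Hf z Hz. destruct (Hf _ Hz) as [H1 H2]. split; [|exact H2].
  assert (E : forall w, (0 + k * w)%C = (k * w)%C) by (intros; ring).
  apply (cdiff_local (fun w => f (0 + k * w)%C) _ z 1 Rlt_0_1).
  - intros w _. now rewrite E.
  - apply cdiff_affine. now rewrite E.
Qed.

Lemma splits_rotate U V f :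
  splits (fun z => U (Ci * z)%C) (fun z => V (Ci * z)%C) (fun z => f (Ci * z)%C) -> splits U V f.
Proof.
  assert (E : forall z, (Ci * (- Ci * z))%C = z).
  { intros z. destruct z. apply injective_projections; simpl; ring. }
  intros [g1 [g2 [H1 [H2 H]]]].
  apply (hol_units_linear _ _ (- Ci)%C) in H1. apply (hol_units_linear _ _ (- Ci)%C) in H2.
  exists (fun z => g1 (- Ci * z)%C), (fun z => g2 (- Ci * z)%C). split; [|split].
  - apply (hol_units_sub _ _ _ (fun z (Hz : U z) => eq_ind_r U Hz (E z)) H1).
  - apply (hol_units_sub _ _ _ (fun z (Hz : V z) => eq_ind_r V Hz (E z)) H2).
  - intros z HU HV. rewrite <- H by now rewrite E. now rewrite E.
Qed.

Lemma splits_beside (a1 b1 a2 b2 c d : R) f : a1 <= a2 -> a2 < b1 -> b1 <= b2 -> c < d ->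
  hol_units (fun z => orect a1 b1 c d z /\ orect a2 b2 c d z) f ->
  splits (orect a1 b1 c d) (orect a2 b2 c d) f.
Proof.
  intros Ha Hab Hb Hcd Hf.
  destruct (cartan_open a1 b1 a2 b2 c d f Ha Hab Hb Hcd) as [f1 [f2 [H1 [H2 H]]]].
  - apply (hol_units_sub _ (fun z => orect a1 b1 c d z /\ orect a2 b2 c d z)); [|exact Hf].
    unfold orect. intros; lra.
  - exists f1, f2. split; [exact H1|]. split; [exact H2|]. intros z Hz1 Hz2. apply H. unfold orect in *; lra.
Qed.
Lemma splits_above (a b c1 d1 c2 d2 : R) f : c1 <= c2 -> c2 < d1 -> d1 <= d2 -> a < b ->
  hol_units (fun z => orect a b c1 d1 z /\ orect a b c2 d2 z) f ->
  splits (orect a b c1 d1) (orect a b c2 d2) f.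
Proof.
  intros Hc Hcd Hd Hab Hf. apply splits_rotate.
  assert (E : forall u v z, orect a b u v (Ci * z)%C <-> orect u v (- b) (- a) z).
  { intros u v [x y]. unfold orect. simpl.
    replace (0 * x - 1 * y) with (- y) by ring. replace (0 * y + 1 * x) with x by ring. lra. }
  apply (splits_equiv _ _ (orect c1 d1 (- b) (- a)) (orect c2 d2 (- b) (- a))); [apply E | apply E |].
  apply splits_beside; try lra.
  apply (hol_units_sub _ (fun z => orect a b c1 d1 (Ci * z)%C /\ orect a b c2 d2 (Ci * z)%C)).
  - intros z [Hz1 Hz2]. split; now apply E.
  - exact (hol_units_linear _ _ Ci Hf).
Qed.
End Splitting.

(** A point of an interval so close to its left end that any of two given numbers
    below it is already below that end. *)
Lemma near_low a b u v : a < b -> exists x, a < x < b /\ (u < x -> u <= a) /\ (v < x -> v <= a).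
Proof.
  intros H.
  assert (Hm : forall m w : R, a < m -> exists m', a < m' <= m /\ (w < m' -> w <= a)).
  { intros m w Hm. destruct (Rlt_le_dec a w).
    - exists (Rmin m w). split; [split; [now apply Rmin_glb_lt | apply Rmin_l]|].
      intros Hw. pose proof (Rmin_r m w). lra.
    - exists m. lra. }
  destruct (Hm ((a + b) / 2) u) as [m [Hm1 Hm2]]; [lra|]. destruct (Hm m v) as [x [Hx1 Hx2]]; [lra|].
  exists x. split; [lra|]. split; [|exact Hx2]. intros Hu. apply Hm2. lra.
Qed.

Lemma near_high a b u v : a < b -> exists x, a < x < b /\ (x < u -> b <= u) /\ (x < v -> b <= v).
Proof.
  intros H. destruct (near_low (- b) (- a) (- u) (- v)) as [x [H1 [H2 H3]]]; [lra|].
  exists (- x). split; [lra|]. split; intros; [specialize (H2 ltac:(lra)) | specialize (H3 ltac:(lra))]; lra.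
Qed.

Lemma subinterval u v a b : u < v -> (forall x, u < x < v -> a < x < b) -> a <= u /\ v <= b.
Proof.
  intros H Hx. split; apply Rnot_lt_le; intros Hlt.
  - destruct (near_low u v a a H) as [x [H1 [H2 _]]]. destruct (Hx x H1) as [H3 _]. specialize (H2 H3). lra.
  - destruct (near_high u v b b H) as [x [H1 [H2 _]]]. destruct (Hx x H1) as [_ H3]. specialize (H2 H3). lra.
Qed.

Lemma cover_overlap a b u1 v1 u2 v2 : a <= u1 -> u1 < v1 -> u2 < v2 -> v2 <= b ->
  (forall x, a < x < b -> u1 < x < v1 \/ u2 < x < v2) -> u2 < v1.
Proof.
  intros Ha H1 H2 Hb Hx. apply Rnot_le_lt. intros Hle. destruct (Hx v1); lra.
Qed.

(** Each corner of the union is a corner of one of the two rectangles.  A rectangle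
    with two opposite corners is the union; otherwise each rectangle has two
    adjacent ones. *)
Lemma rectangle_union_cases (a1 b1 c1 d1 a2 b2 c2 d2 a b c d : R) :
  a1 < b1 -> c1 < d1 -> a2 < b2 -> c2 < d2 ->
  (forall z, orect a1 b1 c1 d1 z \/ orect a2 b2 c2 d2 z <-> orect a b c d z) ->
  (a1 <= a2 /\ b2 <= b1 /\ c1 <= c2 /\ d2 <= d1) \/
  (a2 <= a1 /\ b1 <= b2 /\ c2 <= c1 /\ d1 <= d2) \/
  (c1 = c2 /\ d1 = d2 /\ ((a1 <= a2 /\ a2 < b1 /\ b1 <= b2) \/ (a2 <= a1 /\ a1 < b2 /\ b2 <= b1))) \/
  (a1 = a2 /\ b1 = b2 /\ ((c1 <= c2 /\ c2 < d1 /\ d1 <= d2) \/ (c2 <= c1 /\ c1 < d2 /\ d2 <= d1))).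
Proof.
  intros H1 H1' H2 H2' HU.
  assert (Hin : forall x y, (a1 < x < b1 /\ c1 < y < d1) \/ (a2 < x < b2 /\ c2 < y < d2) ->
     a < x < b /\ c < y < d) by (intros x y; exact (proj1 (HU (x, y)))).
  assert (Hcov : forall x y, a < x < b -> c < y < d ->
     (a1 < x < b1 /\ c1 < y < d1) \/ (a2 < x < b2 /\ c2 < y < d2))
    by (intros x y Hx Hy; exact (proj2 (HU (x, y)) (conj Hx Hy))).
  clear HU.
  assert (M1 : c1 < (c1 + d1) / 2 < d1) by lra. assert (M1' : a1 < (a1 + b1) / 2 < b1) by lra.
  assert (M2 : c2 < (c2 + d2) / 2 < d2) by lra. assert (M2' : a2 < (a2 + b2) / 2 < b2) by lra.
  destruct (subinterval a1 b1 a b H1) as [Sa1 Sb1].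
  { intros x Hx. exact (proj1 (Hin x _ (or_introl (conj Hx M1)))). }
  destruct (subinterval c1 d1 c d H1') as [Sc1 Sd1].
  { intros y Hy. exact (proj2 (Hin _ y (or_introl (conj M1' Hy)))). }
  destruct (subinterval a2 b2 a b H2) as [Sa2 Sb2].
  { intros x Hx. exact (proj1 (Hin x _ (or_intror (conj Hx M2)))). }
  destruct (subinterval c2 d2 c d H2') as [Sc2 Sd2].
  { intros y Hy. exact (proj2 (Hin _ y (or_intror (conj M2' Hy)))). }
  clear Hin M1 M1' M2 M2'.
  assert (Hab : a < b) by lra. assert (Hcd : c < d) by lra.
  destruct (near_low a b a1 a2 Hab) as [xl [Hxl [Hxl1 Hxl2]]].
  destruct (near_high a b b1 b2 Hab) as [xh [Hxh [Hxh1 Hxh2]]].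
  destruct (near_low c d c1 c2 Hcd) as [yl [Hyl [Hyl1 Hyl2]]].
  destruct (near_high c d d1 d2 Hcd) as [yh [Hyh [Hyh1 Hyh2]]].
  assert (Gx : forall x, a < x < b -> a1 < x < b1 \/ a2 < x < b2).
  { intros x Hx. destruct (Hcov x yl Hx Hyl) as [[Hx' _]|[Hx' _]]; auto. }
  assert (Gy : forall y, c < y < d -> c1 < y < d1 \/ c2 < y < d2).
  { intros y Hy. destruct (Hcov xl y Hxl Hy) as [[_ Hy']|[_ Hy']]; auto. }
  pose proof (cover_overlap a b a1 b1 a2 b2 Sa1 H1 H2 Sb2 Gx) as Ox1.
  pose proof (cover_overlap a b a2 b2 a1 b1 Sa2 H2 H1 Sb1 (fun x Hx => proj1 (or_comm _ _) (Gx x Hx))) as Ox2.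
  pose proof (cover_overlap c d c1 d1 c2 d2 Sc1 H1' H2' Sd2 Gy) as Oy1.
  pose proof (cover_overlap c d c2 d2 c1 d1 Sc2 H2' H1' Sd1 (fun y Hy => proj1 (or_comm _ _) (Gy y Hy))) as Oy2.
  (* a point near each corner of the union shows which rectangle has that corner *)
  assert (LL : (a1 <= a /\ c1 <= c) \/ (a2 <= a /\ c2 <= c)).
  { destruct (Hcov xl yl Hxl Hyl) as [[[X _] [Y _]]|[[X _] [Y _]]]; auto. }
  assert (HL : (b <= b1 /\ c1 <= c) \/ (b <= b2 /\ c2 <= c)).
  { destruct (Hcov xh yl Hxh Hyl) as [[[_ X] [Y _]]|[[_ X] [Y _]]]; auto. }
  assert (LH : (a1 <= a /\ d <= d1) \/ (a2 <= a /\ d <= d2)).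
  { destruct (Hcov xl yh Hxl Hyh) as [[[X _] [_ Y]]|[[X _] [_ Y]]]; auto. }
  assert (HH : (b <= b1 /\ d <= d1) \/ (b <= b2 /\ d <= d2)).
  { destruct (Hcov xh yh Hxh Hyh) as [[[_ X] [_ Y]]|[[_ X] [_ Y]]]; auto. }
  clear Hcov Gx Gy Hxl Hxl1 Hxl2 Hxh Hxh1 Hxh2 Hyl Hyl1 Hyl2 Hyh Hyh1 Hyh2.
  destruct LL as [[LL LL']|[LL LL']], HH as [[HH HH']|[HH HH']];
    [left; clear HL LH; lra | | | right; left; clear HL LH; lra].
  - destruct HL as [[HL HL']|[HL HL']], LH as [[LH LH']|[LH LH']]; [left; lra | | | right; left; lra].
    + right; right; right. split; [lra|]. split; [lra|]. left. lra.
    + right; right; left. split; [lra|]. split; [lra|]. left. lra.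
  - destruct HL as [[HL HL']|[HL HL']], LH as [[LH LH']|[LH LH']]; [left; lra | | | right; left; lra].
    + right; right; left. split; [lra|]. split; [lra|]. right. lra.
    + right; right; right. split; [lra|]. split; [lra|]. right. lra.
Qed.

Lemma splits_rectangles {A : BanachAlgebra} (a1 b1 c1 d1 a2 b2 c2 d2 a b c d : R) (f : C -> A) :
  a1 < b1 -> c1 < d1 -> a2 < b2 -> c2 < d2 ->
  (forall z, orect a1 b1 c1 d1 z \/ orect a2 b2 c2 d2 z <-> orect a b c d z) ->
  hol_units (fun z => orect a1 b1 c1 d1 z /\ orect a2 b2 c2 d2 z) f ->
  splits (orect a1 b1 c1 d1) (orect a2 b2 c2 d2) f.
Proof.
  intros H1 H1' H2 H2' HU Hf.
  pose proof (hol_units_inv _ _ Hf) as Hi.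
  pose proof (hol_units_sub _ _ _ (fun z Hz => conj (proj2 Hz) (proj1 Hz)) Hi) as Hi'.
  destruct (rectangle_union_cases _ _ _ _ _ _ _ _ _ _ _ _ H1 H1' H2 H2' HU)
    as [H|[H|[[-> [-> [H|H]]]|[-> [-> [H|H]]]]]].
  - apply splits_sub; [unfold orect; intros; lra|].
    refine (hol_units_sub _ _ f _ Hf). unfold orect. intros; lra.
  - apply splits_swap; [exact Hf|]. apply splits_sub; [unfold orect; intros; lra|].
    refine (hol_units_sub _ _ _ _ Hi). unfold orect. intros; lra.
  - apply splits_beside; try lra. exact Hf.
  - apply splits_swap; [exact Hf|]. apply splits_beside; try lra. exact Hi'.
  - apply splits_above; try lra. exact Hf.
  - apply splits_swap; [exact Hf|]. apply splits_above; try lra. exact Hi'.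
Qed.

Lemma hol_units_holomorphic {A : BanachAlgebra} (U : C -> Prop) (f : C -> A) :
  hol_units U f <-> holomorphic_into_units U f.
Proof.
  split.
  - intros H. split; intros z Hz; [now apply cdiff_ex_derive, H | now apply H].
  - intros [H1 H2] z Hz. split; [now apply cdiff_ex_derive, H1 | now apply H2].
Qed.

Theorem mainTheorem5 (A : BanachAlgebra) (R1 R2 : C -> Prop)
  (hR1 : is_rectangle R1) (hR2 : is_rectangle R2)
  (hR : is_rectangle (fun z => R1 z \/ R2 z))
  (f : C -> A)
  (hf : holomorphic_into_units (fun z => R1 z /\ R2 z) f) :
  exists f1 f2 : C -> A,
    holomorphic_into_units R1 f1 /\
    holomorphic_into_units R2 f2 /\
    forall z : C, R1 z /\ R2 z -> f z = mult (inverse (f1 z)) (f2 z).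
Proof.
  destruct hR1 as [[z1 Hz1] [a1 [b1 [c1 [d1 H1]]]]]. destruct hR2 as [[z2 Hz2] [a2 [b2 [c2 [d2 H2]]]]].
  destruct hR as [_ [a [b [c [d H]]]]].
  apply hol_units_holomorphic in hf.
  pose proof (proj1 (H1 z1) Hz1) as N1. pose proof (proj1 (H2 z2) Hz2) as N2.
  assert (S : splits R1 R2 f).
  { apply (splits_equiv _ _ (orect a1 b1 c1 d1) (orect a2 b2 c2 d2)); [apply H1 | apply H2 |].
    apply (splits_rectangles _ _ _ _ _ _ _ _ a b c d); try lra.
    - intros z. unfold orect. rewrite <- H, H1, H2. reflexivity.
    - apply (hol_units_sub _ _ _ (fun z Hz => conj (proj2 (H1 z) (proj1 Hz)) (proj2 (H2 z) (proj2 Hz))) hf). }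
  destruct S as [f1 [f2 [F1 [F2 F]]]]. exists f1, f2.
  split; [now apply hol_units_holomorphic|]. split; [now apply hol_units_holomorphic|].
  intros z [Hr1 Hr2]. destruct (F1 z Hr1) as [_ U1].
  change (f z = (inv (f1 z) * f2 z)%A). rewrite <- F by assumption.
  replace (inv (f1 z) * (f1 z * f z))%A with (inv (f1 z) * f1 z * f z)%A by nring.
  rewrite inv_l by exact U1. nring.
Qed.
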